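(* Let $f:\Omega\times\mathbb R\to\mathbb R$ satisfy the structural assumption (A) stated in the context. Let $z\in L^p(\Omega)$ with $$p>\tfrac{N}{2s}\ \text{ if } N>2s,\qquad p>1\ \text{ if } N=2s,\qquad p=1\ \text{ if } N<2s .$$ Then every weak solution $u\in\mathcal V_0$ of $(L_D)^su+f(x,u)=z$ in $\Omega$ belongs to $L^\infty(\Omega)$, and there is a constant $C=C(N,s,p,\Omega)>0$ such that $$\|u\|_{L^\infty(\Omega)}\le C\|z\|_{L^p(\Omega)} .$$
   Context: Setting. $N\ge 1$, $0<s<1$, and $\Omega\subset\mathbb R^N$ is an arbitrary bounded open set. The coefficients $a_{ij}\in L^\infty(\Omega)$ are real, measurable, symmetric ($a_{ij}=a_{ji}$ a.e.) and elliptic: there is $\gamma>0$ with $\sum_{i,j}a_{ij}(x)\xi_i\xi_j\ge\gamma|\xi|^2$ for all $\xi\in\mathbb R^N$ and a.e. $x\in\Omega$. $L_D$ is the positive self-adjoint operator on $L^2(\Omega)$ associated with the closed form $\mathcal E_D(u,v)=\sum_{i,j}\int_\Omega a_{ij}D_iu\,D_jv\,dx$, $u,v\in H^1_0(\Omega)$. It has compact resolvent, eigenvalues $0<\lambda_1\le\lambda_2\le\cdots\to\infty$ and an orthonormal basis of eigenfunctions $(\varphi_n)$ of $L^2(\Omega)$. For $\theta\ge0$, $\mathbb H^\theta(\Omega)=\{u\in L^2(\Omega):\|u\|^2_{\mathbb H^\theta(\Omega)}:=\sum_n\lambda_n^\theta u_n^2<\infty\}$, with $u_n=\int_\Omega u\varphi_n\,dx$.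 Powers are defined spectrally, $(L_D)^{\alpha}u=\sum_n\lambda_n^{\alpha}u_n\varphi_n$, so $\|u\|_{\mathbb H^s(\Omega)}=\|(L_D)^{s/2}u\|_{L^2(\Omega)}$. The operator $L_D$ is fixed, and constants said to depend on $\Omega$ may also depend on $L_D$. Assumption (A) on $f$. For a.e. $x\in\Omega$: $f(x,\cdot)$ is odd, strictly increasing, continuous, $f(x,0)=0$, and $\lim_{t\to\infty}f(x,t)=\infty$; for all $t$, $f(\cdot,t)$ is measurable. Let $\widetilde f(x,\cdot)$ be the inverse of $f(x,\cdot)$, $F(x,t)=\int_0^{|t|}f(x,\tau)\,d\tau$, $\widetilde F(x,t)=\int_0^{|t|}\widetilde f(x,\tau)\,d\tau$. There are constants $c_1,c_2\in(0,1]$ independent of $x$ such that for a.e. $x\in\Omega$ and all $t\in\mathbb R$: $c_1tf(x,t)\le F(x,t)\le tf(x,t)$ and $c_2t\widetilde f(x,t)\le\widetilde F(x,t)\le t\widetilde f(x,t)$. Space and weak solutions. $\mathcal V_0=\{u\in\mathbb H^s(\Omega):F(\cdot,u(\cdot))\in L^1(\Omega)\}$. A weak solution of $(L_D)^su+f(x,u)=z$ is $u\in\mathcal V_0$ with $\int_\Omega(L_D)^{s/2}u\,(L_D)^{s/2}v\,dx+\int_\Omega f(x,u)v\,dx=\langle z,v\rangle$ for all $v\in\mathcal V_0$, where $\langle z,v\rangle=\int_\Omega zv\,dx$ for $z\in L^p(\Omega)$ as in the claim. *)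

(* Defs.v *)
From HB Require Import structures.
From mathcomp Require Import all_boot all_order all_algebra.
From mathcomp Require Import all_classical all_reals all_analysis.

Set Implicit Arguments.
Unset Strict Implicit.
Unset Printing Implicit Defensive.

Import Order.TTheory GRing.Theory Num.Theory.
Import numFieldNormedType.Exports.

Local Open Scope classical_set_scope.
Local Open Scope ring_scope.

(** The N-fold product of the one-dimensional Lebesgue measure is built by
    recursion on tuples, transported to ['rV[R]_N], and completed. The measurable
    sets are therefore all Lebesgue-measurable sets, not only the Borel ones:
    this is needed for [x |-> f x (u x)] to be measurable when [f x] is
    continuous only for almost every [x]. *)

Section tuple_measure.
Context {R : realType} (n : nat).
Local Notation T := (measurableTypeR R).

Definition cons_pair (z : T * n.-tuple T) : n.+1.-tuple T :=
  [tuple of z.1 :: z.2].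

Lemma measurable_cons_pair : measurable_fun [set: T * n.-tuple T] cons_pair.
Proof. exact: measurable_cons. Qed.

Variable m : {sigma_finite_measure set (n.-tuple T) -> \bar R}.

Definition cons_measure : set (n.+1.-tuple T) -> \bar R :=
  pushforward (@lebesgue_measure R \x m)%E cons_pair.

Let cons_measure0 : cons_measure set0 = 0%E.
Proof. by rewrite /cons_measure /pushforward preimage_set0 measure0. Qed.

Let cons_measure_ge0 A : (0 <= cons_measure A)%E.
Proof. exact: (measure_ge0 (@lebesgue_measure R \x m)%E). Qed.

Let cons_measure_sigma_additive : semi_sigma_additive cons_measure.
Proof.
move=> F mF tF mUF; rewrite /cons_measure /pushforward preimage_bigcup.
apply: measure_semi_sigma_additive.
- by move=> k; rewrite -[X in measurable X]setTI; exact: measurable_cons_pair.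
- apply/trivIsetP => /= i j _ _ ij; rewrite -preimage_setI.
  by move/trivIsetP : tF => /(_ _ _ _ _ ij) ->//; rewrite preimage_set0.
- rewrite -preimage_bigcup -[X in measurable X]setTI.
  exact: measurable_cons_pair.
Qed.

HB.instance Definition _ := isMeasure.Build _ _ _ cons_measure
  cons_measure0 cons_measure_ge0 cons_measure_sigma_additive.

Let cons_measure_sigma_finite : sigma_finite setT cons_measure.
Proof.
have /sigma_finiteP[F [FT ndF Foo]] := sigma_finiteT (@lebesgue_measure R).
have /sigma_finiteP[G [GT ndG Goo]] := sigma_finiteT m.
pose uncons (t : n.+1.-tuple T) : T * n.-tuple T := (thead t, [tuple of behead t]).
have unconsK : cancel uncons cons_pair.
  by move=> t; rewrite /uncons /cons_pair /= [RHS]tuple_eta.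
have cons_pairK : cancel cons_pair uncons.
  move=> [x t]; rewrite /uncons /cons_pair /= theadE; congr pair.
  exact: val_inj.
have muncons : measurable_fun setT uncons.
  apply/measurable_fun_pairP; split; last exact: measurable_behead.
  exact: measurable_tnth.
exists (fun k => uncons @^-1` (F k `*` G k)).
  apply/seteqP; split=> // t _.
  have [i _ Fi] : (\bigcup_k F k) (uncons t).1 by rewrite -FT.
  have [j _ Gj] : (\bigcup_k G k) (uncons t).2 by rewrite -GT.
  exists (maxn i j) => //; split.
  - by move: Fi; exact/subsetPset/ndF/leq_maxl.
  - by move: Gj; exact/subsetPset/ndG/leq_maxr.
move=> k; have [mF Fk] := Foo k; have [mG Gk] := Goo k; split.
  by rewrite -[X in measurable X]setTI; apply: muncons => //; exact: measurableX.
rewrite /cons_measure /pushforward -comp_preimage.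
rewrite (_ : uncons \o cons_pair = id); last exact/funext.
by rewrite preimage_id product_measure1E// lte_mul_pinfty// ge0_fin_numE.
Qed.

HB.instance Definition _ := Measure_isSigmaFinite.Build _ _ _ cons_measure
  cons_measure_sigma_finite.

End tuple_measure.

Fixpoint tuple_lebesgue (R : realType) (n : nat) :
    {sigma_finite_measure set (n.-tuple (measurableTypeR R)) -> \bar R} :=
  match n with
  | 0 => \d_([tuple] : 0.-tuple (measurableTypeR R))
  | n'.+1 => cons_measure (tuple_lebesgue R n')
  end.

Section lebesgue_rV.
Context (R : realType) (N : nat).
Local Notation T := (measurableTypeR R).

Definition tuple_of_rV (v : 'rV[R]_N) : N.-tuple T := [tuple v ord0 i | i < N].

Definition borel_rV := g_sigma_algebra_preimageType tuple_of_rV.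

Definition rV_of_tuple (t : N.-tuple T) : borel_rV := (\row_i tnth t i : 'rV[R]_N).

Lemma rV_of_tupleK : cancel rV_of_tuple tuple_of_rV.
Proof. by move=> t; apply/eq_from_tnth => i; rewrite tnth_mktuple mxE. Qed.

Lemma measurable_rV_of_tuple : measurable_fun setT rV_of_tuple.
Proof.
move=> _ _ [B mB <-]; rewrite !setTI -comp_preimage.
by rewrite (_ : _ \o _ = id)//; apply/funext => t; exact: rV_of_tupleK.
Qed.

Definition lebesgue_borel : set borel_rV -> \bar R :=
  pushforward (tuple_lebesgue R N) rV_of_tuple.

Let lebesgue_borel0 : lebesgue_borel set0 = 0%E.
Proof. by rewrite /lebesgue_borel /pushforward preimage_set0 measure0. Qed.

Let lebesgue_borel_ge0 A : (0 <= lebesgue_borel A)%E.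
Proof. exact: (measure_ge0 (tuple_lebesgue R N)). Qed.

Let lebesgue_borel_sigma_additive : semi_sigma_additive lebesgue_borel.
Proof.
move=> F mF tF mUF; rewrite /lebesgue_borel /pushforward preimage_bigcup.
apply: measure_semi_sigma_additive.
- by move=> k; rewrite -[X in measurable X]setTI; exact: measurable_rV_of_tuple.
- apply/trivIsetP => /= i j _ _ ij; rewrite -preimage_setI.
  by move/trivIsetP : tF => /(_ _ _ _ _ ij) ->//; rewrite preimage_set0.
- rewrite -preimage_bigcup -[X in measurable X]setTI.
  exact: measurable_rV_of_tuple.
Qed.

HB.instance Definition _ := isMeasure.Build _ _ _ lebesgue_borel
  lebesgue_borel0 lebesgue_borel_ge0 lebesgue_borel_sigma_additive.

Let lebesgue_borel_sigma_finite : sigma_finite setT lebesgue_borel.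
Proof.
have [F FT Foo] := sigma_finiteT (tuple_lebesgue R N).
exists (fun k => tuple_of_rV @^-1` F k).
  by rewrite -preimage_bigcup -FT preimage_setT.
move=> k; have [mF Fk] := Foo k; split; first by exists (F k); rewrite ?setTI.
rewrite /lebesgue_borel /pushforward -comp_preimage.
by rewrite (_ : _ \o _ = id)//; apply/funext => t; exact: rV_of_tupleK.
Qed.

HB.instance Definition _ := Measure_isSigmaFinite.Build _ _ _ lebesgue_borel
  lebesgue_borel_sigma_finite.

Definition euclid : measurableType _ := caratheodory_type (mu_ext lebesgue_borel).

Definition leb : set euclid -> \bar R :=
  @completed_measure_extension _ _ _ lebesgue_borel.

HB.instance Definition _ := Measure.on leb.

HB.instance Definition _ := Measure_isSigmaFinite.Build _ _ _ leb
  (completed_measure_extension_sigma_finite (sigma_finiteT lebesgue_borel)).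

End lebesgue_rV.
Arguments leb {R N}.

Section function_spaces.
Context {R : realType} {N : nat}.
Local Notation RN := 'rV[R]_N.
Variable Omega : set RN.

Definition integral_on (u : RN -> R) : R := (\int[@leb R N]_(x in Omega) u x)%R.

Definition almost_everywhere_in (P : RN -> Prop) : Prop :=
  {ae @leb R N, forall x : RN, Omega x -> P x}.

Definition norm_Lp (p : \bar R) (u : RN -> R) : \bar R :=
  ('N[@leb R N]_p[EFin \o (u \_ Omega)])%E.

Definition Lp (p : \bar R) (u : RN -> R) : Prop :=
  measurable_fun (Omega : set (euclid R N)) u /\ (norm_Lp p u < +oo)%E.

Definition L1 (u : RN -> R) : Prop :=
  (@leb R N).-integrable Omega (EFin \o u).

Definition L2 := Lp 2%:E.

Definition cvg_L2 (u_ : nat -> RN -> R) (u : RN -> R) : Prop :=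
  (fun k => norm_Lp 2%:E (u_ k \- u)) @ \oo --> 0%E.

Definition partial (i : 'I_N) (psi : RN -> R) : RN -> R :=
  fun x => 'D_(delta_mx 0 i) (psi : RN -> R^o) x.

Definition smooth (psi : RN -> R) : Prop :=
  forall (l : seq 'I_N) (x : RN),
    differentiable (foldr partial psi l : RN -> R^o) x.

(** C_c^oo(Omega), whose elements are extended by zero to the whole space. *)
Definition test_function (psi : RN -> R) : Prop :=
  [/\ smooth psi, compact (closure [set x | psi x != 0])
    & closure [set x | psi x != 0] `<=` Omega].

Definition weak_partial (i : 'I_N) (u g : RN -> R) : Prop :=
  forall psi, test_function psi ->
    integral_on (fun x => u x * partial i psi x) = - integral_on (fun x => g x * psi x).

(** In [in_H1 u Du] and [in_H10 u Du], [Du] is a representative of the weak gradient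
    of [u]. *)
Definition in_H1 (u : RN -> R) (Du : 'I_N -> RN -> R) : Prop :=
  [/\ L2 u, forall i, L2 (Du i) & forall i, weak_partial i u (Du i)].

Definition in_H10 (u : RN -> R) (Du : 'I_N -> RN -> R) : Prop :=
  in_H1 u Du /\
  exists psi : nat -> RN -> R,
    [/\ forall k, test_function (psi k), cvg_L2 psi u
      & forall i, cvg_L2 (fun k => partial i (psi k)) (Du i)].

(** The vector norm of [RN] in the library is the maximum norm, so that the
    Euclidean norm of [xi] is written as a sum of squares. *)
Definition elliptic_coefficients (a : 'I_N -> 'I_N -> RN -> R) : Prop :=
  [/\ forall i j, Lp +oo%E (a i j),
      forall i j, almost_everywhere_in (fun x => a i j x = a j i x)
    & exists2 gamma : R, 0 < gamma &
        almost_everywhere_in (fun x => forall xi : RN,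
          gamma * (\sum_(i < N) xi 0 i ^+ 2) <=
            \sum_(i < N) \sum_(j < N) a i j x * xi 0 i * xi 0 j)].

Definition form_D (a : 'I_N -> 'I_N -> RN -> R) (Du Dv : 'I_N -> RN -> R) : R :=
  \sum_(i < N) \sum_(j < N) integral_on (fun x => a i j x * Du i x * Dv j x).

(** L_D as a graph: [u] is in its domain and [w] is the image of [u]. *)
Definition L_D (a : 'I_N -> 'I_N -> RN -> R) (u w : RN -> R) : Prop :=
  L2 w /\ exists2 Du, in_H10 u Du &
    forall v Dv, in_H10 v Dv -> form_D a Du Dv = integral_on (fun x => w x * v x).

Definition coef (phi : nat -> RN -> R) (u : RN -> R) (n : nat) : R :=
  integral_on (fun x => u x * phi n x).

Definition eigenbasis (a : 'I_N -> 'I_N -> RN -> R)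
    (lambda : nat -> R) (phi : nat -> RN -> R) : Prop :=
  [/\ [/\ forall n, 0 < lambda n, {homo lambda : m n / (m <= n)%N >-> m <= n}
        & lambda @ \oo --> +oo],
      forall n, L_D a (phi n) (fun x => lambda n * phi n x),
      forall m n, integral_on (fun x => phi m x * phi n x) = (m == n)%:R
    & forall u, L2 u ->
        cvg_L2 (fun n x => \sum_(k < n) coef phi u k * phi k x) u].

Section spectral_powers.
Variables (lambda : nat -> R) (phi : nat -> RN -> R).

Definition Hspace (theta : R) (u : RN -> R) : Prop :=
  L2 u /\
  (\sum_(0 <= n <oo) (lambda n `^ theta * coef phi u n ^+ 2)%:E < +oo)%E.

(** The sum of the series in L^2(Omega); it converges when [u] is in
    [Hspace (2 * alpha)], and the value is 0 if it diverges. *)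
Definition power_L_D (alpha : R) (u : RN -> R) : RN -> R :=
  xget (fun=> 0) [set w | L2 w /\
    cvg_L2 (fun n x => \sum_(k < n) lambda k `^ alpha * coef phi u k * phi k x)
      w].

End spectral_powers.

Definition inverse_in_t (f : RN -> R -> R) (x : RN) (t : R) : R :=
  xget 0 [set r | f x r = t].

Definition primitive (f : RN -> R -> R) (x : RN) (t : R) : R :=
  (\int[lebesgue_measure]_(tau in `[0%R, `|t|]) f x tau)%R.

Definition assumption_A (f : RN -> R -> R) : Prop :=
  [/\ almost_everywhere_in (fun x =>
        [/\ forall t, f x (- t) = - f x t,
            {homo f x : t1 t2 / t1 < t2},
            continuous (f x), f x 0 = 0 & f x t @[t --> +oo] --> +oo]),
      forall t, measurable_fun (Omega : set (euclid R N)) (f ^~ t)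
    & exists c1 c2 : R, [/\ 0 < c1 <= 1, 0 < c2 <= 1
        & almost_everywhere_in (fun x => forall t : R,
            let F := primitive f in
            let ft := inverse_in_t f in
            let Ft := primitive ft in
            c1 * (t * f x t) <= F x t <= t * f x t /\
            c2 * (t * ft x t) <= Ft x t <= t * ft x t)]].

Definition V0 (s : R) (lambda : nat -> R) (phi : nat -> RN -> R)
    (f : RN -> R -> R) (u : RN -> R) : Prop :=
  Hspace lambda phi s u /\ L1 (fun x => primitive f x (u x)).

Definition weak_solution (s : R) (lambda : nat -> R) (phi : nat -> RN -> R)
    (f : RN -> R -> R) (z u : RN -> R) : Prop :=
  V0 s lambda phi f u /\
  forall v, V0 s lambda phi f v ->
    integral_on (fun x => power_L_D lambda phi (s / 2) u x *
                       power_L_D lambda phi (s / 2) v x) +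
    integral_on (fun x => f x (u x) * v x) = integral_on (fun x => z x * v x).

End function_spaces.

Definition admissible_exponent {R : realType} (N : nat) (s : R) (p : \bar R) : Prop :=
  [/\ 2 * s < N%:R -> ((N%:R / (2 * s))%:E < p)%E,
      N%:R = 2 * s -> (1 < p)%E
    & N%:R < 2 * s -> p = 1%E].

(* Main.v *)
(** Everything rests on truncation and translation. The resolvent quadratic form
    [q_t v = \sum_n lam_n / (lam_n + t) * v_n ^+ 2] satisfies
    [t * q_t v = inf_u (E u + t * `|v - u| ^+ 2)], where [E] is the elliptic form and [u]
    runs over the test functions; as contractions of the real line do
    not increase [E], they do not increase [q_t], and as [lam `^ s] is a positive
    mixture of the functions [lam / (lam + t)], they do not increase the energy
    [\sum_n lam_n `^ s * v_n ^+ 2] either. Testing the equation with the truncation [v]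
    of [u] between the levels [k < h] therefore gives [energy v <= \int z v], the
    monotone term being nonnegative. The same variational formula bounds
    [\int `|v (x + y) - v x| ^+ 2] by [C * r `^ (2 * s) * energy v] when [`|y| <= r]. With
    [r ^+ N] comparable to [mu {`|u| > k}], some such [y] moves half of [{`|u| > h}] off
    [{`|u| > k}], which yields
    [(h - k) * mu {`|u| > h} <= C * `|z|_p * mu {`|u| > k} `^ (1 - 1 / p + 2 * s / N)];
    the exponent exceeds [1] and Stampacchia's lemma concludes. *)

Require Import Defs.
From HB Require Import structures.
From mathcomp Require Import all_boot all_order all_algebra.
From mathcomp Require Import all_classical all_reals all_analysis.
From mathcomp Require Import measurable_realfun ess_sup_inf ring lra.

Set Implicit Arguments.
Unset Strict Implicit.
Unset Printing Implicit Defensive.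

Import Order.TTheory GRing.Theory Num.Theory.
Import numFieldNormedType.Exports.

Local Open Scope classical_set_scope.
Local Open Scope ring_scope.

(** * Lebesgue measure on the Euclidean space *)

(** Left aside above is the reason why the energy pairing of [u] with its truncation [v] is at least
    the energy of [v]. Write [u] as the sum of its truncation at level [k], of [v] and of a
    remainder. Moving from the first term in the direction of [v], or from [v] in the direction of
    the remainder, leaves the corresponding truncation unchanged; as truncations do not increase the
    energy, it is least at the start of such a ray, and its derivative there, twice the pairing, is
    nonnegative. Both cross terms therefore have the right sign.

    The domain is arbitrary and H^1_0 is known only through its test functions. Truncations are
    therefore smoothed into maps that preserve test functions, and spectral inequalities are stated
    for all partial sums.

    The three cases for [p] merge into [p >= 1] and [1 / p < 2 * s / N]. The constant is built from
    [N], [s], [p], [gamma] and the measure of the domain, hence is fixed before the eigenbasis and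
    the nonlinearity. *)

Section lebesgue_translation.
Context {R : realType}.
Local Notation mu := (@lebesgue_measure R).
Local Notation T := (measurableTypeR R).

Lemma measurable_addr (c : R) : measurable_fun [set: T] (fun x : T => x + c : T).
Proof. exact: measurable_funD. Qed.

(** Half-open intervals determine the measure, and on them both sides are the length. *)
Lemma lebesgue_measure_shift (c : R) (A : set T) : measurable A ->
  mu ((fun x : T => x + c : T) @^-1` A) = mu A.
Proof.
move=> mA; apply/esym.
rewrite -[RHS]/(pushforward mu (fun x : T => x + c : T) A).
pose phi : {mfun T >-> T} := HB.pack (fun x : T => x + c : T)
  (isMeasurableFun.Build _ _ _ _ _ (measurable_addr c)).
apply: (@lebesgue_measure_unique _ (pushforward mu phi)) => //= _ [[a b]] _ <-.
rewrite /pushforward/=.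
rewrite [X in _ = mu X](_ : _ = `]a - c, b - c]%classic); last first.
  by apply/seteqP; split=> x /=; rewrite !in_itv/= ltrBlDr lerBrDr.
by rewrite !lebesgue_measure_itv/= !lte_fin ltrD2r -!EFinB opprB addrA subrK.
Qed.

Lemma ge0_lebesgue_integral_shift (c : R) (g : measurableTypeR R -> \bar R) :
  measurable_fun setT g -> (forall x, 0 <= g x)%E ->
  (\int[mu]_x g (x + c)%R = \int[mu]_x g x)%E.
Proof.
move=> mg g0.
have := @ge0_integral_pushforward _ _ T T R _ (measurable_addr c) mu setT g
  measurableT mg (fun y _ => g0 y).
rewrite preimage_setT /= => <-.
apply: eq_measure_integral => [|mp A mA _]; first exact: measurable_addr.
exact: lebesgue_measure_shift.
Qed.

End lebesgue_translation.

Section tuple_translation.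
Context {R : realType}.
Local Notation T := (measurableTypeR R).

Definition tshift n (y : 'I_n -> R) (t : n.-tuple T) : n.-tuple T :=
  [tuple tnth t i + y i | i < n].

Lemma measurable_tshift n (y : 'I_n -> R) : measurable_fun setT (tshift y).
Proof.
apply/measurable_fun_tnthP => i.
rewrite (_ : _ \o _ = (fun x : T => x + y i : T) \o (fun t => tnth t i)).
  apply: measurableT_comp; first exact: measurable_addr.
  exact: measurable_tnth.
by apply/funext => t /=; rewrite tnth_mktuple.
Qed.

Lemma tshift_cons n (y : 'I_n.+1 -> R) (x : T) (t : n.-tuple T) :
  tshift y (cons_pair (x, t)) = cons_pair (x + y ord0, tshift (y \o lift ord0) t).
Proof.
apply/eq_from_tnth => i; rewrite tnth_mktuple /cons_pair /=.
case: (unliftP ord0 i) => [j ->|->]; last by rewrite !tnth0.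
by rewrite !tnthS tnth_mktuple.
Qed.

(** Induction on the dimension through the sections of [A]: the shift of the tail disappears by
    induction, the shift of the head by invariance on the line. *)
Lemma tuple_lebesgue_shift n (y : 'I_n -> R) (A : set (n.-tuple T)) :
  measurable A -> tuple_lebesgue R n (tshift y @^-1` A) = tuple_lebesgue R n A.
Proof.
elim: n y A => [|n IH] y A mA.
  rewrite /= !diracE; congr ((_ : bool)%:R%:E).
  apply/idP/idP; rewrite !inE /=.
  - by rewrite (_ : tshift y _ = [tuple])//; apply/eq_from_tnth => -[].
  - by rewrite (_ : tshift y _ = [tuple])//; apply/eq_from_tnth => -[].
rewrite /= /cons_measure /pushforward /product_measure1 /=.
pose B := @cons_pair R n @^-1` A.
have mB : measurable B.
  by rewrite -[X in measurable X]setTI; exact: measurable_cons_pair.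
pose g x := tuple_lebesgue R n (xsection B x).
have mg : measurable_fun setT g by exact: measurable_fun_xsection.
rewrite -(@ge0_lebesgue_integral_shift _ (y ord0) g)//.
apply: eq_integral => x _ /=; rewrite /g.
rewrite -(IH (y \o lift ord0)); last exact: measurable_xsection.
congr (tuple_lebesgue _ _ _); apply/seteqP.
by split => t; rewrite /xsection/= !inE /B /= tshift_cons.
Qed.

End tuple_translation.

Section rV_translation.
Context {R : realType} {N : nat}.
Local Notation T := (measurableTypeR R).
Local Notation lebB := (@lebesgue_borel R N).

Lemma measurable_tuple_of_rV :
  measurable_fun setT (@tuple_of_rV R N : borel_rV R N -> N.-tuple T).
Proof. by move=> _ B mB; exists B. Qed.

Definition rVshift (y : 'rV[R]_N) (x : 'rV[R]_N) : 'rV[R]_N := x + y.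

Lemma tuple_of_rV_shift (y x : 'rV[R]_N) :
  tuple_of_rV (x + y) = tshift (y ord0) (tuple_of_rV x).
Proof. by apply/eq_from_tnth => i; rewrite !tnth_mktuple !mxE. Qed.

Lemma measurable_rVshift_borel (y : 'rV[R]_N) :
  measurable_fun setT (rVshift y : borel_rV R N -> borel_rV R N).
Proof.
move=> _ _ [B mB <-]; rewrite setTI setTI -comp_preimage.
exists (tshift (y ord0) @^-1` B).
  by rewrite -[X in measurable X]setTI; exact: measurable_tshift.
rewrite setTI -comp_preimage (_ : _ \o tuple_of_rV (N:=N) = tuple_of_rV (N:=N) \o rVshift y)//.
by apply/funext => x /=; rewrite tuple_of_rV_shift.
Qed.

Lemma lebesgue_borel_shift (y : 'rV[R]_N) (A : set (borel_rV R N)) :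
  measurable A -> lebB (rVshift y @^-1` A) = lebB A.
Proof.
move=> mA; rewrite /lebesgue_borel /pushforward.
have mB : measurable (@rV_of_tuple R N @^-1` A).
  by rewrite -[X in measurable X]setTI; exact: measurable_rV_of_tuple.
rewrite -(tuple_lebesgue_shift (y ord0) mB).
congr (tuple_lebesgue _ _ _); apply/seteqP; split => t;
  rewrite /preimage /= /rVshift => At; move: At; congr A;
  by apply/rowP => i; rewrite !mxE tnth_mktuple.
Qed.

Local Notation muE := (mu_ext lebB).

Lemma rVshiftK (y : 'rV[R]_N) : cancel (rVshift y) (rVshift (- y)).
Proof. by move=> x; rewrite /rVshift addrK. Qed.

Lemma rVshiftNK (y : 'rV[R]_N) : cancel (rVshift (- y)) (rVshift y).
Proof. by move=> x; rewrite /rVshift subrK. Qed.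

(** A Borel cover of [A] pulls back to a cover of the preimage with the same total measure. The
    opposite translation will give the reverse inequality. *)
Lemma mu_ext_shift_le (y : 'rV[R]_N) (A : set 'rV[R]_N) :
  (muE (rVshift y @^-1` A) <= muE A)%E.
Proof.
apply: le_ereal_inf_tmp => _ [B [mB AB] <-].
apply: ereal_inf_lbound; exists (fun k => rVshift y @^-1` B k).
  split; last by move=> x /AB[k _ Bk]; exists k.
  by move=> k; rewrite -[X in measurable X]setTI; exact: measurable_rVshift_borel.
by apply: eq_eseriesr => k _; rewrite lebesgue_borel_shift.
Qed.

Lemma mu_ext_shift (y : 'rV[R]_N) (A : set 'rV[R]_N) :
  muE (rVshift y @^-1` A) = muE A.
Proof.
apply/eqP; rewrite eq_le mu_ext_shift_le /=.
rewrite -{1}(_ : rVshift (- y) @^-1` (rVshift y @^-1` A) = A).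
  exact: mu_ext_shift_le.
by rewrite -comp_preimage; apply/seteqP; split => x /=; rewrite rVshiftNK.
Qed.

(** The sigma-algebra is that of Caratheodory and not the Borel one, so its criterion is checked
    directly: the test set is translated back, and the outer measure is invariant. *)
Lemma measurable_rVshift (y : 'rV[R]_N) :
  measurable_fun setT (rVshift y : euclid R N -> euclid R N).
Proof.
move=> _ A mA; rewrite setTI.
change (caratheodory_measurable muE (rVshift y @^-1` A)) => X.
have XE : X = rVshift y @^-1` (rVshift (- y) @^-1` X).
  by rewrite -comp_preimage; apply/seteqP; split => x /=; rewrite rVshiftK.
rewrite XE; set X' := rVshift (- y) @^-1` X.
transitivity (muE X'); first exact: mu_ext_shift.
rewrite (mA X'); congr (_ + _)%E.
- exact: esym (mu_ext_shift y (X' `&` A)).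
- exact: esym (mu_ext_shift y (X' `&` ~` A)).
Qed.

Lemma leb_shift (y : 'rV[R]_N) (A : set (euclid R N)) :
  leb (rVshift y @^-1` A) = leb A.
Proof. exact: mu_ext_shift. Qed.

Lemma leb_borel (A : set (borel_rV R N)) : measurable A -> leb (A : set (euclid R N)) = lebB A.
Proof. by move=> mA; rewrite -[LHS]/(muE A) measurable_mu_extE. Qed.

Lemma borel_measurable (A : set (borel_rV R N)) :
  measurable A -> measurable (A : set (euclid R N)).
Proof. exact: caratheodory_measurable_mu_ext. Qed.

Lemma measurable_entry (i : 'I_N) :
  measurable_fun setT (fun x : borel_rV R N => (x : 'rV[R]_N) ord0 i : T).
Proof.
rewrite (_ : (fun _ => _) = (fun t => tnth t i) \o @tuple_of_rV R N).
  by apply: measurableT_comp measurable_tuple_of_rV; exact: measurable_tnth.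
by apply/funext => x /=; rewrite tnth_mktuple.
Qed.

Definition rVbox (P : 'I_N -> set R) : set 'rV[R]_N := [set x | forall i, P i (x ord0 i)].

Lemma measurable_rVbox (P : 'I_N -> set T) : (forall i, measurable (P i)) ->
  measurable (rVbox P : set (borel_rV R N)).
Proof.
move=> mP; rewrite [X in measurable X](_ : _ =
  \bigcap_(i in [set: 'I_N]) ((fun x : 'rV[R]_N => x ord0 i) @^-1` P i)).
  apply: fin_bigcap_measurable => // i _.
  by rewrite -[X in measurable X]setTI; exact: (measurable_entry i).
by apply/seteqP; split => x //= xP i; [move=> _; exact: xP|exact: xP].
Qed.

(** The Borel structure is generated by the coordinates, so an open set has to be exhibited as a
    countable union of boxes, here with rational centres and half-widths [n.+1%:R^-1]. *)
Lemma open_borel (U : set 'rV[R]_N) : open U -> measurable (U : set (borel_rV R N)).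
Proof.
move=> oU.
pose box (q : 'rV[rat]_N) (n : nat) : set 'rV[R]_N :=
  [set x | forall i, ratr (q ord0 i) - n.+1%:R^-1 < x ord0 i < ratr (q ord0 i) + n.+1%:R^-1].
pose D : set ('rV[rat]_N * nat) := [set qn | box qn.1 qn.2 `<=` U].
rewrite (_ : U = \bigcup_(qn in D) box qn.1 qn.2); last first.
  apply/seteqP; split => [x Ux|x [qn Dqn]]; last exact: Dqn.
  have /nbhs_ballP[e e0 xeU] := open_nbhs_nbhs (conj oU Ux).
  have [n ne] : exists n : nat, n.+1%:R^-1 < e / 2.
    have e20 : 0 < e / 2 by rewrite divr_gt0.
    exists (Num.truncn (e / 2)^-1); rewrite invf_plt ?posrE//; exact: truncnS_gt.
  have qi (i : 'I_N) : exists q : rat, x ord0 i - n.+1%:R^-1 < ratr q < x ord0 i + n.+1%:R^-1.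
    have [|q] := @rat_in_itvoo R (x ord0 i - n.+1%:R^-1) (x ord0 i + n.+1%:R^-1).
      by rewrite ltrD2l gtrN// invr_gt0.
    by rewrite in_itv; exists q.
  have [q qP] := choice qi.
  exists (\row_i q i, n) => /=.
    move=> y yb; apply: xeU.
    split=> // i0 i; rewrite (ord1 i0) /ball /=; have := yb i; rewrite !mxE => /andP[y1 y2].
    have /andP[q1 q2] := qP i.
    have -> : `|x 0 i - y 0 i| = `|x ord0 i - y ord0 i| by [].
    move: y1 y2 q1 q2 ne => /=.
    move: (x ord0 i) (y ord0 i) (ratr (q i)) (n.+1%:R^-1) => a b c d *.
    by rewrite ltr_norml; apply/andP; split; lra.
  move=> i; rewrite mxE /=; have /andP[] := qP i.
  by rewrite ltrBlDr ltrBlDr => -> ->.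
rewrite bigcup_mkcond; apply: countable_bigcupT_measurable => // -[q n] /=.
case: ifP => // _.
rewrite (_ : box q n = rVbox (fun i =>
  `]ratr (q ord0 i) - n.+1%:R^-1, ratr (q ord0 i) + n.+1%:R^-1[%classic)).
  by apply: measurable_rVbox => i; exact: measurable_itv.
by apply/seteqP; split => x /= xb i; move: (xb i); rewrite /= in_itv.
Qed.

End rV_translation.

(** * Boxes, Borel hulls and the correlation of two sets *)

Section lebesgue_boxes.
Context {R : realType}.
Local Notation T := (measurableTypeR R).
Local Notation lambda := (@lebesgue_measure R).

Lemma tuple_lebesgue_box n (P : set T) : measurable P ->
  tuple_lebesgue R n [set t : n.-tuple T | forall i, P (tnth t i)] = (lambda P ^+ n)%E.
Proof.
move=> mP; elim: n => [|n IH].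
  by rewrite /= diracE mem_set// => -[].
rewrite expeS /= /cons_measure /pushforward.
rewrite [X in product_measure1 _ _ X](_ : _ = P `*` [set t : n.-tuple T | forall i, P (tnth t i)]).
  rewrite product_measure1E//; first by congr (_ * _)%E.
  rewrite [X in measurable X](_ : _ = \bigcap_(i in [set: 'I_n]) ((fun t : n.-tuple T => tnth t i) @^-1` P)).
    apply: fin_bigcap_measurable => // i _.
    by rewrite -[X in measurable X]setTI; exact: measurable_tnth.
  by apply/seteqP; split => t //= tP i; [move=> _; exact: tP|exact: tP].
apply/seteqP; split => [[x t]|[x t] [/= Px Pt]] /=.
  move=> xt; split => [|i]; first by have := xt ord0; rewrite tnth0.
  by have := xt (lift ord0 i); rewrite tnthS.
by move=> i; case: (unliftP ord0 i) => [j ->|->]; rewrite ?tnth0 ?tnthS.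
Qed.

Variable N : nat.

Lemma leb_box (P : set T) : measurable P ->
  @leb R N (rVbox (fun=> P)) = (lambda P ^+ N)%E.
Proof.
move=> mP; rewrite leb_borel; last exact: measurable_rVbox.
rewrite -(tuple_lebesgue_box N mP) /lebesgue_borel /pushforward.
congr (tuple_lebesgue _ _ _); apply/seteqP.
by split => t /= Pt i; have := Pt i; rewrite !mxE.
Qed.

Lemma leb_bounded (A : set 'rV[R]_N) : bounded_set A -> (leb A < +oo)%E.
Proof.
move=> [M [_ /(_ (M + 1))]]; rewrite ltrDl => /(_ ltr01) AM.
apply: (@le_lt_trans _ _ (@leb R N (rVbox (fun=> `[- (M + 1), M + 1]%classic)))).
  apply: le_mu_ext => x /AM xM i /=; rewrite in_itv /= -ler_norml.
  apply: le_trans xM; rewrite [leRHS]/Num.norm /= mx_normrE.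
  exact: (le_bigmax _ (fun i : 'I_1 * 'I_N => `|x i.1 i.2|) (ord0, i)).
rewrite (leb_box (measurable_itv _)).
by rewrite lebesgue_measure_itv/=; case: ifP => _; rewrite -?EFinB -?EFin_expe ?ltry// -[0%E]/(0%:E) -EFin_expe ltry.
Qed.

Lemma leb_cube (r : R) : 0 <= r ->
  @leb R N (rVbox (fun=> `[0, r]%classic)) = (r ^+ N)%:E.
Proof.
move=> r0; rewrite (leb_box (measurable_itv _)).
rewrite lebesgue_measure_itv/= lte_fin; case: ltP => [_|r0'].
  by rewrite -EFinB subr0 EFin_expe.
by rewrite (@le_anti _ _ r 0) ?r0 ?r0'// EFin_expe.
Qed.

(** Tonelli's theorem will be applied to Borel sets, whereas [leb] also measures sets that are not
    Borel; a Borel set of the same measure above a given one links the two. *)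
Lemma borel_hull (A : set 'rV[R]_N) : (leb A < +oo)%E ->
  exists B : set (borel_rV R N), [/\ measurable B, A `<=` B & lebesgue_borel B = leb A].
Proof.
move=> Afin.
have A0 : (0 <= leb A)%E by exact: mu_ext_ge0.
have Afn : leb A \is a fin_num by rewrite ge0_fin_numE.
have H n : exists B : set (borel_rV R N),
    [/\ measurable B, A `<=` B & (lebesgue_borel B <= leb A + n.+1%:R^-1%:E)%E].
  have n0 : (0 < n.+1%:R^-1 :> R) by [].
  have [_ [F [mF AF] <-] Fl] := lb_ereal_inf_adherent n0 Afn.
  exists (\bigcup_k F k); split => //; first exact: bigcupT_measurable.
  apply: le_trans (ltW Fl).
  exact: measure_sigma_subadditive (bigcupT_measurable _ mF) (@subset_refl _ _).
have [B HB] := choice H.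
have mB : measurable (\bigcap_k B k) by apply: bigcapT_measurable => k; have [] := HB k.
have AB : A `<=` \bigcap_k B k by move=> x Ax k _; have [_ + _] := HB k; exact.
exists (\bigcap_k B k); split => //.
apply/eqP; rewrite eq_le; apply/andP; split; last first.
  by rewrite -leb_borel//; exact: le_mu_ext.
apply/lee_addgt0Pr => e e0.
have [n ne] : exists n : nat, n.+1%:R^-1 < e.
  by exists (Num.truncn e^-1); rewrite invf_plt ?posrE//; exact: truncnS_gt.
have [mBn _ Bn] := HB n.
apply: (@le_trans _ _ (lebesgue_borel (B n))).
  by apply: le_measure; rewrite ?inE//; exact: bigcap_inf.
by apply: le_trans Bn _; rewrite leeD2l// lee_fin ltW.
Qed.

Lemma measurable_addrV :
  measurable_fun setT (fun xy : borel_rV R N * borel_rV R N => (xy.1 + xy.2 : borel_rV R N)).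
Proof.
move=> _ _ [B mB <-]; rewrite !setTI -comp_preimage.
suff : measurable_fun setT (@tuple_of_rV R N \o
    (fun xy : borel_rV R N * borel_rV R N => (xy.1 + xy.2 : borel_rV R N))).
  by move=> /(_ measurableT _ mB); rewrite setTI.
apply/measurable_fun_tnthP => i.
rewrite (_ : _ \o _ = (fun xy : borel_rV R N * borel_rV R N =>
    ((xy.1 : 'rV[R]_N) ord0 i : T)) \+ (fun xy => ((xy.2 : 'rV[R]_N) ord0 i : T))).
  apply: measurable_funD.
    exact: measurableT_comp (measurable_entry i) measurable_fst.
  exact: measurableT_comp (measurable_entry i) measurable_snd.
by apply/funext => xy /=; rewrite tnth_mktuple mxE.
Qed.

(** Tonelli's theorem for [\1_A x * \1_B (x + y)]: integrating in [y] first leaves the measure of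
    [B], by translation invariance. *)
Lemma lebesgue_borel_correlation (A B : set (borel_rV R N)) :
  measurable A -> measurable B ->
  (measurable_fun setT (fun y : borel_rV R N => lebesgue_borel (A `&` rVshift y @^-1` B)) /\
  \int[@lebesgue_borel R N]_y lebesgue_borel (A `&` rVshift y @^-1` B) =
  lebesgue_borel A * lebesgue_borel B)%E.
Proof.
move=> mA mB.
pose f (xy : borel_rV R N * borel_rV R N) : \bar R := (\1_A xy.1 * \1_B (xy.1 + xy.2 : borel_rV R N))%:E.
have mf : measurable_fun setT f.
  apply/measurable_EFinP; apply: measurable_funM.
    by apply: measurableT_comp measurable_fst; exact: measurable_indic.
  by apply: measurableT_comp measurable_addrV; exact: measurable_indic.
have f0 xy : (0 <= f xy)%E by rewrite lee_fin mulr_ge0.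
have mS y : measurable (rVshift y @^-1` B : set (borel_rV R N)).
  by rewrite -[X in measurable X]setTI; exact: measurable_rVshift_borel.
have hE : (fun y : borel_rV R N => lebesgue_borel (A `&` rVshift y @^-1` B)) =
    (fun y => \int[@lebesgue_borel R N]_x f (x, y))%E.
  apply/funext => y; rewrite -(setIT (A `&` _)) -integral_indic//; last exact: measurableI.
  by apply: eq_integral => x _; rewrite /f /= indicI.
rewrite hE; split; first exact: (measurable_fun_fubini_tonelli_G (m1 := @lebesgue_borel R N)).
rewrite -(fubini_tonelli (m1 := @lebesgue_borel R N) (m2 := @lebesgue_borel R N) _ mf f0).
transitivity (\int[@lebesgue_borel R N]_x ((\1_A x)%:E * lebesgue_borel B))%E.
  apply: eq_integral => x _.
  rewrite (_ : (fun y => f (x, y)) = (fun y => (\1_A x)%:E * (\1_(rVshift x @^-1` B) y)%:E)%E); last first.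
    by apply/funext => y; rewrite /f /= -EFinM; congr (_ * _)%:E; rewrite /indic /= /rVshift addrC.
  rewrite ge0_integralZl ?lee_fin//; last first.
    by apply/measurable_EFinP; exact: measurable_indic.
  congr (_ * _)%E.
  transitivity (lebesgue_borel (rVshift x @^-1` B)); last exact: lebesgue_borel_shift.
  by rewrite integral_indic// setIT.
rewrite ge0_integralZr//; last by apply/measurable_EFinP; exact: measurable_indic.
by rewrite integral_indic// setIT.
Qed.

(* The translates of B meet A in a set of measure |A| |B| / r^N on average over the cube. *)
Lemma small_correlation (A B : set (euclid R N)) (r : R) :
  measurable A -> measurable B -> (leb A < +oo)%E -> (0 < leb A)%E -> 0 < r ->
  (2%:E * leb B < (r ^+ N)%:E)%E ->
  exists2 y : 'rV[R]_N, (forall i, 0 <= y ord0 i <= r) &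
    (2%:E * leb (A `&` rVshift y @^-1` B) <= leb A)%E.
Proof.
move=> mA mB Afin Apos r0 Br.
have Bfin : (leb B < +oo)%E.
  rewrite ltNge leye_eq; apply/negP => /eqP Boo.
  by move: Br; rewrite Boo gt0_muley// ltNge leey.
have [A0 [mA0 AA0 A0E]] := borel_hull Afin.
have [B0 [mB0 BB0 B0E]] := borel_hull Bfin.
apply: contrapT => /forall2NP H.
pose Q := (@rVbox R N (fun=> `[0, r]%classic)).
have mQ : measurable (Q : set (borel_rV R N)) by apply: measurable_rVbox => i; exact: measurable_itv.
have [mh hE] := lebesgue_borel_correlation mA0 mB0.
have Afn : leb A \is a fin_num by rewrite ge0_fin_numE.
have Bfn : leb B \is a fin_num by rewrite ge0_fin_numE.
(* If every vector of the cube [Q] gave an intersection of more than half the measure of [A],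
   integrating over [Q] would yield [r ^+ N * |A| / 2 <= |A| * |B|], against the hypothesis on
   [r]. *)
have : (\int[@lebesgue_borel R N]_(y in Q) (2^-1%:E * leb A) <= lebesgue_borel A0 * lebesgue_borel B0)%E.
  rewrite -hE; apply: (@le_trans _ _ (\int[@lebesgue_borel R N]_(y in Q)
      lebesgue_borel (A0 `&` rVshift y @^-1` B0))%E); last first.
    by apply: ge0_subset_integral.
  apply: ge0_le_integral => //.
  - by move=> y _; rewrite mule_ge0.
  - exact: measurable_funTS.
  - move=> y Qy; have [nQ|/negP] := H y.
      by exfalso; apply: nQ => i; have := Qy i; rewrite /= in_itv.
    rewrite -ltNge => /ltW ABy; apply: (@le_trans _ _ (leb (A `&` rVshift y @^-1` B))).
      rewrite -(@lee_pmul2l _ 2%:E)// muleA -EFinM mulfV// mul1e.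
      exact: ABy.
    apply: (@le_trans _ _ (leb (A0 `&` rVshift y @^-1` B0))).
      by apply: le_mu_ext; apply: setISS => // z /BB0.
    rewrite leb_borel//; apply: measurableI => //.
    by rewrite -[X in measurable X]setTI; exact: measurable_rVshift_borel.
rewrite A0E B0E integral_cst// -[X in (_ * X <= _)%E](leb_borel mQ) (leb_cube (ltW r0)).
rewrite -(fineK Afn) -(fineK Bfn) -!EFinM lee_fin.
move: Br Apos; rewrite -(fineK Afn) -(fineK Bfn) -EFinM !lte_fin.
move=> /=; move: (fine (leb A)) (fine (leb B)) (r ^+ N) => a b c h1 h2 h3.
by clear -h1 h2 h3; nra.
Qed.

End lebesgue_boxes.

(** * Pre-Hilbert forms and square-integrable functions *)

Section prehilbert.
Context (R : realType) (V : zmodType).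

(** The space is cut out of all functions by the predicate [P], and the form may be degenerate,
    since functions equal almost everywhere are not identified. The same record covers
    square-integrable functions and vector fields under the elliptic form. *)
Record prehilbert (P : V -> Prop) (sc : R -> V -> V) (B : V -> V -> R) := PreHilbert {
  phD : forall u v, P u -> P v -> P (u + v);
  phN : forall u, P u -> P (- u);
  phZ : forall a u, P u -> P (sc a u);
  ph0 : P 0;
  phC : forall u v, P u -> P v -> B u v = B v u;
  phBDl : forall u v w, P u -> P v -> P w -> B (u + v) w = B u w + B v w;
  phBZl : forall a u w, P u -> P w -> B (sc a u) w = a * B u w;
  ph_ge0 : forall u, P u -> 0 <= B u u }.

Context (P : V -> Prop) (sc : R -> V -> V) (B : V -> V -> R).
Hypothesis H : prehilbert P sc B.

Lemma phB u v : P u -> P v -> P (u - v).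
Proof. by move=> Pu Pv; apply: (phD H) => //; exact: (phN H). Qed.

Lemma phB0l w : P w -> B 0 w = 0.
Proof.
move=> Pw; have := phBDl H (ph0 H) (ph0 H) Pw.
by rewrite addr0 => /eqP; rewrite -subr_eq0 opprD addNKr oppr_eq0 => /eqP.
Qed.

Lemma phBNl u w : P u -> P w -> B (- u) w = - B u w.
Proof.
move=> Pu Pw; apply/eqP; rewrite -addr_eq0 -(phBDl H)//; last exact: (phN H).
by rewrite addNr phB0l.
Qed.

Lemma phBBl u v w : P u -> P v -> P w -> B (u - v) w = B u w - B v w.
Proof. by move=> Pu Pv Pw; rewrite (phBDl H)// ?phBNl//; exact: (phN H). Qed.

Lemma phBBr u v w : P u -> P v -> P w -> B w (u - v) = B w u - B w v.
Proof. by move=> Pu Pv Pw; rewrite (phC H Pw (phB Pu Pv)) phBBl// (phC H Pu Pw) (phC H Pv Pw). Qed.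

Lemma phBZr a u w : P u -> P w -> B w (sc a u) = a * B w u.
Proof. by move=> Pu Pw; rewrite (phC H Pw (phZ H a Pu)) (phBZl H)// (phC H Pu Pw). Qed.

Lemma phBDr u v w : P u -> P v -> P w -> B w (u + v) = B w u + B w v.
Proof. by move=> Pu Pv Pw; rewrite (phC H Pw (phD H Pu Pv)) (phBDl H)// (phC H Pu Pw) (phC H Pv Pw). Qed.

Lemma ph_sqB u v : P u -> P v -> B (u - v) (u - v) = B u u - 2 * B u v + B v v.
Proof.
move=> Pu Pv; rewrite phBBl// ?phBBr//; last exact: phB.
by rewrite (phC H Pv Pu); ring.
Qed.

Lemma ph_sqD u v : P u -> P v -> B (u + v) (u + v) = B u u + 2 * B u v + B v v.
Proof.
move=> Pu Pv; rewrite (phBDl H)// ?phBDr//; last exact: (phD H).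
by rewrite (phC H Pv Pu); ring.
Qed.

Lemma ph_sum (e : nat -> V) M : (forall n, P (e n)) -> P (\sum_(n < M) e n).
Proof. by move=> Pe; elim/big_ind : _ => //; [exact: (ph0 H)|exact: (phD H)]. Qed.

Lemma ph_suml (e : nat -> V) M w : (forall n, P (e n)) -> P w ->
  B (\sum_(n < M) e n) w = \sum_(n < M) B (e n) w.
Proof.
move=> Pe Pw; elim: M => [|M IH]; first by rewrite !big_ord0 phB0l.
by rewrite !big_ord_recr /= (phBDl H)// ?IH//; exact: ph_sum.
Qed.

Section orthogonal_family.
Variables (e : nat -> V) (lam c : nat -> R).
Hypothesis Pe : forall n, P (e n).
Hypothesis Be : forall m n, B (e m) (e n) = lam m * (m == n)%:R.

Lemma ph_sum_orthogonal m M : (M <= m)%N ->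
  B (\sum_(n < M) sc (c n) (e n)) (e m) = 0.
Proof.
move=> Mm; rewrite (ph_suml (e := fun n => sc (c n) (e n)))//; last by move=> n; exact: (phZ H).
rewrite big1// => i _; rewrite (phBZl H)// Be.
by rewrite ltn_eqF ?mulr0// (leq_trans (ltn_ord i)).
Qed.

Lemma ph_sq_sum M :
  B (\sum_(n < M) sc (c n) (e n)) (\sum_(n < M) sc (c n) (e n)) =
  \sum_(n < M) lam n * c n ^+ 2.
Proof.
elim: M => [|M IH]; first by rewrite !big_ord0 phB0l//; exact: (ph0 H).
have PS := ph_sum (e := fun n => sc (c n) (e n)) M (fun n => phZ H (c n) (Pe n)).
rewrite !big_ord_recr /= ph_sqD//; last exact: (phZ H).
rewrite IH phBZr// (phBZl H)//; last exact: (phZ H).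
by rewrite phBZr// ph_sum_orthogonal// Be eqxx /= mulr1; ring.
Qed.

(** The weights [lam] let one identity serve both the orthonormal eigenfunctions, with weight 1, and
    their gradients, which are orthogonal for the elliptic form with the eigenvalues as weights. *)
Lemma ph_sq_projection g M : P g -> (forall n, B (e n) g = lam n * c n) ->
  B (g - \sum_(n < M) sc (c n) (e n)) (g - \sum_(n < M) sc (c n) (e n)) =
  B g g - \sum_(n < M) lam n * c n ^+ 2.
Proof.
move=> Pg Bg.
have PS := ph_sum (e := fun n => sc (c n) (e n)) M (fun n => phZ H (c n) (Pe n)).
rewrite ph_sqB// ph_sq_sum (phC H Pg PS).
rewrite (ph_suml (e := fun n => sc (c n) (e n)))//; last by move=> n; exact: (phZ H).
under [X in _ - 2 * X + _]eq_bigr => i _.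
  rewrite (phBZl H)// Bg (_ : _ * (_ * _) = lam i * c i ^+ 2); last by ring.
  over.
by ring.
Qed.

Lemma ph_bessel g M : P g -> (forall n, B (e n) g = lam n * c n) ->
  \sum_(n < M) lam n * c n ^+ 2 <= B g g.
Proof.
move=> Pg Bg; rewrite -subr_ge0 -ph_sq_projection//.
apply: (ph_ge0 H); apply: phB => //.
by apply: (ph_sum (e := fun n => sc (c n) (e n))) => n; exact: (phZ H).
Qed.

End orthogonal_family.
End prehilbert.

Definition fscale {R : realType} {T : Type} (a : R) (u : T -> R) : T -> R := fun x => a * u x.

Section square_integrable.
Context d (T : measurableType d) (R : realType) (mu : {measure set T -> \bar R}).
Variables (D : set T) (mD : measurable D).

Definition sqi (u : T -> R) : Prop :=
  measurable_fun D u /\ mu.-integrable D (EFin \o (fun x => u x ^+ 2)).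

Definition ip (u v : T -> R) : R := \int[mu]_(x in D) (u x * v x).

Lemma sqi_ae_le (u v : T -> R) : sqi u -> measurable_fun D v ->
  {ae mu, forall x, D x -> `|v x| <= `|u x|} -> sqi v.
Proof.
move=> [mu_ iu] mv vu; split=> //; apply/integrableP; split.
  by apply/measurable_EFinP; exact: measurable_funX.
move/integrableP : iu => [_]; apply: le_lt_trans; apply: ae_ge0_le_integral => //.
- by apply: measurableT_comp => //; apply/measurable_EFinP; exact: measurable_funX.
- by apply: measurableT_comp => //; apply/measurable_EFinP; exact: measurable_funX.
apply: filterS vu => x h Dx /=; rewrite lee_fin !normrX.
by rewrite ler_pXn2r// ?nnegrE// h.
Qed.

Lemma sqi_le (u v : T -> R) : sqi u -> measurable_fun D v ->
  (forall x, D x -> `|v x| <= `|u x|) -> sqi v.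
Proof. by move=> su mv vu; apply: (sqi_ae_le su mv); exact: aeW. Qed.

Lemma sqi_mul (u v : T -> R) : sqi u -> sqi v ->
  mu.-integrable D (EFin \o (fun x => u x * v x)).
Proof.
move=> [mu_ iu] [mv iv].
apply: (le_integrable mD _ _ (integrableD mD iu iv)).
  by apply/measurable_EFinP; exact: measurable_funM.
move=> x Dx /=; rewrite lee_fin normrM [leRHS]ger0_norm; last by rewrite addr_ge0// sqr_ge0.
rewrite -[u x ^+ 2]real_normK ?num_real// -[v x ^+ 2]real_normK ?num_real//.
have := sqr_ge0 (`|u x| - `|v x|); have := normr_ge0 (u x); have := normr_ge0 (v x).
by move: `|u x| `|v x| => a b; nra.
Qed.

Lemma sqi0 : sqi 0.
Proof.
split; first exact: measurable_cst.
rewrite (_ : _ \o _ = cst 0%E); first exact: integrable0.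
by apply/funext => x /=; rewrite expr0n.
Qed.

Lemma sqiD (u v : T -> R) : sqi u -> sqi v -> sqi (u + v).
Proof.
move=> su sv; have [mu_ iu] := su; have [mv iv] := sv.
split; first exact: measurable_funD.
apply: (le_integrable mD _ _ (integrableD mD (integrableD mD iu iu) (integrableD mD iv iv))).
  by apply/measurable_EFinP; apply: measurable_funX; exact: measurable_funD.
move=> x Dx /=; rewrite lee_fin !fctE; set a := u x; set b := v x.
rewrite !ger0_norm ?sqr_ge0//; last by rewrite !addr_ge0// sqr_ge0.
by have := sqr_ge0 (a - b); nra.
Qed.

Lemma sqiZ a (u : T -> R) : sqi u -> sqi (fscale a u).
Proof.
move=> [mu_ iu]; split; first by apply: measurable_funM => //; exact: measurable_cst.
have := integrableZl mD (a ^+ 2) iu; congr (mu.-integrable D).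
by apply/funext => x /=; rewrite -EFinM /fscale exprMn.
Qed.

Lemma sqiN (u : T -> R) : sqi u -> sqi (- u).
Proof.
move=> su; apply: (sqi_le su); first by apply: measurable_funN; case: su.
by move=> x _; rewrite !fctE normrN.
Qed.

Lemma prehilbert_L2 : prehilbert sqi fscale ip.
Proof.
split; [exact: sqiD|exact: sqiN|exact: sqiZ|exact: sqi0|..].
- by move=> u v su sv; apply: eq_Rintegral => x _; rewrite mulrC.
- move=> u v w su sv sw; rewrite /ip -RintegralD//; try exact: sqi_mul.
  by apply: eq_Rintegral => x _; rewrite mulrDl.
- move=> a u w su sw; rewrite /ip -RintegralZl//; last exact: sqi_mul.
  by apply: eq_Rintegral => x _; rewrite /fscale mulrA.
- by move=> u su; apply: Rintegral_ge0 => x _; rewrite -expr2 sqr_ge0.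
Qed.

Lemma ip_EFin (u v : T -> R) : sqi u -> sqi v ->
  (ip u v)%:E = (\int[mu]_(x in D) (u x * v x)%:E)%E.
Proof.
move=> su sv; rewrite /ip /Rintegral fineK//.
exact: (integrable_fin_num mD (sqi_mul su sv)).
Qed.

Lemma le_ip (u v : T -> R) : sqi u -> sqi v ->
  (forall x, D x -> `|v x| <= `|u x|) -> ip v v <= ip u u.
Proof.
move=> su sv vu; apply: le_Rintegral => //; try exact: sqi_mul.
move=> x Dx; rewrite -!expr2 -[v x ^+ 2]real_normK ?num_real// -[u x ^+ 2]real_normK ?num_real//.
by rewrite ler_pXn2r// ?nnegrE// vu.
Qed.

Lemma ip_sub_le (u v : T -> R) : sqi u -> sqi v ->
  ip (u + v) (u + v) <= 2 * ip u u + 2 * ip v v.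
Proof.
move=> su sv; rewrite (ph_sqD prehilbert_L2)//.
have := ph_ge0 prehilbert_L2 (phB prehilbert_L2 su sv).
by rewrite (ph_sqB prehilbert_L2)//; lra.
Qed.

End square_integrable.

(** * Square-integrable functions on the domain *)

Section L2_Omega.
Context {R : realType} {N : nat} (Omega : set 'rV[R]_N).
Hypothesis mO : measurable (Omega : set (euclid R N)).
Local Notation mu := (@leb R N).
Local Notation sqO := (sqi mu Omega).
Local Notation ipO := (ip mu Omega).

Lemma norm_Lp2E (u : euclid R N -> R) :
  norm_Lp Omega 2%:E u = ((\int[mu]_(x in Omega) (u x ^+ 2)%:E) `^ (2^-1))%E.
Proof.
rewrite /norm_Lp unlock; congr (_ `^ _)%E.
rewrite [RHS]integral_mkcond; apply: eq_integral => x _ /=.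
rewrite !patchE; case: ifP => _ /=.
  by rewrite -[in RHS]real_normK ?num_real// powR_mulrn.
by rewrite normr0 powR0.
Qed.

Lemma L2P (u : euclid R N -> R) : L2 Omega u <-> sqO u.
Proof.
rewrite /L2 /Lp norm_Lp2E; split => -[mu_ h]; split => //.
  apply/integrableP; split; first by apply/measurable_EFinP; exact: measurable_funX.
  apply: le_lt_trans (lty_poweRy _ h) => //.
  rewrite le_eqVlt; apply/orP; left; apply/eqP; apply: eq_integral => x _ /=.
  by rewrite ger0_norm// sqr_ge0.
move/integrableP : h => [_ h]; apply: poweR_lty; apply: le_lt_trans h.
rewrite le_eqVlt; apply/orP; left; apply/eqP; apply: eq_integral => x _ /=.
by rewrite ger0_norm// sqr_ge0.
Qed.

Lemma norm_Lp2_ip (u : euclid R N -> R) : sqO u ->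
  norm_Lp Omega 2%:E u = (ipO u u `^ 2^-1)%:E.
Proof.
move=> su; rewrite norm_Lp2E -poweR_EFin (ip_EFin mO)//.
Qed.

Lemma cvg_L2P (u_ : nat -> euclid R N -> R) (u : euclid R N -> R) :
  (forall k, sqO (u_ k)) -> sqO u ->
  cvg_L2 Omega u_ u <-> (fun k => ipO (u_ k - u) (u_ k - u)) @ \oo --> (0 : R).
Proof.
move=> su_ su; rewrite /cvg_L2.
have sB k : sqO (u_ k - u) by exact: (phB (prehilbert_L2 _ mO)).
have ge0 k : 0 <= ipO (u_ k - u) (u_ k - u) by exact: (ph_ge0 (prehilbert_L2 _ mO)).
have -> : (fun k => norm_Lp Omega 2%:E (u_ k \- u)) =
    EFin \o (fun k => ipO (u_ k - u) (u_ k - u) `^ 2^-1).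
  by apply/funext => k /=; rewrite -norm_Lp2_ip.
split => [/fine_cvgP[_ /= h]|h].
  rewrite (_ : (fun k => ipO _ _) = (fun k => (ipO (u_ k - u) (u_ k - u) `^ 2^-1) *
      (ipO (u_ k - u) (u_ k - u) `^ 2^-1))); last first.
    by apply/funext => k; rewrite -expr2 -powR_mulrn ?powR_ge0// -powRrM mulVf ?powRr1.
  by have := cvgM h h; rewrite mulr0; exact.
apply: cvg_EFin; first exact: nearW.
rewrite /comp /= (_ : (fun k => _) = (fun k => Num.sqrt (ipO (u_ k - u) (u_ k - u)))); last first.
  by apply/funext => k; rewrite powR12_sqrt.
by have := @cvg_comp _ _ _ _ (@Num.sqrt R) _ _ _ h (@sqrt_continuous R 0); rewrite /= sqrtr0; exact.
Qed.

End L2_Omega.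

(** * Smooth functions *)

Section smooth_calculus.
Context {R : realType} {N : nat}.
Local Notation RN := 'rV[R]_N.
Implicit Types f g : RN -> R.

(** Smoothness asks for every iterated partial derivative; a class of differentiable functions
    closed under partial derivatives yields them all at once, without formulas for the iterates. *)
Lemma smooth_coind (S : (RN -> R) -> Prop) :
  (forall f, S f -> (forall x, differentiable (f : RN -> R^o) x) /\ forall i, S (partial i f)) ->
  forall f, S f -> smooth f.
Proof.
(* The last index of the list is the first derivative taken, hence the induction from the end. *)
move=> HS f Sf l; elim/last_ind: l f Sf => [|l i IH] f Sf x /=.
  exact: (HS f Sf).1.
by rewrite foldr_rcons; apply: IH; exact: (HS f Sf).2.
Qed.

Lemma smooth_differentiable f : smooth f -> forall x, differentiable (f : RN -> R^o) x.
Proof. by move=> sf x; exact: (sf [::] x). Qed.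

Lemma smooth_partial f i : smooth f -> smooth (partial i f).
Proof. by move=> sf l x; have := sf (rcons l i) x; rewrite foldr_rcons. Qed.

Lemma smooth_cst (c : R) : smooth ((fun=> c) : RN -> R).
Proof.
apply: (@smooth_coind (fun f => exists c, f = fun=> c)); last by exists c.
move=> f [{}c ->]; split => [x|i]; first exact: differentiable_cst.
by exists 0; apply/funext => x; rewrite /partial derive_cst.
Qed.

Lemma derive_comp f (g : R -> R) (dg : R) x v : differentiable (f : RN -> R^o) x ->
  is_derive (f x : R^o) (1 : R^o) (g : R^o -> R^o) dg ->
  differentiable (g \o f : RN -> R^o) x /\
  'D_v (g \o f : RN -> R^o) x = dg * 'D_v (f : RN -> R^o) x.
Proof.
move=> df [dg1 dgE].
have dgf : differentiable (g : R^o -> R^o) (f x : R^o) by apply/derivable1_diffP.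
have dgf' : differentiable (g \o f : RN -> R^o) x.
  exact: (@differentiable_comp _ _ R^o R^o f g).
split => //; rewrite !deriveE// (@diff_comp _ _ R^o R^o f g)//=.
by rewrite deriv1E// derive1E dgE mulrC.
Qed.

(** The inverse root of [t ^+ 2 + e] has derivative [- t] times its own cube, so sums and products
    close the class under partial derivatives. It is large enough to contain the smoothed
    truncations of a test function. *)
Inductive sclass : (RN -> R) -> Prop :=
| sc_smooth f : smooth f -> sclass f
| sc_add f g : sclass f -> sclass g -> sclass (fun x => f x + g x)
| sc_mul f g : sclass f -> sclass g -> sclass (fun x => f x * g x)
| sc_rsqrt (e : R) f : 0 < e -> sclass f -> sclass (fun x => (Num.sqrt (f x ^+ 2 + e))^-1).

Lemma is_derive_sqrt_sq (e t : R) : 0 < e ->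
  is_derive (t : R^o) (1 : R^o) (fun t : R^o => Num.sqrt (t ^+ 2 + e) : R^o) (t / Num.sqrt (t ^+ 2 + e)).
Proof.
move=> e0; have te0 : 0 < t ^+ 2 + e by rewrite ltr_wpDl// sqr_ge0.
have h1 : is_derive (t : R^o) (1 : R^o) (fun t : R^o => t ^+ 2 + e : R^o) (2 * t).
  have -> : (fun t : R^o => t ^+ 2 + e : R^o) = ((@id R^o) ^+ 2 + cst e) by apply/funext.
  by apply: is_derive_eq; rewrite /GRing.scale /= expr1 mulr1 addr0 mulr_natl.
have h2 := @is_derive1_sqrt R (t ^+ 2 + e) te0.
have := @is_derive1_comp R _ (fun t : R^o => t ^+ 2 + e : R^o) t _ _ h2 h1.
by move=> /is_derive_eq; apply; rewrite /GRing.scale /=; field; rewrite gt_eqF// sqrtr_gt0.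
Qed.

Lemma is_derive_rsqrt (e t : R) : 0 < e ->
  is_derive (t : R^o) (1 : R^o) (fun t : R^o => (Num.sqrt (t ^+ 2 + e))^-1 : R^o)
    (- t * (Num.sqrt (t ^+ 2 + e))^-1 ^+ 3).
Proof.
move=> e0; have te0 : 0 < t ^+ 2 + e by rewrite ltr_wpDl// sqr_ge0.
have s0 : Num.sqrt (t ^+ 2 + e) != 0 by rewrite gt_eqF// sqrtr_gt0.
have [d1 d2] := is_derive_sqrt_sq t e0.
split; first exact: derivableV.
by rewrite deriveV// d2 /GRing.scale /=; field.
Qed.

Lemma sclass_step f : sclass f ->
  (forall x, differentiable (f : RN -> R^o) x) /\ forall i, sclass (partial i f).
Proof.
elim => {f} [f sf|f g _ [df pf] _ [dg pg]|f g Cf [df pf] Cg [dg pg]|e f e0 Cf [df pf]].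
- by split; [exact: smooth_differentiable|move=> i; apply: sc_smooth; exact: smooth_partial].
- split=> [x|i]; first exact: (@differentiableD _ _ R^o f g).
  rewrite (_ : partial i _ = fun x => partial i f x + partial i g x); first exact: sc_add.
  apply/funext => x; rewrite /partial (@deriveD _ _ R^o f g)//; exact: diff_derivable.
- split=> [x|i]; first exact: (@differentiableM _ _ f g).
  rewrite (_ : partial i _ = fun x => f x * partial i g x + g x * partial i f x).
    by apply: sc_add; exact: sc_mul.
  apply/funext => x; rewrite /partial (@deriveM _ _ f g)//; exact: diff_derivable.
- have D x v := derive_comp v (df x) (is_derive_rsqrt (f x) e0).
  split=> [x|i]; first exact: (D x 0).1.
  rewrite (_ : partial i _ = fun x => -1 * (f x * partial i f x *
    ((Num.sqrt (f x ^+ 2 + e))^-1 * ((Num.sqrt (f x ^+ 2 + e))^-1 * (Num.sqrt (f x ^+ 2 + e))^-1)))).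
    apply: sc_mul.
      by apply: sc_smooth; exact: smooth_cst.
    apply: sc_mul; first exact: sc_mul.
    by apply: sc_mul; [|apply: sc_mul]; exact: sc_rsqrt.
  apply/funext => x; rewrite /partial [LHS](D x _).2.
  by rewrite exprS expr2; ring.
Qed.

Lemma sclass_smooth f : sclass f -> smooth f.
Proof. exact: (smooth_coind sclass_step). Qed.

Lemma smoothD f g : smooth f -> smooth g -> smooth (fun x => f x + g x).
Proof. by move=> sf sg; apply: sclass_smooth; apply: sc_add; exact: sc_smooth. Qed.

Lemma smoothM f g : smooth f -> smooth g -> smooth (fun x => f x * g x).
Proof. by move=> sf sg; apply: sclass_smooth; apply: sc_mul; exact: sc_smooth. Qed.

Lemma partialD f g i : smooth f -> smooth g ->
  partial i (fun x => f x + g x) = fun x => partial i f x + partial i g x.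
Proof.
move=> sf sg; apply/funext => x; rewrite /partial (@deriveD _ _ R^o f g)//.
- exact/diff_derivable/smooth_differentiable.
- exact/diff_derivable/smooth_differentiable.
Qed.

Lemma partialM f g i : smooth f -> smooth g ->
  partial i (fun x => f x * g x) = fun x => f x * partial i g x + g x * partial i f x.
Proof.
move=> sf sg; apply/funext => x; rewrite /partial (@deriveM _ _ f g)//.
- exact/diff_derivable/smooth_differentiable.
- exact/diff_derivable/smooth_differentiable.
Qed.

Lemma partialZ (c : R) f i : smooth f -> partial i (fun x => c * f x) = fun x => c * partial i f x.
Proof.
move=> sf; rewrite (@partialM (fun=> c))//; last exact: smooth_cst.
by apply/funext => x; rewrite /partial derive_cst mulr0 addr0.
Qed.

Lemma derive_partial f x (y : RN) : smooth f ->
  'D_y (f : RN -> R^o) x = \sum_(i < N) y ord0 i * partial i f x.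
Proof.
move=> sf; have df := smooth_differentiable sf x.
rewrite deriveE// [in LHS](row_sum_delta y) linear_sum; apply: eq_bigr => i _.
by rewrite linearZ /partial deriveE.
Qed.

Lemma smooth_continuous f : smooth f -> continuous (f : RN -> R).
Proof. by move=> sf x; exact/differentiable_continuous/smooth_differentiable. Qed.

Lemma continuous_measurable_euclid f : continuous f ->
  measurable_fun setT (f : euclid R N -> R).
Proof.
move=> /continuousP cf; apply: (measurability _ (RGenOpens.measurableE R)).
move=> _ [_ [a [b ->] <-]]; rewrite setTI.
by apply: borel_measurable; apply: open_borel; exact/cf/interval_open.
Qed.

Lemma smooth_measurable f : smooth f -> measurable_fun setT (f : euclid R N -> R).
Proof. by move=> sf; apply: continuous_measurable_euclid; exact: smooth_continuous. Qed.

End smooth_calculus.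

(** * Supports, bounds and directional derivatives of test functions *)

Section test_functions.
Context {R : realType} {N : nat} (Omega : set 'rV[R]_N).
Local Notation RN := 'rV[R]_N.
Local Notation test := (test_function Omega).
Local Notation supp f := (closure [set x : RN | f x != 0]).
Implicit Types f g psi : RN -> R.

Lemma test_supp psi f : test psi -> smooth f ->
  (forall x, ~ supp psi x -> f x = 0) -> test f.
Proof.
move=> [spsi cpsi psiO] sf fpsi.
have fs : supp f `<=` supp psi.
  have /closure_id -> := @closed_closure _ [set x : RN | psi x != 0].
  apply: closureS => x /= fx; apply: contrapT => /fpsi fx0.
  by rewrite fx0 eqxx in fx.
split => //; last exact: subset_trans psiO.
by apply: (subclosed_compact _ cpsi fs); exact: closed_closure.
Qed.

Lemma nsupp psi x : ~ supp psi x -> psi x = 0.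
Proof.
move=> nx; apply: contrapT => /eqP px; apply: nx; exact: subset_closure.
Qed.

Lemma partial_nsupp psi i x : ~ supp psi x -> partial i psi x = 0.
Proof.
move=> nx; rewrite /partial (@near_eq_derive _ _ R^o psi (cst 0)) ?derive_cst//.
have : nbhs x (~` supp psi) by apply: open_nbhs_nbhs; split => //; apply: closed_openC; exact: closed_closure.
by apply: filterS => z /nsupp.
Qed.

Lemma test_partial psi i : test psi -> test (partial i psi).
Proof.
move=> tpsi; apply: (test_supp tpsi); first by apply: smooth_partial; case: tpsi.
by move=> x; exact: partial_nsupp.
Qed.

Lemma testM f psi : smooth f -> test psi -> test (fun x => f x * psi x).
Proof.
move=> sf tpsi; apply: (test_supp tpsi); first by apply: smoothM => //; case: tpsi.
by move=> x /nsupp ->; rewrite mulr0.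
Qed.

Lemma testZ (c : R) psi : test psi -> test (fun x => c * psi x).
Proof. by apply: testM; exact: smooth_cst. Qed.

Lemma test0 : test ((fun=> 0) : RN -> R).
Proof.
split; first exact: smooth_cst.
  rewrite (_ : [set x | _] = set0); last by apply/seteqP; split => x //=; rewrite eqxx.
  by rewrite closure0; exact: compact0.
rewrite (_ : [set x | _] = set0); last by apply/seteqP; split => x //=; rewrite eqxx.
by rewrite closure0.
Qed.

Lemma testD f g : test f -> test g -> test (fun x => f x + g x).
Proof.
move=> [sf cf fO] [sg cg gO].
have sub : supp (fun x => f x + g x) `<=` supp f `|` supp g.
  rewrite -closureU; apply: closureS => x /= fgx.
  have [fx0|fx] := eqVneq (f x) 0; [right|by left].
  by apply: contraNneq fgx => gx0; rewrite fx0 gx0 addr0.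
split; first exact: smoothD.
- by apply: (subclosed_compact _ (compactU cf cg) sub); exact: closed_closure.
- by apply: (subset_trans sub) => x [/fO|/gO].
Qed.

Lemma test_bounded psi : test psi -> exists2 M : R, 0 <= M & forall x, `|psi x| <= M.
Proof.
move=> [spsi cpsi _].
have := compact_bounded (continuous_compact (continuous_subspaceT (smooth_continuous spsi)) cpsi).
move=> [M [_ /(_ (`|M| + 1))]].
rewrite (le_lt_trans (ler_norm _)) ?ltrDl// => /(_ isT) HM.
exists (`|M| + 1); first by rewrite addr_ge0.
move=> x; have [sx|/nsupp ->] := pselect (supp psi x).
  by apply: HM; exists x.
by rewrite normr0 addr_ge0.
Qed.

Lemma test_bounded_supp psi : test psi -> exists2 M : R, 0 <= M &
  forall x, psi x != 0 -> `|x| <= M.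
Proof.
move=> [_ cpsi _]; have := compact_bounded cpsi.
move=> [M [_ /(_ (`|M| + 1))]].
rewrite (le_lt_trans (ler_norm _)) ?ltrDl// => /(_ isT) HM.
exists (`|M| + 1); first by rewrite addr_ge0.
by move=> x px; apply: HM; exact: subset_closure.
Qed.

Lemma test_out psi x : test psi -> ~ Omega x -> psi x = 0.
Proof. by move=> [_ _ pO] nx; apply: nsupp => /pO. Qed.

Lemma test_sum n (F : 'I_n -> RN -> R) : (forall i, test (F i)) ->
  test (fun x => \sum_(i < n) F i x).
Proof.
elim: n F => [|n IH] F tF.
  rewrite (_ : (fun x => _) = fun=> 0); first exact: test0.
  by apply/funext => x; rewrite big_ord0.
rewrite (_ : (fun x => _) = fun x => \sum_(i < n) F (widen_ord (leqnSn n) i) x + F ord_max x).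
  by apply: testD => //; apply: IH => i; exact: tF.
by apply/funext => x; rewrite big_ord_recr.
Qed.

Lemma test_derive psi (y : RN) : test psi -> test (fun x => 'D_y (psi : RN -> R^o) x).
Proof.
move=> tpsi; have spsi : smooth psi by case: tpsi.
rewrite (_ : (fun x => _) = fun x => \sum_(i < N) y ord0 i * partial i psi x); last first.
  by apply/funext => x; rewrite derive_partial.
by apply: test_sum => i; apply: testZ; exact: test_partial.
Qed.

Lemma derive_cvg psi (y x : RN) : smooth psi ->
  (fun k => k.+1%:R * (psi (x + k.+1%:R^-1 *: y) - psi x)) @ \oo --> ('D_y (psi : RN -> R^o) x : R).
Proof.
move=> spsi.
have h := @diff_derivable _ _ R^o (psi : RN -> R^o) x y (smooth_differentiable spsi x).
have /cvgr_dnbhsP/(_ (fun k => k.+1%:R^-1)) := h.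
move=> /(_ (conj _ (@cvg_harmonic R))) H.
have -> : (fun k => k.+1%:R * (psi (x + k.+1%:R^-1 *: y) - psi x)) =
    (fun k => (k.+1%:R^-1)^-1 * (psi (k.+1%:R^-1 *: y + x) - psi x)).
  by apply/funext => k; rewrite invrK (addrC x).
by apply: H => n; rewrite invr_eq0 pnatr_eq0.
Qed.

(** The mean value theorem along a line; the directional derivative is again a test function, hence
    bounded. The estimate will dominate difference quotients uniformly in [x]. *)
Lemma test_lipschitz psi (y : RN) : test psi ->
  exists2 L : R, 0 <= L & forall x t, 0 <= t -> `|psi (x + t *: y) - psi x| <= L * t.
Proof.
move=> tpsi; have spsi : smooth psi by case: tpsi.
have [L L0 LP] := test_bounded (test_derive y tpsi).
exists L => // x t; rewrite le_eqVlt => /predU1P[<-|t0].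
  by rewrite scale0r addr0 subrr normr0 mulr0.
pose g (r : R) := psi (x + r *: y).
have dg r : is_derive (r : R^o) (1 : R^o) (g : R^o -> R^o) ('D_y (psi : RN -> R^o) (x + r *: y)).
  have dpsi := @diff_derivable _ _ R^o (psi : RN -> R^o) _ y (smooth_differentiable spsi (x + r *: y)).
  have E : (fun h : R => h^-1 *: ((g : R^o -> R^o) (h *: (1 : R^o) + r) - g r)) =
      (fun h : R => h^-1 *: ((psi : RN -> R^o) (h *: y + (x + r *: y)) - psi (x + r *: y))).
    apply/funext => h; congr (_ *: (psi _ - _)).
    by rewrite [_%:A]mulr1 scalerDl addrCA.
  by split; [move: dpsi; rewrite /derivable /comp /shift /= E|
             rewrite /derive /comp /shift /= E].
have [|c _ gE] := @MVT_segment R g (fun r => 'D_y (psi : RN -> R^o) (x + r *: y)) 0 t (ltW t0).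
  apply: continuous_subspaceT => r; apply: (@differentiable_continuous _ R^o R^o).
  by apply/derivable1_diffP; case: (dg r).
by move: gE; rewrite /g scale0r addr0 subr0 => ->; rewrite normrM (gtr0_norm t0) ler_wpM2r// ltW.
Qed.

End test_functions.

(** * Measure-preserving maps and translations *)

Section prehilbert_sum.
Context (R : realType) (V : zmodType) (P : V -> Prop) (sc : R -> V -> V) (B : V -> V -> R).
Hypothesis H : prehilbert P sc B.

Lemma ph_sq_sum_nat_le (e : nat -> V) n : (forall k, P (e k)) ->
  B (\sum_(k < n) e k) (\sum_(k < n) e k) <= n%:R * \sum_(k < n) B (e k) (e k).
Proof.
move=> Pe; elim: n => [|n IH]; first by rewrite !big_ord0 mul0r (phB0l H)//; exact: (ph0 H).
have PS := ph_sum H n Pe.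
rewrite !big_ord_recr /= (ph_sqD H)//.
case: n => [|n] in IH PS *.
  by rewrite !big_ord0 (phB0l H)//; [rewrite (phB0l H)// mulr0 !add0r mul1r|exact: (ph0 H)].
(* Positivity of the square of [S - m * e], with [m] the number of terms of the partial sum [S] and
   [e] the next term, bounds the cross term: [2 * m * B S e <= B S S + m ^+ 2 * B e e]. *)
have := ph_ge0 H (phB H PS (phZ H n.+1%:R (Pe n.+1))).
rewrite (ph_sqB H)//; last exact: (phZ H).
rewrite (phBZr H)// (phBZl H)//; last exact: (phZ H).
rewrite (phBZr H)//.
have n0 : (0 : R) < n.+1%:R by rewrite ltr0n.
rewrite -[n.+2%:R]natr1; move: n0 IH.
move: (B (\sum_(k < n.+1) e k) (\sum_(k < n.+1) e k)) (B (\sum_(k < n.+1) e k) (e n.+1))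
  (B (e n.+1) (e n.+1)) (\sum_(k < n.+1) B (e k) (e k)) (n.+1%:R : R) => a b c S m m0 IH h.
rewrite -(ler_pM2l m0); nra.
Qed.

Lemma ph_sq_sum_le n (F : 'I_n -> V) : (forall i, P (F i)) ->
  B (\sum_(i < n) F i) (\sum_(i < n) F i) <= n%:R * \sum_(i < n) B (F i) (F i).
Proof.
move=> PF; pose e (k : nat) := oapp F 0 (insub k : option 'I_n).
have eE (i : 'I_n) : e i = F i by rewrite /e valK.
have Pe k : P (e k) by rewrite /e; case: insub => [i|] /=; [exact: PF|exact: (ph0 H)].
have := ph_sq_sum_nat_le n Pe.
by under eq_bigr do rewrite eE; under [X in _ <= _ * X]eq_bigr do rewrite eE.
Qed.

End prehilbert_sum.

Section invariant_map.
Context d (T : measurableType d) (R : realType) (mu : {measure set T -> \bar R}).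
Variable tau : T -> T.
Hypothesis mtau : measurable_fun setT tau.
Hypothesis tau_inv : forall A, measurable A -> mu (tau @^-1` A) = mu A.
Local Notation sqT := (sqi mu setT).
Local Notation ipT := (ip mu setT).
Local Notation H := (prehilbert_L2 mu (@measurableT _ T)).

Lemma ge0_integral_inv (g : T -> \bar R) : measurable_fun setT g -> (forall x, 0 <= g x)%E ->
  (\int[mu]_x g (tau x) = \int[mu]_x g x)%E.
Proof.
move=> mg g0.
have := @ge0_integral_pushforward _ _ _ _ R _ mtau mu setT g measurableT mg (fun y _ => g0 y).
rewrite preimage_setT /= => <-.
by apply: eq_measure_integral => A mA _; exact: tau_inv.
Qed.

Lemma integral_inv (f : T -> \bar R) : measurable_fun setT f ->
  (\int[mu]_x f (tau x) = \int[mu]_x f x)%E.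
Proof.
move=> mf; rewrite integralE [RHS]integralE; congr (_ - _)%E.
- rewrite -(ge0_integral_inv (measurable_funepos mf) (funepos_ge0 f)).
  by rewrite (_ : (fun x => f (tau x)) = f \o tau)// funepos_comp.
- rewrite -(ge0_integral_inv (measurable_funeneg mf) (funeneg_ge0 f)).
  by rewrite (_ : (fun x => f (tau x)) = f \o tau)// funeneg_comp.
Qed.

Lemma Rintegral_inv (f : T -> R) : measurable_fun setT f ->
  \int[mu]_x f (tau x) = \int[mu]_x f x.
Proof.
move=> mf; rewrite /Rintegral; congr fine.
by apply: (integral_inv (f := EFin \o f)); exact/measurable_EFinP.
Qed.

Lemma integrable_inv (f : T -> R) : mu.-integrable setT (EFin \o f) ->
  mu.-integrable setT (EFin \o (f \o tau)).
Proof.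
move=> /integrableP[mf fi]; apply/integrableP; split.
  exact: (measurableT_comp mf mtau).
rewrite [X in (X < _)%E](_ : _ = (\int[mu]_x (fun y => `|(f y)%:E|%E) (tau x))%E)//.
by rewrite (integral_inv (f := fun y => `|(f y)%:E|%E))//; exact: measurableT_comp.
Qed.

Lemma sqi_inv f : sqT f -> sqT (f \o tau).
Proof.
move=> [mf fi]; split; first exact: measurableT_comp.
exact: (integrable_inv fi).
Qed.

Lemma ip_inv f : sqT f -> ipT (f \o tau) (f \o tau) = ipT f f.
Proof.
by move=> [mf _]; apply: (Rintegral_inv (f := fun x => f x * f x)); exact: measurable_funM.
Qed.

Definition displacement (f : T -> R) : R := ipT ((f \o tau) - f) ((f \o tau) - f).

Lemma sqi_displacement f : sqT f -> sqT ((f \o tau) - f).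
Proof. by move=> sf; apply: (phB H) => //; exact: sqi_inv. Qed.

Lemma displacement_le4 f : sqT f -> displacement f <= 4 * ipT f f.
Proof.
move=> sf; have := ip_sub_le (mu := mu) measurableT (sqi_inv sf) (sqiN measurableT sf).
rewrite ip_inv// (phBNl H)//; last exact: (sqiN measurableT).
rewrite (phC H sf (sqiN measurableT sf)) (phBNl H)// opprK => h; apply: le_trans h _.
by rewrite -mulrDl; lra.
Qed.

Lemma displacement_add f g : sqT f -> sqT g ->
  displacement (f + g) <= 2 * displacement f + 2 * displacement g.
Proof.
move=> sf sg.
have := ip_sub_le (mu := mu) measurableT (sqi_displacement sf) (sqi_displacement sg).
rewrite /displacement (_ : ((f + g) \o tau) - (f + g) = ((f \o tau) - f) + ((g \o tau) - g))//.
by apply/funext => x; rewrite !fctE /=; ring.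
Qed.

End invariant_map.

Section invariant_iterates.
Context d (T : measurableType d) (R : realType) (mu : {measure set T -> \bar R}).
Variable tau : T -> T.
Hypothesis mtau : measurable_fun setT tau.
Hypothesis tau_inv : forall A, measurable A -> mu (tau @^-1` A) = mu A.
Local Notation H := (prehilbert_L2 mu (@measurableT _ T)).

(** The difference between [f \o iter n tau] and [f] telescopes into [n] terms of equal norm, as
    [tau] preserves the measure. The Cauchy-Schwarz inequality costs one factor [n], the sum of the
    squares another. *)
Lemma displacement_iter n f : sqi mu setT f ->
  displacement mu (iter n tau) f <= n%:R ^+ 2 * displacement mu tau f.
Proof.
move=> sf.
have sub k g : sqi mu setT g ->
    sqi mu setT (g \o iter k tau) /\ ip mu setT (g \o iter k tau) (g \o iter k tau) = ip mu setT g g.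
  move=> sg; elim: k => [|k [IH1 IH2]]; first by [].
  have -> : g \o iter k.+1 tau = (g \o iter k tau) \o tau.
    by apply/funext => x; rewrite /= -iterSr.
  by split; [exact: (sqi_inv mtau tau_inv)|rewrite (ip_inv mtau tau_inv)].
have s1 := sqi_displacement mtau tau_inv sf.
pose e (k : nat) := ((f \o tau) - f) \o iter k tau.
have se k : sqi mu setT (e k) by exact: (sub k _ s1).1.
have := ph_sq_sum_nat_le H n se.
rewrite (_ : \sum_(k < n) e k = (f \o iter n tau) - f).
  rewrite (eq_bigr (fun=> displacement mu tau f)); last by move=> k _; exact: (sub k _ s1).2.
  rewrite (_ : \sum_(i < n) _ = n%:R * displacement mu tau f); first by rewrite mulrA -expr2.
  by rewrite sumr_const card_ord mulr_natl.
elim: n => [|n IH]; first by rewrite big_ord0; apply/funext => x; rewrite !fctE /= subrr.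
rewrite big_ord_recr /= IH; apply/funext => x; rewrite /e !fctE /=; ring.
Qed.

End invariant_iterates.

Section bounded_convergence.
Context d (T : measurableType d) (R : realType) (mu : {measure set T -> \bar R}).
Variables (K : set T) (c : R).
Hypotheses (mK : measurable K) (Kfin : (mu K < +oo)%E).

Lemma integrable_cindic (a : R) : mu.-integrable setT (fun x => (a * \1_K x)%:E).
Proof.
have iB : mu.-integrable setT (EFin \o (\1_K : T -> R)).
  apply/integrableP; split; first by apply/measurable_EFinP; exact: measurable_indic.
  rewrite (eq_integral (fun x => (\1_K x)%:E)) ?integral_indic// ?setIT//.
  by move=> x _ /=; rewrite ger0_norm.
by have := integrableZl measurableT a iB; congr (_.-integrable _); apply/funext => x.
Qed.

Lemma sqr_le_indic (t : R) x : `|t| <= c * \1_K x -> t ^+ 2 <= c ^+ 2 * \1_K x.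
Proof.
rewrite indicE; case: (_ \in _) => /=; rewrite ?mulr1 ?mulr0 => h.
  by rewrite -[t ^+ 2]real_normK ?num_real// ler_pXn2r// nnegrE// (le_trans _ h).
have -> : t = 0 by apply/eqP; rewrite -normr_eq0 eq_le normr_ge0 h.
by rewrite expr0n.
Qed.

Lemma dominated_integrable_sqi (f : T -> R) : measurable_fun setT f ->
  (forall x, `|f x| <= c * \1_K x) ->
  mu.-integrable setT (EFin \o f) /\ sqi mu setT f.
Proof.
move=> mf fc; split; last split => //.
  apply: (le_integrable measurableT _ _ (integrable_cindic c)); first exact/measurable_EFinP.
  by move=> x _ /=; rewrite lee_fin; exact: le_trans (fc x) (ler_norm _).
apply: (le_integrable measurableT _ _ (integrable_cindic (c ^+ 2))).
  by apply/measurable_EFinP; exact: measurable_funX.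
move=> x _ /=; rewrite lee_fin ger0_norm ?sqr_ge0//.
exact: le_trans (sqr_le_indic (fc x)) (ler_norm _).
Qed.

Lemma bounded_Rintegral_cvg (f_ : nat -> T -> R) (f : T -> R) (a : R) :
  (forall k, measurable_fun setT (f_ k)) -> measurable_fun setT f ->
  (forall x, (fun k => f_ k x) @ \oo --> f x) ->
  (forall k x, `|f_ k x| <= a * \1_K x) ->
  mu.-integrable setT (EFin \o f) ->
  (fun k => \int[mu]_x f_ k x) @ \oo --> \int[mu]_x f x.
Proof.
move=> mf_ mf cv hd fi.
have cvE x : (fun k => (f_ k x)%:E) @ \oo --> (f x)%:E.
  by apply: cvg_EFin; [exact: nearW|exact: cv].
have [_ _ h] := dominated_convergence (mu := mu) measurableT
    (f_ := fun k => EFin \o f_ k) (f := EFin \o f)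
    (fun k => (measurable_EFinP _ _).2 (mf_ k))
    ((measurable_EFinP _ _).2 mf)
    (aeW _ (fun x _ => cvE x))
    (integrable_cindic a)
    (aeW _ (fun x n _ => hd n x)).
by apply: fine_cvg; rewrite fineK; [exact: h|exact: (integrable_fin_num measurableT fi)].
Qed.

Lemma bounded_ip_cvg (f_ : nat -> T -> R) (f : T -> R) :
  (forall k, measurable_fun setT (f_ k)) ->
  (forall x, (fun k => f_ k x) @ \oo --> f x) ->
  (forall k x, `|f_ k x| <= c * \1_K x) -> sqi mu setT f ->
  (fun k => ip mu setT (f_ k) (f_ k)) @ \oo --> ip mu setT f f.
Proof.
move=> mf_ cv hd sf; have mf : measurable_fun setT f by case: sf.
apply: (@bounded_Rintegral_cvg (fun k x => f_ k x * f_ k x) (fun x => f x * f x) (c ^+ 2)).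
- by move=> k; exact: measurable_funM.
- exact: measurable_funM.
- by move=> x; apply: cvgM; exact: cv.
- by move=> k x; rewrite -expr2 ger0_norm ?sqr_ge0//; exact: sqr_le_indic.
- exact: sqi_mul.
Qed.

End bounded_convergence.

Section translation_L2.
Context {R : realType} {N : nat}.
Local Notation RN := 'rV[R]_N.
Local Notation mu := (@leb R N).

Definition Dsh (y : RN) (f : RN -> R) : R := displacement mu (rVshift y) f.

Lemma rVshift_iter n (y : RN) : iter n (rVshift y) = rVshift (n%:R *: y).
Proof.
elim: n => [|n IH]; first by apply/funext => x; rewrite /rVshift scale0r addr0.
by apply/funext => x; rewrite iterS IH /rVshift -natr1 scalerDl scale1r addrA.
Qed.

Lemma Dsh_telescope n (y : RN) f : sqi mu setT f ->
  Dsh (n%:R *: y) f <= n%:R ^+ 2 * Dsh y f.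
Proof.
move=> sf; rewrite /Dsh -rVshift_iter.
exact: (displacement_iter (measurable_rVshift y) (fun A _ => leb_shift y A) n sf).
Qed.

Lemma Dsh_le4 (y : RN) f : sqi mu setT f -> Dsh y f <= 4 * ip mu setT f f.
Proof. exact: (displacement_le4 (measurable_rVshift y) (fun A _ => leb_shift y A)). Qed.

Lemma Dsh_add (y : RN) f g : sqi mu setT f -> sqi mu setT g ->
  Dsh y (f + g) <= 2 * Dsh y f + 2 * Dsh y g.
Proof. exact: (displacement_add (measurable_rVshift y) (fun A _ => leb_shift y A)). Qed.

Lemma measurable_norm_ball (M : R) : measurable ([set x | `|x| <= M] : set (euclid R N)).
Proof.
apply: borel_measurable.
have -> : [set x : RN | `|x| <= M] = ~` [set x : RN | M < `|x|].
  by apply/seteqP; split => x /=; rewrite leNgt => /negP.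
apply: measurableC; apply: open_borel.
have -> : [set x : RN | M < `|x|] = Num.norm @^-1` `]M, +oo[%classic.
  by apply/seteqP; split => x /=; rewrite in_itv /= andbT.
by move: (@norm_continuous R RN) => /continuousP; apply; exact: rray_open.
Qed.

Lemma leb_norm_ball (M : R) : (mu [set x | (`|x| <= M)%R] < +oo)%E.
Proof.
apply: leb_bounded; exists M; split; first exact: num_real.
by move=> z Mz x /= xM; exact: le_trans xM (ltW Mz).
Qed.

End translation_L2.

(** * Test functions *)

Section test_integrals.
Context {R : realType} {N : nat} (Omega : set 'rV[R]_N).
Local Notation RN := 'rV[R]_N.
Local Notation mu := (@leb R N).
Local Notation sqT := (sqi mu setT).
Local Notation ipT := (ip mu setT).
Local Notation H := (prehilbert_L2 mu (@measurableT _ (euclid R N))).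
Local Notation test := (test_function Omega).
Implicit Types (psi eta : RN -> R) (y : RN).

Lemma test_norm_ball psi : test psi ->
  exists c M : R, forall x, `|psi x| <= c * \1_([set x : RN | `|x| <= M]) x.
Proof.
move=> tpsi; have [c c0 hc] := test_bounded tpsi; have [M M0 hM] := test_bounded_supp tpsi.
exists c, M => x; rewrite indicE; case: (boolP (x \in _)) => [_|]; first by rewrite mulr1.
rewrite notin_setE /= => nx; rewrite mulr0.
by have [->|/hM//] := eqVneq (psi x) 0; rewrite normr0.
Qed.

Lemma test_measurable psi : test psi -> measurable_fun setT (psi : euclid R N -> R).
Proof. by move=> [s _ _]; exact: smooth_measurable. Qed.

Lemma test_integrable_sqi psi : test psi ->
  mu.-integrable setT (EFin \o (psi : euclid R N -> R)) /\ sqT psi.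
Proof.
move=> tpsi; have [c [M h]] := test_norm_ball tpsi.
exact: (dominated_integrable_sqi (measurable_norm_ball M) (leb_norm_ball M)
  (test_measurable tpsi) h).
Qed.

Lemma test_sqi psi : test psi -> sqT psi.
Proof. by move=> /test_integrable_sqi[]. Qed.

Lemma test_integrable psi : test psi -> mu.-integrable setT (EFin \o (psi : euclid R N -> R)).
Proof. by move=> /test_integrable_sqi[]. Qed.

Definition dq psi y (k : nat) : RN -> R :=
  fun x => k.+1%:R * (psi (x + k.+1%:R^-1 *: y) - psi x).

Lemma test_shift_measurable psi y : test psi ->
  measurable_fun setT (psi \o rVshift y : euclid R N -> R).
Proof. by move=> tpsi; exact: (measurableT_comp (test_measurable tpsi) (measurable_rVshift y)). Qed.

Lemma measurable_dq psi y k : test psi -> measurable_fun setT (dq psi y k : euclid R N -> R).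
Proof.
move=> tpsi.
exact: (measurable_funM (@measurable_cst _ _ _ _ _ (k.+1%:R : R))
  (measurable_funB (test_shift_measurable (k.+1%:R^-1 *: y) tpsi) (test_measurable tpsi))).
Qed.

Lemma dq_dominated psi y : test psi ->
  exists c M : R, forall k x, `|dq psi y k x| <= c * \1_([set x : RN | `|x| <= M]) x.
Proof.
move=> tpsi; have [L L0 hL] := test_lipschitz y tpsi.
have [M M0 hM] := test_bounded_supp tpsi.
(* The step [k.+1%:R^-1] is at most 1, so [x] or its translate can meet the support only when [x]
   has norm at most [M] plus the norm of [y]. *)
exists L, (M + `|y|) => k x.
have k0 : (0 : R) < k.+1%:R^-1 by rewrite invr_gt0.
have kL : `|dq psi y k x| <= L.
  rewrite /dq normrM gtr0_norm// mulrC -ler_pdivlMr//.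
  exact: hL (ltW k0).
rewrite indicE; case: (boolP (x \in _)) => [_|]; first by rewrite mulr1.
rewrite notin_setE /= => /negP; rewrite -ltNge => nx; rewrite mulr0 /dq.
have px : psi x = 0.
  apply: contrapT => /eqP/hM; apply/negP; rewrite -ltNge; apply: le_lt_trans nx.
  by rewrite lerDl.
have pxy : psi (x + k.+1%:R^-1 *: y) = 0.
  apply: contrapT => /eqP/hM; apply/negP; rewrite -ltNge.
  have yk : `|k.+1%:R^-1 *: y| <= `|y|.
    by rewrite normrZ gtr0_norm// ler_piMl// invf_le1// ler1n.
  have := lerB_normD x (k.+1%:R^-1 *: y).
  by move: nx yk; move: `|x| `|y| `|_ *: _| `|_ + _| => a b c e; lra.
by rewrite px pxy subrr mulr0 normr0.
Qed.

Local Notation Dy psi y := (fun x : RN => 'D_y (psi : RN -> R^o) x : R).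

Lemma dq_cvg psi y x : test psi -> (fun k => dq psi y k x) @ \oo --> Dy psi y x.
Proof. by move=> [s _ _]; exact: derive_cvg. Qed.

Lemma dq_integral_cvg psi y : test psi ->
  (fun k => \int[mu]_x dq psi y k x) @ \oo --> \int[mu]_x Dy psi y x.
Proof.
move=> tpsi; have [c [M hd]] := dq_dominated y tpsi.
have tD := test_derive y tpsi.
apply: (@bounded_Rintegral_cvg _ (euclid R N) R mu [set x : RN | `|x| <= M]
  (measurable_norm_ball M) (leb_norm_ball M) (dq psi y) (Dy psi y) c).
- by move=> k; exact: measurable_dq.
- exact: (test_measurable tD).
- by move=> x; exact: dq_cvg.
- exact: hd.
- exact: (test_integrable tD).
Qed.

Lemma dq_ip_cvg psi y : test psi ->
  (fun k => ipT (dq psi y k) (dq psi y k)) @ \oo --> ipT (Dy psi y) (Dy psi y).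
Proof.
move=> tpsi; have [c [M hd]] := dq_dominated y tpsi.
have tD := test_derive y tpsi.
apply: (@bounded_ip_cvg _ (euclid R N) R mu [set x : RN | `|x| <= M] c
  (measurable_norm_ball M) (leb_norm_ball M) (dq psi y) (Dy psi y)).
- by move=> k; exact: measurable_dq.
- by move=> x; exact: dq_cvg.
- exact: hd.
- exact: (test_sqi tD).
Qed.

(** Each difference quotient has integral 0 by translation invariance, and dominated convergence
    passes to the derivative. Applied to a product of test functions, this is integration by
    parts. *)
Lemma test_integral_derive psi y : test psi -> \int[mu]_x Dy psi y x = 0.
Proof.
move=> tpsi; have h := @dq_integral_cvg psi y tpsi.
have ip_ := test_integrable tpsi.
have z k : \int[mu]_x dq psi y k x = 0.
  have is_ := integrable_inv (measurable_rVshift (k.+1%:R^-1 *: y))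
    (fun A _ => leb_shift (k.+1%:R^-1 *: y) A) ip_.
  have e := Rintegral_inv (measurable_rVshift (k.+1%:R^-1 *: y))
    (fun A _ => leb_shift (k.+1%:R^-1 *: y) A) (test_measurable tpsi).
  have eB := RintegralB (@measurableT _ (euclid R N)) is_ ip_.
  have iB := integrableB (@measurableT _ (euclid R N)) is_ ip_.
  have eZ := RintegralZl k.+1%:R (@measurableT _ (euclid R N)) iB.
  apply: (eq_trans eZ); apply/eqP; rewrite mulf_eq0; apply/orP; right; apply/eqP.
  by apply: (eq_trans eB); apply/eqP; rewrite subr_eq0; apply/eqP; exact: e.
move: h; rewrite (_ : (fun k => \int[mu]_x dq psi y k x) = fun=> 0); last by apply/funext => k; exact: z.
by move/(cvg_lim (@Rhausdorff R)) => <-; rewrite lim_cst.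
Qed.

(** When [y] is cut into [k.+1] equal steps, telescoping bounds the displacement by the squared norm
    of the difference quotient of step [k.+1%:R^-1]; then [k] tends to infinity. *)
Lemma Dsh_test psi y : test psi -> Dsh y psi <= ipT (Dy psi y) (Dy psi y).
Proof.
move=> tpsi; have h := @dq_ip_cvg psi y tpsi; have sp := test_sqi tpsi.
rewrite -(cvg_lim (@Rhausdorff R) h); apply: limr_ge; first by apply/cvg_ex; eexists; exact: h.
apply: nearW => k; have := Dsh_telescope k.+1 (k.+1%:R^-1 *: y) sp.
rewrite scalerA mulfV ?pnatr_eq0// scale1r => hk; apply: le_trans hk _.
have s1 := sqi_displacement (measurable_rVshift (k.+1%:R^-1 *: y))
  (fun A _ => leb_shift (k.+1%:R^-1 *: y) A) sp.
have e1 := phBZl H k.+1%:R s1 (phZ H k.+1%:R s1).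
have e2 := phBZr H k.+1%:R s1 s1.
rewrite le_eqVlt; apply/orP; left; apply/eqP; apply/esym; apply: (eq_trans e1).
by rewrite e2 mulrA -expr2.
Qed.

Lemma Dsh_test_gradient psi y (r : R) : test psi -> (forall i, `|y ord0 i| <= r) ->
  Dsh y psi <= N%:R * r ^+ 2 * \sum_(i < N) ipT (partial i psi) (partial i psi).
Proof.
move=> tpsi yr; apply: (le_trans (Dsh_test y tpsi)).
have sp i := test_sqi (test_partial i tpsi).
have := ph_sq_sum_le H (fun i => phZ H (y ord0 i) (sp i)).
rewrite (_ : \sum_(i < N) fscale (y ord0 i) (partial i psi) = Dy psi y); last first.
  apply/funext => x; rewrite derive_partial; last by case: tpsi.
  by rewrite fct_sumE.
move=> h; apply: le_trans h _; rewrite -mulrA ler_wpM2l// mulr_sumr; apply: ler_sum => i _.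
rewrite (phBZl H _ (sp i) (phZ H _ (sp i))) (phBZr H _ (sp i) (sp i)) mulrA -expr2.
rewrite ler_wpM2r ?(ph_ge0 H (sp i))//.
by rewrite -[y _ _ ^+ 2]real_normK ?num_real// ler_pXn2r// ?nnegrE// (le_trans _ (yr i)).
Qed.

Lemma test_by_parts psi eta i : test psi -> test eta ->
  \int[mu]_x (psi x * partial i eta x) = - \int[mu]_x (partial i psi x * eta x).
Proof.
move=> tpsi teta; have [spsi _ _] := tpsi; have [seta _ _] := teta.
have tM : test (fun x => psi x * eta x) by exact: testM.
have := test_integral_derive (delta_mx 0 i) tM.
rewrite (_ : (fun x : RN => 'D_(delta_mx 0 i) _ x) =
   (fun x => psi x * partial i eta x + partial i psi x * eta x)); last first.
  have := partialM i spsi seta; rewrite /partial => ->.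
  by apply/funext => x; rewrite (mulrC (eta x)).
have i1 := sqi_mul measurableT (test_sqi tpsi) (test_sqi (test_partial i teta)).
have i2 := sqi_mul measurableT (test_sqi (test_partial i tpsi)) (test_sqi teta).
have e := RintegralD measurableT i1 i2.
by move=> h; apply/eqP; rewrite -subr_eq0 opprK; apply/eqP; exact: eq_trans (esym e) h.
Qed.

End test_integrals.

(** * Elliptic forms *)

Section Rintegral_ae.
Context d (T : measurableType d) (R : realType) (mu : {measure set T -> \bar R}).
Variables (D : set T) (mD : measurable D).

Lemma eq_ae_Rintegral (f g : T -> R) : measurable_fun D f -> measurable_fun D g ->
  {ae mu, forall x, D x -> f x = g x} ->
  \int[mu]_(x in D) f x = \int[mu]_(x in D) g x.
Proof.
move=> mf mg fg; rewrite /Rintegral; congr fine.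
apply: ae_eq_integral => //; [exact/measurable_EFinP|exact/measurable_EFinP|].
by apply: filterS fg => x h Dx; rewrite h.
Qed.

Lemma ae_Rintegral_ge0 (f : T -> R) : measurable_fun D f ->
  {ae mu, forall x, D x -> 0 <= f x} -> 0 <= \int[mu]_(x in D) f x.
Proof.
move=> mf f0; rewrite (@eq_ae_Rintegral f (fun x => `|f x|))//.
- by apply: Rintegral_ge0.
- exact: measurableT_comp.
- by apply: filterS f0 => x h Dx; rewrite ger0_norm// h.
Qed.

Lemma ae_le_Rintegral (f g : T -> R) : mu.-integrable D (EFin \o f) ->
  mu.-integrable D (EFin \o g) -> {ae mu, forall x, D x -> f x <= g x} ->
  \int[mu]_(x in D) f x <= \int[mu]_(x in D) g x.
Proof.
move=> fi gi fg; rewrite -subr_ge0 -RintegralB//; apply: ae_Rintegral_ge0.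
  apply: measurable_funB; apply/measurable_EFinP.
  - exact: (measurable_int mu gi).
  - exact: (measurable_int mu fi).
by apply: filterS fg => x h Dx; rewrite subr_ge0 h.
Qed.

Lemma integrable_sumR n (f : 'I_n -> T -> R) :
  (forall i, mu.-integrable D (EFin \o f i)) ->
  mu.-integrable D (EFin \o (fun x => \sum_(i < n) f i x)).
Proof.
move=> fi; rewrite (_ : _ \o _ = (fun x => \sum_(i < n) (EFin \o f i) x)%E).
  exact: integrable_sum.
by apply/funext => x /=; rewrite sumEFin.
Qed.

Lemma Rintegral_sum n (f : 'I_n -> T -> R) :
  (forall i, mu.-integrable D (EFin \o f i)) ->
  \int[mu]_(x in D) (\sum_(i < n) f i x) = \sum_(i < n) \int[mu]_(x in D) f i x.
Proof.
elim: n f => [|n IH] f fi.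
  rewrite big_ord0 (_ : (fun x => _) = fun=> 0); last by apply/funext => x; rewrite big_ord0.
  by rewrite Rintegral_cst// mul0r.
rewrite big_ord_recr /= -IH// -RintegralD//.
  by apply: eq_Rintegral => x _; rewrite big_ord_recr.
by apply: integrable_sumR => i; exact: fi.
Qed.

Lemma sqi_mul_bounded (a u : T -> R) (M : R) : measurable_fun D a ->
  {ae mu, forall x, D x -> `|a x| <= M} -> sqi mu D u -> sqi mu D (fun x => a x * u x).
Proof.
move=> ma aM su; apply: (sqi_ae_le mD (sqiZ mD M su)).
  by apply: measurable_funM => //; case: su.
apply: filterS aM => x h Dx; rewrite /fscale !normrM ler_wpM2r//.
exact: le_trans (h Dx) (ler_norm _).
Qed.

End Rintegral_ae.

Definition gscale {R : realType} {T : Type} {n : nat} (c : R) (G : 'I_n -> T -> R) : 'I_n -> T -> R :=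
  fun i => fscale c (G i).

(** * The elliptic form on square-integrable vector fields *)

Section elliptic_form.
Context d (T : measurableType d) (R : realType) (mu : {measure set T -> \bar R}).
Variables (D : set T) (mD : measurable D) (n : nat) (a : 'I_n -> 'I_n -> T -> R) (M gamma : R).
Hypothesis ma : forall i j, measurable_fun D (a i j).
Hypothesis aM : forall i j, {ae mu, forall x, D x -> `|a i j x| <= M}.
Hypothesis aC : forall i j, {ae mu, forall x, D x -> a i j x = a j i x}.
Hypothesis gamma0 : 0 < gamma.
Hypothesis aE : {ae mu, forall x, D x -> forall xi : 'rV[R]_n,
  gamma * (\sum_(i < n) xi 0 i ^+ 2) <= \sum_(i < n) \sum_(j < n) a i j x * xi 0 i * xi 0 j}.
Local Notation sq := (sqi mu D).

Definition gform (G H : 'I_n -> T -> R) : R :=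
  \sum_(i < n) \sum_(j < n) \int[mu]_(x in D) (a i j x * G i x * H j x).

Definition gsq (G : 'I_n -> T -> R) : Prop := forall i, sq (G i).

Lemma sqi_coef_mul i j u : sq u -> sq (fun x => a i j x * u x).
Proof. exact: (sqi_mul_bounded mD (ma i j) (aM i j)). Qed.

Lemma integrable_coef_mul i j u v : sq u -> sq v ->
  mu.-integrable D (EFin \o (fun x => a i j x * u x * v x)).
Proof. by move=> su sv; exact: (sqi_mul mD (sqi_coef_mul i j su) sv). Qed.

Lemma gformE G H : gsq G -> gsq H -> gform G H =
  \int[mu]_(x in D) (\sum_(i < n) \sum_(j < n) a i j x * G i x * H j x).
Proof.
move=> sG sH; rewrite (Rintegral_sum mD); last first.
  by move=> i; apply: integrable_sumR => // j; exact: integrable_coef_mul.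
by apply: eq_bigr => i _; rewrite (Rintegral_sum mD)// => j; exact: integrable_coef_mul.
Qed.

Lemma integrable_gform G H : gsq G -> gsq H -> mu.-integrable D
  (EFin \o (fun x => \sum_(i < n) \sum_(j < n) a i j x * G i x * H j x)).
Proof.
move=> sG sH; apply: integrable_sumR => // i; apply: integrable_sumR => // j.
exact: integrable_coef_mul.
Qed.

Lemma gform_coercive G : gsq G ->
  gamma * \sum_(i < n) ip mu D (G i) (G i) <= gform G G.
Proof.
move=> sG; rewrite gformE// -(Rintegral_sum mD); last by move=> i; exact: sqi_mul.
have iS := integrable_sumR mD (fun i => sqi_mul mD (sG i) (sG i)).
rewrite -RintegralZl//; apply: ae_le_Rintegral => //.
- by have := integrableZl mD gamma iS; congr (_.-integrable _); apply/funext => x.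
- exact: integrable_gform.
apply: filterS aE => x h Dx; have := h Dx (\row_i G i x).
congr (gamma * _ <= _); first by apply: eq_bigr => i _; rewrite mxE expr2.
by apply: eq_bigr => i _; apply: eq_bigr => j _; rewrite !mxE.
Qed.

Lemma gform_ge0 G : gsq G -> 0 <= gform G G.
Proof.
move=> sG; apply: le_trans (gform_coercive sG); rewrite mulr_ge0 ?(ltW gamma0)//.
by apply: sumr_ge0 => i _; exact: (ph_ge0 (prehilbert_L2 mu mD) (sG i)).
Qed.

(** Each entry contributes at most [|M|] times a sum of two squares. The estimate turns convergence
    of gradients in L^2 into convergence in energy. *)
Lemma gform_bounded G : gsq G ->
  gform G G <= 2 * n%:R * `|M| * \sum_(i < n) ip mu D (G i) (G i).
Proof.
move=> sG; rewrite /gform.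
apply: (@le_trans _ _ (\sum_(i < n) \sum_(j < n) `|M| * (ip mu D (G i) (G i) + ip mu D (G j) (G j)))).
  apply: ler_sum => i _; apply: ler_sum => j _.
  rewrite /ip -RintegralD//; try exact: sqi_mul.
  have iD := integrableD mD (sqi_mul mD (sG i) (sG i)) (sqi_mul mD (sG j) (sG j)).
  rewrite -RintegralZl//; apply: ae_le_Rintegral => //.
  - exact: integrable_coef_mul.
  - by have := integrableZl mD `|M| iD; congr (_.-integrable _); apply/funext => x.
  apply: filterS (aM i j) => x h Dx; have {}h := le_trans (h Dx) (ler_norm M).
  rewrite -mulrA; apply: (le_trans (ler_norm _)); rewrite normrM.
  apply: ler_pM => //; rewrite ler_norml; have := sqr_ge0 (G i x + G j x).
  have := sqr_ge0 (G i x - G j x); move: (G i x) (G j x) => u v *; apply/andP; split; nra.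
rewrite le_eqVlt; apply/orP; left; apply/eqP.
rewrite (eq_bigr (fun i => `|M| * (n%:R * ip mu D (G i) (G i)) +
    `|M| * \sum_(j < n) ip mu D (G j) (G j))); last first.
  move=> i _; rewrite -!mulr_sumr big_split /= sumr_const card_ord mulr_natl.
  by rewrite mulrDr.
rewrite big_split /= sumr_const card_ord -!mulr_sumr -[X in _ + X]mulr_natl; ring.
Qed.

(** The integrand is nonnegative by ellipticity and gets multiplied by [m x ^+ 2], at most 1. By the
    chain rule [m] will be the slope of a smoothed truncation. *)
Lemma gform_contraction (m : T -> R) G : measurable_fun D m ->
  (forall x, 0 <= m x <= 1) -> gsq G ->
  gsq (fun i x => m x * G i x) /\
  gform (fun i x => m x * G i x) (fun i x => m x * G i x) <= gform G G.
Proof.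
move=> mm m01 sG.
have sm : gsq (fun i x => m x * G i x).
  move=> i; apply: (sqi_mul_bounded mD mm (M := 1)) => //.
  by apply: aeW => x _; have /andP[? ?] := m01 x; rewrite ger0_norm.
split => //; rewrite !gformE//; apply: ae_le_Rintegral; try exact: integrable_gform.
  exact: mD.
apply: filterS aE => x h Dx; have := h Dx (\row_i G i x).
have /andP[m0 m1] := m01 x.
rewrite (_ : \sum_(i < n) \sum_(j < n) a i j x * (m x * G i x) * (m x * G j x) = m x ^+ 2 * \sum_(i < n) \sum_(j < n) a i j x * G i x * G j x); last first.
  rewrite mulr_sumr; apply: eq_bigr => i _; rewrite mulr_sumr; apply: eq_bigr => j _; ring.
under [X in _ <= X -> _]eq_bigr do under eq_bigr do rewrite !mxE.
rewrite [X in gamma * X](eq_bigr (fun i => G i x ^+ 2)); last by move=> i _; rewrite mxE.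
have S0 : 0 <= gamma * \sum_(i < n) G i x ^+ 2.
  by rewrite mulr_ge0 ?(ltW gamma0)//; apply: sumr_ge0 => i _; exact: sqr_ge0.
move=> /(le_trans S0) S1; rewrite ler_piMl//.
by rewrite expr_le1.
Qed.

Lemma prehilbert_gform : prehilbert gsq gscale gform.
Proof.
have HL := prehilbert_L2 mu mD.
split.
- by move=> u v su sv i; apply: (phD HL); [exact: su|exact: sv].
- by move=> u su i; apply: (phN HL); exact: su.
- by move=> c u su i; apply: (phZ HL); exact: su.
- by move=> i; exact: (ph0 HL).
- move=> u v su sv; rewrite /gform exchange_big /=; apply: eq_bigr => i _; apply: eq_bigr => j _.
  apply: eq_ae_Rintegral => //.
  + by apply/measurable_EFinP; exact: (measurable_int mu (integrable_coef_mul j i (su j) (sv i))).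
  + by apply/measurable_EFinP; exact: (measurable_int mu (integrable_coef_mul i j (sv i) (su j))).
  by apply: filterS (aC i j) => x h Dx; rewrite h//; ring.
- move=> u v w su sv sw; rewrite /gform -big_split /=; apply: eq_bigr => i _.
  rewrite -big_split /=; apply: eq_bigr => j _.
  rewrite -RintegralD//; try exact: integrable_coef_mul.
  by apply: eq_Rintegral => x _; rewrite !fctE; ring.
- move=> c u w su sw; rewrite /gform mulr_sumr; apply: eq_bigr => i _.
  rewrite mulr_sumr; apply: eq_bigr => j _.
  rewrite -RintegralZl//; try exact: integrable_coef_mul.
  by apply: eq_Rintegral => x _; rewrite /gscale /fscale; ring.
- exact: gform_ge0.
Qed.

End elliptic_form.

Section prehilbert_inequalities.
Context (R : realType) (X : zmodType) (Q : X -> Prop) (sc : R -> X -> X) (C : X -> X -> R).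
Hypothesis HC : prehilbert Q sc C.

Lemma ph_sqN x : Q x -> C (- x) (- x) = C x x.
Proof.
move=> Qx; have Qnx := phN HC Qx.
by rewrite (phBNl HC)// (phC HC Qx Qnx) (phBNl HC)// opprK.
Qed.

(** Positivity of the square of [eta * y - (x - y)]. It replaces the triangle inequality for squared
    norms, with a factor [1 + eta] as close to 1 as desired, so that limits lose no constant. *)
Lemma ph_near (x y : X) (eta : R) : Q x -> Q y -> 0 < eta ->
  C x x <= (1 + eta) * C y y + (1 + eta^-1) * C (x - y) (x - y).
Proof.
move=> Qx Qy eta0; have Qz := phB HC Qx Qy.
have -> : C x x = C (y + (x - y)) (y + (x - y)) by rewrite addrC subrK.
rewrite (ph_sqD HC)//.
have Qey := phZ HC eta Qy; have := ph_ge0 HC (phB HC Qey Qz).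
rewrite (ph_sqB HC)// (phBZr HC)// !(phBZl HC)//.
move: (C y y) (C y (x - y)) (C (x - y) (x - y)) => p q r h.
rewrite -subr_ge0 (_ : _ - _ = (eta * (eta * p) - 2 * (eta * q) + r) / eta); last first.
  by field; rewrite lt0r_neq0.
by rewrite divr_ge0// ltW.
Qed.

Lemma ph_sqZB (x y : X) (c : R) : Q x -> Q y ->
  C (sc c x - sc c y) (sc c x - sc c y) = c ^+ 2 * C (x - y) (x - y).
Proof.
move=> Qx Qy; have Qcx := phZ HC c Qx; have Qcy := phZ HC c Qy.
rewrite !(ph_sqB HC)// !(phBZr HC)// !(phBZl HC)//; ring.
Qed.

Lemma ph_sqD_le (x y : X) : Q x -> Q y -> C (x + y) (x + y) <= 2 * C x x + 2 * C y y.
Proof.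
move=> Qx Qy; rewrite (ph_sqD HC)//.
by have := ph_ge0 HC (phB HC Qx Qy); rewrite (ph_sqB HC)//; lra.
Qed.

End prehilbert_inequalities.

(** * The variational formula for the resolvent form, in abstract spaces *)

Section energy_approximation.
Context (R : realType) (V W : zmodType).
Context (P : V -> Prop) (scV : R -> V -> V) (B : V -> V -> R) (H : prehilbert P scV B).
Context (PE : W -> Prop) (scW : R -> W -> W) (E : W -> W -> R) (HE : prehilbert PE scW E).
Variables (tst : V -> Prop) (grad : V -> W) (phi : nat -> V) (Dphi : nat -> W) (lam : nat -> R).
Hypothesis tstP : forall u, tst u -> P u.
Hypothesis gradP : forall u, tst u -> PE (grad u).
Hypothesis tst_lin : forall (c : R) u v, tst u -> tst v ->
  tst (u + scV c v) /\ grad (u + scV c v) = grad u + scW c (grad v).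
Hypothesis tst0 : tst 0 /\ grad 0 = 0.
Hypothesis phiP : forall n, P (phi n).
Hypothesis DphiP : forall n, PE (Dphi n).
Hypothesis lam0 : forall n, 0 < lam n.
Hypothesis phi_ortho : forall m n, B (phi m) (phi n) = (m == n)%:R.
Hypothesis Dphi_ortho : forall m n, E (Dphi m) (Dphi n) = lam m * (m == n)%:R.
Hypothesis Dphi_grad : forall n u, tst u -> E (Dphi n) (grad u) = lam n * B (phi n) u.
Hypothesis phi_dense : forall n (e : R), 0 < e -> exists2 u, tst u &
  B (u - phi n) (u - phi n) <= e /\ E (grad u - Dphi n) (grad u - Dphi n) <= e.
Hypothesis phi_complete : forall v, P v -> forall e : R, 0 < e -> exists M : nat,
  B v v - \sum_(n < M) B (phi n) v ^+ 2 <= e.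

Lemma Dphi_ortho' : forall m n, B (phi m) (phi n) = 1 * (m == n)%:R.
Proof. by move=> m n; rewrite mul1r. Qed.

(** Bessel's inequality in both forms reduces the claim to a single mode, where the minimum over [y]
    of [l * y ^+ 2 + t * (x - y) ^+ 2] is [l * t / (l + t) * x ^+ 2]. *)
Lemma energy_lower v u t M : P v -> tst u -> 0 < t ->
  t * (\sum_(n < M) lam n / (lam n + t) * B (phi n) v ^+ 2) <=
  E (grad u) (grad u) + t * B (v - u) (v - u).
Proof.
move=> Pv tu t0; have Pu := tstP tu.
have b1 := ph_bessel HE DphiP Dphi_ortho M (gradP tu) (fun n => Dphi_grad n tu).
have b2 := ph_bessel H phiP Dphi_ortho' M (phB H Pv Pu) (fun n => esym (mul1r _)).
apply: le_trans (lerD b1 (ler_wpM2l (ltW t0) b2)).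
rewrite !mulr_sumr -big_split /=; apply: ler_sum => n _.
have l0 := lam0 n; rewrite (phBBr H)// mul1r.
move: (lam n) (B (phi n) v) (B (phi n) u) l0 => l x y l0.
have lt0 : 0 < l + t by rewrite addr_gt0.
rewrite -subr_ge0 (_ : _ - _ = ((l + t) * y - t * x) ^+ 2 / (l + t)); last by field; rewrite lt0r_neq0.
by rewrite divr_ge0 ?sqr_ge0// ltW.
Qed.

Lemma finite_combination_dense (w : nat -> R) M (e : R) : 0 < e ->
  exists2 u, tst u &
  B (u - \sum_(n < M) scV (w n) (phi n)) (u - \sum_(n < M) scV (w n) (phi n)) <= e /\
  E (grad u - \sum_(n < M) scW (w n) (Dphi n)) (grad u - \sum_(n < M) scW (w n) (Dphi n)) <= e.
Proof.
elim: M e => [|M IH] e e0.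
  have [t0 g0] := tst0; exists 0 => //.
  by rewrite !big_ord0 g0 !subr0 (phB0l H) ?(phB0l HE) ?(ltW e0)//; [exact: (ph0 HE)|exact: (ph0 H)].
have e40 : 0 < e / 4 by rewrite divr_gt0.
have [u tu [u1 u2]] := IH _ e40.
(* Both errors will be doubled, and the new one is also multiplied by [w M ^+ 2]; the added 1 covers
   a vanishing coefficient. *)
have d0 : 0 < e / 4 / (1 + w M ^+ 2) by rewrite divr_gt0// ltr_pwDl// sqr_ge0.
have [p tp [p1 p2]] := phi_dense M d0.
have [tup gup] := tst_lin (w M) tu tp.
exists (u + scV (w M) p) => //.
have PSV := ph_sum H (e := fun n => scV (w n) (phi n)) M (fun n => phZ H (w n) (phiP n)).
have PSW := ph_sum HE (e := fun n => scW (w n) (Dphi n)) M (fun n => phZ HE (w n) (DphiP n)).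
have key x : x <= e / 4 / (1 + w M ^+ 2) -> w M ^+ 2 * x <= e / 4.
  rewrite ler_pdivlMr; last by rewrite ltr_pwDl// sqr_ge0.
  have [x0|x0] := leP 0 x; first by nra.
  by have := sqr_ge0 (w M); nra.
split; rewrite big_ord_recr /= ?gup opprD addrACA.
  apply: le_trans (ph_sqD_le H (phB H (tstP tu) PSV) (phB H (phZ H _ (tstP tp)) (phZ H _ (phiP M)))) _.
  rewrite (ph_sqZB H _ (tstP tp) (phiP M)).
  by have := key _ p1; lra.
apply: le_trans (ph_sqD_le HE (phB HE (gradP tu) PSW) (phB HE (phZ HE _ (gradP tp)) (phZ HE _ (DphiP M)))) _.
rewrite (ph_sqZB HE _ (gradP tp) (DphiP M)).
by have := key _ p2; lra.
Qed.

(** The minimiser has coefficients [t / (lam n + t)] times those of [v]; its first [M] modes are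
    approximated by a test function. The error [e] is shared in thirds between the modes beyond [M],
    the factor [1 + eta] and this approximation. *)
Lemma energy_upper v t Q e : P v -> 0 < t -> 0 < e ->
  (forall M, \sum_(n < M) lam n / (lam n + t) * B (phi n) v ^+ 2 <= Q) ->
  exists2 u, tst u & E (grad u) (grad u) + t * B (v - u) (v - u) <= t * Q + e.
Proof.
move=> Pv t0 e0 HQ.
have Q0 : 0 <= Q by have := HQ 0%N; rewrite big_ord0.
have d0 : 0 < e / (3 * t) by rewrite divr_gt0// mulr_gt0.
have [M HM] := phi_complete Pv d0.
pose w n := t / (lam n + t) * B (phi n) v.
set X := t * Q + e / 3.
have X0 : 0 < X by rewrite ltr_wpDl ?mulr_ge0 ?(ltW t0)// divr_gt0.
pose eta := e / (3 * (X + 1)).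
have eta0 : 0 < eta by rewrite divr_gt0// mulr_gt0// addr_gt0.
have etaX : eta * X <= e / 3.
  rewrite /eta mulrAC ler_pdivrMr; last by rewrite mulr_gt0// addr_gt0.
  by nra.
pose k := (1 + eta^-1) * (1 + t).
have k0 : 0 < k by rewrite mulr_gt0// addr_gt0// invr_gt0.
have ek0 : 0 < e / 3 / k by rewrite !divr_gt0.
have [u tu [u1 u2]] := finite_combination_dense w M ek0.
exists u => //; have Pu := tstP tu.
have PSV := ph_sum H (e := fun n => scV (w n) (phi n)) M (fun n => phZ H (w n) (phiP n)).
have PSW := ph_sum HE (e := fun n => scW (w n) (Dphi n)) M (fun n => phZ HE (w n) (DphiP n)).
move: u1 u2; set Sv := \sum_(n < M) scV _ _; set Sw := \sum_(n < M) scW _ _ => u1 u2.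
rewrite -/Sv in PSV; rewrite -/Sw in PSW.
have ESw : E Sw Sw = \sum_(n < M) lam n * w n ^+ 2 by exact: (ph_sq_sum HE w DphiP Dphi_ortho).
have BSv : B Sv Sv = \sum_(n < M) 1 * w n ^+ 2 by exact: (ph_sq_sum H w phiP Dphi_ortho').
have BvSv : B v Sv = \sum_(n < M) w n * B (phi n) v.
  rewrite (phC H Pv PSV) (ph_suml H M (fun n => phZ H (w n) (phiP n)) Pv).
  by apply: eq_bigr => n _; rewrite (phBZl H).
have main : E Sw Sw + t * B (v - Sv) (v - Sv) <= X.
  rewrite (ph_sqB H)// ESw BSv BvSv.
  have : t * (B v v - \sum_(n < M) B (phi n) v ^+ 2) <= e / 3.
    apply: le_trans (ler_wpM2l (ltW t0) HM) _.
    by rewrite le_eqVlt; apply/orP; left; apply/eqP; field; rewrite lt0r_neq0.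
  have := ler_wpM2l (ltW t0) (HQ M).
  have -> : t * (\sum_(n < M) lam n / (lam n + t) * B (phi n) v ^+ 2) =
     \sum_(n < M) lam n * w n ^+ 2 + t * (\sum_(n < M) B (phi n) v ^+ 2 -
       2 * (\sum_(n < M) w n * B (phi n) v) + \sum_(n < M) 1 * w n ^+ 2).
    rewrite !mulr_sumr -sumrB -big_split /= !mulr_sumr -big_split /=.
    apply: eq_bigr => n _; rewrite /w; field; rewrite lt0r_neq0// addr_gt0//.
  by rewrite /X; lra.
have n1 := ph_near HE (gradP tu) PSW eta0.
have n2 := ph_near H (phB H Pv Pu) (phB H Pv PSV) eta0.
have vE : B ((v - u) - (v - Sv)) ((v - u) - (v - Sv)) = B (u - Sv) (u - Sv).
  have -> : (v - u) - (v - Sv) = - (u - Sv) by rewrite opprB addrC addrA subrK opprB.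
  by rewrite (ph_sqN H)//; exact: (phB H).
rewrite vE in n2.
apply: le_trans (lerD n1 (ler_wpM2l (ltW t0) n2)) _.
have f1 : (1 + eta) * (E Sw Sw + t * B (v - Sv) (v - Sv)) <= (1 + eta) * X.
  by rewrite ler_wpM2l// addr_ge0// ltW.
have f2 : (1 + eta^-1) * (E (grad u - Sw) (grad u - Sw) + t * B (u - Sv) (u - Sv)) <= e / 3.
  apply: (@le_trans _ _ ((1 + eta^-1) * ((1 + t) * (e / 3 / k)))).
    rewrite ler_wpM2l//; first by rewrite addr_ge0// ltW// invr_gt0.
    by rewrite mulrDl mul1r lerD// ler_wpM2l// ltW.
  rewrite le_eqVlt; apply/orP; left; apply/eqP.
  transitivity (k * (e / 3 / k)); first exact: mulrA.
  by rewrite [LHS]mulrC divfK// lt0r_neq0.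
move: f1 f2 etaX; rewrite /X.
move: (E Sw Sw) (B (v - Sv) _) (E (_ - _) _) (B (u - Sv) _) (1 + eta^-1) => p q r y z.
rewrite mulrDl mul1r; lra.
Qed.

(** A nearly optimal test function for [v] is carried to a competitor for [F v]: [energy_upper] is
    used for [v] and [energy_lower] for [F v]. The slack [d] leaves room for smoothing [F] on test
    functions. *)
Lemma energy_contraction (F : V -> V) v t Q : P v -> P (F v) -> 0 < t ->
  (forall u d, tst u -> 0 < d -> exists2 u', tst u' & E (grad u') (grad u') <= E (grad u) (grad u) /\
     B (F v - u') (F v - u') <= (1 + d) * B (v - u) (v - u) + d) ->
  (forall M, \sum_(n < M) lam n / (lam n + t) * B (phi n) v ^+ 2 <= Q) ->
  forall M, \sum_(n < M) lam n / (lam n + t) * B (phi n) (F v) ^+ 2 <= Q.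
Proof.
move=> Pv PFv t0 HF HQ M.
have Q0 : 0 <= Q by have := HQ 0%N; rewrite big_ord0.
rewrite -(ler_pM2l t0); apply/ler_addgt0Pr => e e0.
have e20 : 0 < e / 2 by rewrite divr_gt0.
have [u tu Hu] := energy_upper Pv t0 e20 HQ.
have Euu := ph_ge0 HE (gradP tu).
have Bvu := ph_ge0 H (phB H Pv (tstP tu)).
(* The relative and the absolute error, multiplied by [t], add up to [e / 2]. *)
pose d := e / 2 / (t * (B (v - u) (v - u) + 1)).
have d0 : 0 < d by rewrite divr_gt0// mulr_gt0// ltr_wpDl.
have [u' tu' [Eu' Bu']] := HF u d tu d0.
apply: (le_trans (energy_lower M PFv tu' t0)).
have := ler_wpM2l (ltW t0) Bu'.
have : t * (d * (B (v - u) (v - u) + 1)) <= e / 2.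
  rewrite /d le_eqVlt; apply/orP; left; apply/eqP; field.
  by rewrite !lt0r_neq0// ltr_wpDl.
move: Hu Eu'; move: (E _ _) (E _ _) (B _ _) (B _ _) => p q r y; lra.
Qed.

End energy_approximation.

(** * Truncations *)

Section clamp.
Context {R : realType}.
Implicit Types k e s t : R.

Definition clamp k t : R := (`|t + k| - `|t - k|) / 2.

Lemma clampP k t : 0 <= k -> [\/ t <= - k /\ clamp k t = - k, k <= t /\ clamp k t = k |
  (- k <= t /\ t <= k) /\ clamp k t = t].
Proof.
move=> k0; rewrite /clamp; have [h1|h1] := leP t (- k).
  by apply: Or31; split => //; rewrite (@ler0_norm _ (t + k)) ?(@ler0_norm _ (t - k)); lra.
have [h2|h2] := leP k t.
  by apply: Or32; split => //; rewrite (@ger0_norm _ (t + k)) ?(@ger0_norm _ (t - k)); lra.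
apply: Or33; rewrite (@ger0_norm _ (t + k)) ?(@ler0_norm _ (t - k)); lra.
Qed.

Lemma clamp0 k : clamp k 0 = 0.
Proof. by rewrite /clamp add0r sub0r normrN subrr mul0r. Qed.

Lemma clamp_homo k : 0 <= k -> {homo clamp k : s t / s <= t}.
Proof.
move=> k0 s t st.
by case: (clampP s k0) => [[? ->]|[? ->]|[[? ?] ->]];
  case: (clampP t k0) => [[? ->]|[? ->]|[[? ?] ->]]; lra.
Qed.

Lemma clamp_lip k s t : 0 <= k -> `|clamp k s - clamp k t| <= `|s - t|.
Proof.
move=> k0; wlog st : s t / t <= s => [h|].
  have [|/ltW] := leP t s; first exact: h.
  by rewrite distrC (distrC s); exact: h.
have := clamp_homo k0 st; rewrite -[t <= s]subr_ge0 -[_ <= clamp k s]subr_ge0 in st *.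
move=> cst; rewrite !ger0_norm//; move: st {cst}.
by case: (clampP s k0) => [[? ->]|[? ->]|[[? ?] ->]];
  case: (clampP t k0) => [[? ->]|[? ->]|[[? ?] ->]]; lra.
Qed.

Lemma clamp_norm k t : 0 <= k -> `|clamp k t| <= `|t|.
Proof. by move=> k0; have := clamp_lip t 0 k0; rewrite clamp0 !subr0. Qed.

Lemma clamp_le k t : 0 <= k -> `|clamp k t| <= k.
Proof.
move=> k0; rewrite ler_norml.
by case: (clampP t k0) => [[? ->]|[? ->]|[[? ?] ->]]; apply/andP; split; lra.
Qed.

Lemma clamp_id k t : `|t| <= k -> clamp k t = t.
Proof.
move=> tk; have k0 := le_trans (normr_ge0 t) tk; move: tk; rewrite ler_norml => /andP[? ?].
by case: (clampP t k0) => [[? ->]|[? ->]|[[? ?] ->]]; lra.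
Qed.

Lemma clamp_large k t : 0 <= k -> k <= `|t| -> `|clamp k t| = k.
Proof.
move=> k0 kt; case: (clampP t k0) => [[? ->]|[? ->]|[[? ?] ->]].
- by rewrite normrN ger0_norm.
- by rewrite ger0_norm.
- by apply/eqP; rewrite eq_le kt andbT ler_norml; apply/andP; split; lra.
Qed.

(** This is [clamp] with each absolute value smoothed to a root. It still vanishes at 0, so
    composing with it does not enlarge the support of a test function. *)
Definition sclamp k e t : R := (Num.sqrt ((t + k) ^+ 2 + e) - Num.sqrt ((t - k) ^+ 2 + e)) / 2.

Lemma sclamp0 k e : sclamp k e 0 = 0.
Proof. by rewrite /sclamp add0r sub0r sqrrN subrr mul0r. Qed.

Lemma sqrt_sqD e s : 0 <= e -> `|s| <= Num.sqrt (s ^+ 2 + e) <= `|s| + Num.sqrt e.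
Proof.
move=> e0; have se := sqrtr_ge0 e; have ses : Num.sqrt e ^+ 2 = e by rewrite sqr_sqrtr.
apply/andP; split.
  by rewrite -(sqrtr_sqr s) ler_wsqrtr// lerDl.
rewrite -[leRHS]ger0_norm ?addr_ge0// -sqrtr_sqr ler_wsqrtr//.
by rewrite sqrrD real_normK ?num_real// ses lerD2r lerDl mulrn_wge0// mulr_ge0.
Qed.

Lemma sclamp_clamp k e t : 0 <= e -> `|sclamp k e t - clamp k t| <= Num.sqrt e.
Proof.
move=> e0; have /andP[a1 a2] := sqrt_sqD (t + k) e0; have /andP[b1 b2] := sqrt_sqD (t - k) e0.
rewrite /sclamp /clamp ler_norml; move: a1 a2 b1 b2.
move: (Num.sqrt _) (Num.sqrt _) `|t + k| `|t - k| (Num.sqrt e) => A A' B B' C *.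
by apply/andP; split; lra.
Qed.

(** The derivative of the root of [s ^+ 2 + e]. As it is nondecreasing with values between -1 and 1,
    the slope of [sclamp] lies between 0 and 1. *)
Definition hfun e s : R := s * (Num.sqrt (s ^+ 2 + e))^-1.

Lemma hfun_homo e : 0 < e -> {homo hfun e : s t / s <= t}.
Proof.
move=> e0.
have pos s : 0 < Num.sqrt (s ^+ 2 + e) by rewrite sqrtr_gt0 ltr_wpDl// sqr_ge0.
have nn s t : 0 <= s -> s <= t -> hfun e s <= hfun e t.
  move=> s0 st; rewrite /hfun ler_pdivrMr// mulrAC ler_pdivlMr//.
  have t0 := le_trans s0 st.
  have sE (x : R) : 0 <= x -> x = Num.sqrt (x ^+ 2) by move=> x0; rewrite sqrtr_sqr ger0_norm.
  rewrite {1}(sE s)// {2}(sE t)// -!sqrtrM ?sqr_ge0// ler_wsqrtr//.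
  suff : s ^+ 2 <= t ^+ 2 by move=> h; have := ltW e0; nra.
  by rewrite ler_pXn2r// nnegrE.
have odd s : hfun e (- s) = - hfun e s by rewrite /hfun sqrrN mulNr.
move=> s t st; have [s0|s0] := leP 0 s; first exact: nn.
have [t0|t0] := leP 0 t.
  apply: (@le_trans _ _ 0); rewrite /hfun.
  - by rewrite mulr_le0_ge0 ?(ltW s0)// invr_ge0 ltW.
  - by rewrite mulr_ge0// invr_ge0 ltW.
by rewrite -lerN2 -!odd; apply: nn; rewrite ?lerN2// oppr_ge0 ltW.
Qed.

Lemma hfun_le1 e s : 0 < e -> `|hfun e s| <= 1.
Proof.
move=> e0; have pos : 0 < Num.sqrt (s ^+ 2 + e) by rewrite sqrtr_gt0 ltr_wpDl// sqr_ge0.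
rewrite /hfun normrM normfV (gtr0_norm pos) ler_pdivrMr// mul1r.
by have /andP[] := sqrt_sqD s (ltW e0).
Qed.

Lemma is_derive_sclamp k e t : 0 < e ->
  is_derive (t : R^o) (1 : R^o) (sclamp k e : R^o -> R^o) ((hfun e (t + k) - hfun e (t - k)) / 2).
Proof.
move=> e0.
have sh c : is_derive (t : R^o) (1 : R^o) (fun t : R^o => Num.sqrt ((t + c) ^+ 2 + e) : R^o) (hfun e (t + c)).
  have h1 : is_derive (t : R^o) (1 : R^o) (fun t : R^o => t + c : R^o) (1 : R^o).
    have -> : (fun t : R^o => t + c : R^o) = ((@id R^o) + cst c) by apply/funext.
    by apply: is_derive_eq; rewrite addr0.
  have := @is_derive1_comp R _ (fun t : R^o => t + c : R^o) t _ _ (is_derive_sqrt_sq (t + c) e0) h1.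
  by move=> /is_derive_eq; apply; rewrite /hfun /GRing.scale /= mulr1.
have -> : (sclamp k e : R^o -> R^o) = (2^-1 : R) *: ((fun t : R^o => Num.sqrt ((t + k) ^+ 2 + e) : R^o) -
    (fun t : R^o => Num.sqrt ((t + (- k)) ^+ 2 + e) : R^o)).
  by apply/funext => x; rewrite /sclamp !fctE /GRing.scale /= mulrC.
have h1 := sh k; have h2 := sh (- k).
by apply: is_derive_eq; rewrite /GRing.scale /= mulrC.
Qed.

Lemma sclamp_slope k e t : 0 <= k -> 0 < e -> 0 <= (hfun e (t + k) - hfun e (t - k)) / 2 <= 1.
Proof.
move=> k0 e0; have := hfun_le1 (t + k) e0; have := hfun_le1 (t - k) e0.
have := @hfun_homo e e0 (t - k) (t + k); rewrite lerD2l ge0_cp// => /(_ isT).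
move: (hfun e (t + k)) (hfun e (t - k)) => a b ab; rewrite !ler_norml => /andP[? ?] /andP[? ?].
by apply/andP; split; lra.
Qed.

End clamp.

Section sclamp_test.
Context {R : realType} {N : nat} (Omega : set 'rV[R]_N).
Local Notation RN := 'rV[R]_N.

Definition slope (k e : R) (psi : RN -> R) (x : RN) : R :=
  (hfun e (psi x + k) - hfun e (psi x - k)) / 2.

Lemma sclass_hfun e (f : RN -> R) : 0 < e -> sclass f -> sclass (fun x => hfun e (f x)).
Proof. by move=> e0 sf; apply: sc_mul => //; exact: sc_rsqrt. Qed.

Lemma sclass_cst (c : R) : sclass ((fun=> c) : RN -> R).
Proof. by apply: sc_smooth; exact: smooth_cst. Qed.

Lemma smooth_slope k e psi : 0 < e -> smooth psi -> smooth (slope k e psi).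
Proof.
move=> e0 sp; have Cp := sc_smooth sp; apply: sclass_smooth.
rewrite (_ : slope k e psi = fun x => (hfun e (psi x + k) + -1 * hfun e (psi x + - k)) * 2^-1).
  apply: sc_mul; last exact: sclass_cst.
  apply: sc_add; first by apply: sclass_hfun => //; apply: sc_add => //; exact: sclass_cst.
  apply: sc_mul; first exact: sclass_cst.
  by apply: sclass_hfun => //; apply: sc_add => //; exact: sclass_cst.
by apply/funext => x; rewrite /slope mulN1r.
Qed.

Lemma smooth_sclamp k e (psi : RN -> R) : 0 < e -> smooth psi -> smooth (sclamp k e \o psi : RN -> R).
Proof.
move=> e0 sp; have Cp := sc_smooth sp; apply: sclass_smooth.
have sq c : sclass (fun x : RN => Num.sqrt ((psi x + c) ^+ 2 + e)).
  have Cc : sclass (fun x => psi x + c) by apply: sc_add => //; exact: sclass_cst.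
  (* The constructors of [sclass] provide the inverse root, so the root of [X] is written as [X]
     times its inverse root. *)
  rewrite (_ : (fun x => _) = fun x => ((psi x + c) * (psi x + c) + e) *
     (Num.sqrt ((psi x + c) ^+ 2 + e))^-1); last first.
    apply/funext => x; have p0 : 0 < (psi x + c) ^+ 2 + e by rewrite ltr_wpDl// sqr_ge0.
    rewrite -expr2 -[X in _ = X / _]sqr_sqrtr ?(ltW p0)// expr2 mulfK//.
    by rewrite gt_eqF// sqrtr_gt0.
  by apply: sc_mul; [apply: sc_add; [exact: sc_mul|exact: sclass_cst]|exact: sc_rsqrt].
rewrite (_ : _ \o _ = fun x => (Num.sqrt ((psi x + k) ^+ 2 + e) +
    -1 * Num.sqrt ((psi x + - k) ^+ 2 + e)) * 2^-1).
  by apply: sc_mul; [apply: sc_add => //; apply: sc_mul => //|]; exact: sclass_cst.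
by apply/funext => x; rewrite /= /sclamp mulN1r.
Qed.

Lemma test_sclamp k e psi : 0 < e -> test_function Omega psi ->
  test_function Omega (sclamp k e \o psi).
Proof.
move=> e0 tp; have [sp _ _] := tp; apply: (test_supp tp); first exact: smooth_sclamp.
by move=> x /nsupp h; rewrite /= h sclamp0.
Qed.

Lemma partial_sclamp k e psi i : 0 < e -> smooth psi ->
  partial i (sclamp k e \o psi) = fun x => slope k e psi x * partial i psi x.
Proof.
move=> e0 sp; apply/funext => x; rewrite /partial.
exact: (derive_comp _ (smooth_differentiable sp x) (is_derive_sclamp k (psi x) e0)).2.
Qed.

End sclamp_test.

(** * Extension by zero outside the domain *)

Section zero_extension.
Context d (T : measurableType d) (R : realType) (mu : {measure set T -> \bar R}).
Variables (D : set T) (mD : measurable D).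

Lemma finite_measure_integrable_cst_on (c : R) : (mu D < +oo)%E ->
  mu.-integrable D (EFin \o (fun=> c)).
Proof.
move=> Dfin; apply/integrableP; split; first by apply/measurable_EFinP; exact: measurable_cst.
rewrite (eq_integral (cst `|c|%:E))// integral_cst//.
by rewrite lte_mul_pinfty// ?lee_fin// ltry.
Qed.

Lemma sqiS (u : T -> R) : sqi mu setT u -> sqi mu D u.
Proof.
move=> [mu_ iu]; split; first exact: measurable_funTS.
exact: (integrableS measurableT mD _ iu).
Qed.

Lemma sqi_patch (u : T -> R) : sqi mu D u -> sqi mu setT (u \_ D).
Proof.
move=> [mu_ iu]; split.
  by apply/(measurable_restrictT _ mD).
have /(integrable_mkcond _ mD) := iu; congr (_.-integrable _).
by apply/funext => x /=; rewrite !patchE; case: ifP => //= _; rewrite expr0n.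
Qed.

Lemma ip_patch (u v : T -> R) : ip mu setT (u \_ D) (v \_ D) = ip mu D u v.
Proof.
rewrite /ip [RHS]Rintegral_mkcond; apply: eq_Rintegral => x _.
by rewrite !patchE; case: ifP => //= _; rewrite mulr0.
Qed.

Lemma patch_supp (u : T -> R) : (forall x, ~ D x -> u x = 0) -> u \_ D = u.
Proof.
move=> u0; apply/funext => x; rewrite patchE; case: ifP => // /negbT.
by rewrite notin_setE => /u0.
Qed.

Lemma Rintegral_supp (u : T -> R) : (forall x, ~ D x -> u x = 0) ->
  \int[mu]_(x in D) u x = \int[mu]_x u x.
Proof. by move=> u0; rewrite Rintegral_mkcond patch_supp. Qed.

Lemma ip_supp (u v : T -> R) : (forall x, ~ D x -> u x = 0) -> ip mu D u v = ip mu setT u v.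
Proof. by move=> u0; apply: Rintegral_supp => x /u0 ->; rewrite mul0r. Qed.

Lemma patchB (u v : T -> R) : (u - v) \_ D = u \_ D - v \_ D.
Proof.
by apply/funext => x; rewrite !fctE !patchE; case: ifP => //= _; rewrite subr0.
Qed.

Lemma ae_bounded_of_norm (a : T -> R) : measurable_fun D a ->
  ('N[mu]_+oo[EFin \o (a \_ D)] < +oo)%E ->
  exists M : R, {ae mu, forall x, D x -> `|a x| <= M}.
Proof.
move=> ma; rewrite unlock; case: ifPn => [mu0 h|].
  have e := ess_sup_ge mu (abse \o (EFin \o (a \_ D))).
  exists (fine (ess_sup mu (abse \o (EFin \o (a \_ D))))).
  apply: filterS e => x /=; rewrite patchE => + Dx; rewrite mem_set//.
  by case: (ess_sup _ _) h => //= r _; rewrite lee_fin.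
rewrite -leNgt measure_le0 => /eqP mu0 _; exists 0.
by exists setT; split.
Qed.

End zero_extension.

Lemma measurable_clamp {R : realType} (k : R) : 0 <= k -> measurable_fun [set: R] (clamp k).
Proof.
move=> k0; apply: nondecreasing_measurable => //.
exact: clamp_homo.
Qed.

(** * The resolvent form on the domain: truncation and displacement *)

Section domain_form.
Context {R : realType} {N : nat} (Omega : set 'rV[R]_N).
Hypothesis mO : measurable (Omega : set (euclid R N)).
Hypothesis Ofin : (@leb R N Omega < +oo)%E.
Local Notation RN := 'rV[R]_N.
Local Notation mu := (@leb R N).
Local Notation sqO := (sqi mu (Omega : set (euclid R N))).
Local Notation B := (ip mu (Omega : set (euclid R N))).
Local Notation HL := (prehilbert_L2 mu mO).
Local Notation test := (test_function Omega).

Lemma test_sqiO psi : test psi -> sqO psi.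
Proof. by move=> tp; apply: (sqiS mO); exact: (test_sqi tp). Qed.

(** Integration by parts makes the classical gradient a weak one. Test functions thus become
    admissible in the weak eigenvalue equations. *)
Lemma test_in_H10 psi : test psi -> in_H10 Omega psi (fun i => partial i psi).
Proof.
move=> tp; split; first split.
- by apply/L2P; exact: test_sqiO.
- by move=> i; apply/L2P; apply: test_sqiO; exact: test_partial.
- move=> i eta te; rewrite /integral_on.
  rewrite (Rintegral_supp mu (D := Omega)); last by move=> x /(test_out tp) ->; rewrite mul0r.
  rewrite (Rintegral_supp mu (D := Omega)); last by move=> x /(test_out te) ->; rewrite mulr0.
  exact: (test_by_parts i tp te).
have cc f : test f -> cvg_L2 Omega (fun=> f) f.
  move=> tf; apply/(cvg_L2P mO) => [k||]; try exact: test_sqiO.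
  rewrite (_ : (fun=> _) = fun=> 0); first exact: cvg_cst.
  by apply/funext => k; rewrite subrr (phB0l HL)//; exact: (ph0 HL).
exists (fun=> psi); split => //; first exact: cc.
by move=> i; apply: cc; exact: test_partial.
Qed.

Variables (a : 'I_N -> 'I_N -> RN -> R) (M gamma : R).
Hypothesis ma : forall i j, measurable_fun (Omega : set (euclid R N)) (a i j).
Hypothesis aM : forall i j, {ae mu, forall x, Omega x -> `|a i j x| <= M}.
Hypothesis aC : forall i j, {ae mu, forall x, Omega x -> a i j x = a j i x}.
Hypothesis gamma0 : 0 < gamma.
Hypothesis aE : {ae mu, forall x, Omega x -> forall xi : 'rV[R]_N,
  gamma * (\sum_(i < N) xi 0 i ^+ 2) <= \sum_(i < N) \sum_(j < N) a i j x * xi 0 i * xi 0 j}.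
Local Notation E := (gform mu (Omega : set (euclid R N)) a).
Local Notation HE := (prehilbert_gform mO ma aM aC gamma0 aE).
Variables (lam : nat -> R) (phi : nat -> RN -> R) (Dphi : nat -> 'I_N -> RN -> R).
Hypothesis lam0 : forall n, 0 < lam n.
Hypothesis phi_L2 : forall n, sqO (phi n).
Hypothesis Dphi_H10 : forall n, in_H10 Omega (phi n) (Dphi n).
Hypothesis Dphi_form : forall n v Dv, in_H10 Omega v Dv ->
  form_D Omega a (Dphi n) Dv = integral_on Omega (fun x => lam n * phi n x * v x).
Hypothesis phi_ortho : forall m n, integral_on Omega (fun x => phi m x * phi n x) = (m == n)%:R.
Hypothesis phi_basis : forall u, L2 Omega u ->
  cvg_L2 Omega (fun n x => \sum_(k < n) coef Omega phi u k * phi k x) u.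

Local Notation grad := (fun (psi : RN -> R) i => partial i psi : RN -> R).

Lemma Dphi_sq n : gsq mu (Omega : set (euclid R N)) (Dphi n).
Proof. by move=> i; have [[_ h _] _] := Dphi_H10 n; apply/L2P. Qed.

Lemma grad_sq psi : test psi -> gsq mu (Omega : set (euclid R N)) (grad psi).
Proof. by move=> tp i; apply: test_sqiO; exact: test_partial. Qed.

Lemma Dphi_form_ip n v Dv : in_H10 Omega v Dv -> E (Dphi n) Dv = lam n * B (phi n) v.
Proof.
move=> hv; have := Dphi_form n hv; rewrite -[form_D _ _ _ _]/(E (Dphi n) Dv) => ->.
have sv : sqO v by have [[h _ _] _] := hv; apply/L2P.
rewrite /integral_on /ip -(RintegralZl _ mO); last exact: (sqi_mul mO (phi_L2 n) sv).
by apply: eq_Rintegral => x _; rewrite mulrA.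
Qed.

Lemma coefE u n : sqO u -> coef Omega phi u n = B (phi n) u.
Proof. by move=> su; exact: (phC HL su (phi_L2 n)). Qed.

(** Orthonormality identifies the defect with the squared distance from [v] to its partial sum,
    which tends to 0 as the eigenfunctions form a basis. *)
Lemma phi_complete v : sqO v -> forall e : R, 0 < e -> exists m : nat,
  B v v - \sum_(n < m) B (phi n) v ^+ 2 <= e.
Proof.
move=> sv e e0; have Lv : L2 Omega v by apply/L2P.
pose S m := \sum_(n < m) fscale (B (phi n) v) (phi n) : RN -> R.
have sS m : sqO (S m).
  exact: (ph_sum HL m (fun n => phZ HL (B (phi n) v) (phi_L2 n))).
have h : cvg_L2 Omega S v.
  have := phi_basis Lv; congr (cvg_L2 _ _ _); apply/funext => m; apply/funext => x.
  rewrite /S fct_sumE; apply: eq_bigr => k _; rewrite /fscale coefE//.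
move/(cvg_L2P mO sS sv)/cvgrPdist_le/(_ e e0) : h => [m _ /(_ m (leqnn m))].
rewrite sub0r normrN => h; exists m; apply: le_trans h.
have e1 n : B (phi n) v = 1 * B (phi n) v by rewrite mul1r.
have ortho i j : B (phi i) (phi j) = 1 * (i == j)%:R by rewrite mul1r; exact: phi_ortho.
have := ph_sq_projection HL (c := fun n => B (phi n) v) (lam := fun=> 1) phi_L2 ortho m sv e1.
rewrite -/(S m) (_ : \sum_(n < m) 1 * B (phi n) v ^+ 2 = \sum_(n < m) B (phi n) v ^+ 2); last first.
  by apply: eq_bigr => n _; rewrite mul1r.
move=> <-; have sB := phB HL sv (sS m).
rewrite -(ph_sqN HL sB) opprB; exact: ler_norm.
Qed.

(** The sequence provided by the definition of H^1_0 converges in L^2 together with its partial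
    derivatives; [gform_bounded] converts the latter into energy. *)
Lemma phi_dense n (e : R) : 0 < e -> exists2 u, test u &
  B (u - phi n) (u - phi n) <= e /\ E (grad u - Dphi n) (grad u - Dphi n) <= e.
Proof.
move=> e0; have [_ [psi [tpsi h1 h2]]] := Dphi_H10 n.
have {h1} h1 := (cvg_L2P mO (fun k => test_sqiO (tpsi k)) (phi_L2 n)).1 h1.
have {}h2 i := (cvg_L2P mO (fun k => test_sqiO (test_partial i (tpsi k))) (Dphi_sq n i)).1 (h2 i).
pose c := 2 * N%:R * `|M|.
have c0 : 0 <= c by rewrite !mulr_ge0.
have h3 : (fun k => c * \sum_(i < N) B (partial i (psi k) - Dphi n i) (partial i (psi k) - Dphi n i))
    @ \oo --> (0 : R).
  have h3 : (fun k => \sum_(i < N) B (partial i (psi k) - Dphi n i) (partial i (psi k) - Dphi n i))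
      @ \oo --> \sum_(i < N) (0 : R).
    by apply: cvg_big => [|i _]; [exact: add_continuous|exact: h2].
  rewrite big1_eq in h3.
  by have := cvgM (@cvg_cst _ c _ _ _) h3; rewrite mulr0; exact.
have /cvgrPdist_le/(_ e e0)[k1 _ H1] := h1.
have /cvgrPdist_le/(_ e e0)[k2 _ H2] := h3.
exists (psi (maxn k1 k2)); first exact: tpsi.
split.
  have := H1 _ (leq_maxl k1 k2); rewrite sub0r normrN; exact: le_trans (ler_norm _).
have := H2 _ (leq_maxr k1 k2); rewrite sub0r normrN => h.
apply: le_trans h; apply: le_trans (ler_norm _).
apply: (gform_bounded mO ma aM).
by move=> i; apply: (phB HL); [exact: grad_sq|exact: Dphi_sq].
Qed.

Lemma test_lin (c : R) u v : test u -> test v ->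
  test (u + fscale c v) /\ grad (u + fscale c v) = grad u + gscale c (grad v).
Proof.
move=> tu tv; split; first by apply: testD => //; exact: testZ.
have [su _ _] := tu; have [sv _ _] := tv.
apply/funext => i; rewrite (@partialD _ _ u (fun x => c * v x) i su).
  by rewrite (partialZ c i sv).
by apply: smoothM => //; exact: smooth_cst.
Qed.

Lemma grad0 : test 0 /\ grad 0 = 0.
Proof.
split; first exact: test0.
by apply/funext => i; apply/funext => x; rewrite /partial derive_cst.
Qed.

Lemma form_upper v t Q e : sqO v -> 0 < t -> 0 < e ->
  (forall m, \sum_(n < m) lam n / (lam n + t) * B (phi n) v ^+ 2 <= Q) ->
  exists2 u, test u & E (grad u) (grad u) + t * B (v - u) (v - u) <= t * Q + e.
Proof.
move=> sv t0 e0 HQ.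
apply: (energy_upper HL HE test_sqiO grad_sq test_lin grad0 phi_L2 Dphi_sq lam0 _ _ phi_dense
  phi_complete sv t0 e0 HQ).
- exact: phi_ortho.
- by move=> i j; rewrite (Dphi_form_ip i (Dphi_H10 j)); congr (_ * _); exact: phi_ortho.
Qed.

Lemma sqi_clamp k v : 0 <= k -> sqO v -> sqO (clamp k \o v).
Proof.
move=> k0 sv; apply: (sqi_le mO sv).
  by apply: measurableT_comp; [exact: measurable_clamp|case: sv].
by move=> x _; exact: clamp_norm.
Qed.

(** The competitor is the smoothed truncation of [u]. Its gradient is that of [u] times a slope
    between 0 and 1; in L^2, [clamp k] is 1-Lipschitz, and the smoothing error is at most the root
    of [e] pointwise on a set of finite measure. *)
Lemma test_clamp_approx k (v : RN -> R) u d : 0 <= k -> sqO v -> test u -> 0 < d ->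
  exists2 u', test u' & E (grad u') (grad u') <= E (grad u) (grad u) /\
     B ((clamp k \o v) - u') ((clamp k \o v) - u') <= (1 + d) * B (v - u) (v - u) + d.
Proof.
move=> k0 sv tu d0; have [su _ _] := tu.
pose m := fine (mu Omega).
have m0 : 0 <= m by rewrite fine_ge0// measure_ge0.
have dd0 : 0 < 1 + d^-1 by rewrite addr_gt0// invr_gt0.
(* Ensures [(1 + d^-1) * (e * m) <= d]; the 1 added to [m] covers a domain of measure 0. *)
pose e := d / ((1 + d^-1) * (m + 1)).
have e0 : 0 < e by rewrite divr_gt0// mulr_gt0// ltr_wpDl.
have tu' := test_sclamp k e0 tu.
exists (sclamp k e \o u); first exact: tu'.
split.
  have mslope : measurable_fun (Omega : set (euclid R N)) (slope k e u).
    exact: (measurable_funTS (smooth_measurable (smooth_slope k e0 su))).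
  have [_ h] := gform_contraction mO ma aM gamma0 aE mslope
    (fun x => sclamp_slope (u x) k0 e0) (grad_sq tu).
  apply: le_trans h; rewrite le_eqVlt; apply/orP; left; apply/eqP.
  by congr (gform _ _ _ _ _); apply/funext => i; exact: partial_sclamp.
have sFv := sqi_clamp k0 sv; have sFu := sqi_clamp k0 (test_sqiO tu).
have su' := test_sqiO tu'; have su0 := test_sqiO tu.
apply: (le_trans (ph_near HL (phB HL sFv su') (phB HL sFv sFu) d0)).
apply: lerD.
  rewrite ler_wpM2l//; first by rewrite addr_ge0// ltW.
  apply: (le_ip mO (phB HL sv su0) (phB HL sFv sFu)) => x _.
  by rewrite !fctE; exact: clamp_lip.
have -> : (clamp k \o v) - (sclamp k e \o u) - ((clamp k \o v) - (clamp k \o u)) =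
    (clamp k \o u) - (sclamp k e \o u).
  by apply/funext => x; rewrite !fctE; ring.
have sw := phB HL sFu su'.
have h : B ((clamp k \o u) - (sclamp k e \o u)) ((clamp k \o u) - (sclamp k e \o u)) <= e * m.
  rewrite -(Rintegral_cst mu mO e); apply: (le_Rintegral mO (sqi_mul mO sw sw)).
    exact: (finite_measure_integrable_cst_on mO e Ofin).
  move=> x _; rewrite -expr2 -[_ ^+ 2]real_normK ?num_real//.
  rewrite -[leRHS]sqr_sqrtr ?(ltW e0)// ler_pXn2r ?nnegrE ?sqrtr_ge0//.
  by rewrite !fctE distrC; apply: sclamp_clamp; exact: ltW.
apply: le_trans (ler_wpM2l (ltW dd0) h) _.
rewrite /e [leLHS](_ : _ = d * (m / (m + 1))); last first.
  have m1 : 0 < m + 1 by rewrite ltr_wpDl.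
  have z0 : 1 + d^-1 != 0 by rewrite lt0r_neq0.
  by rewrite invfM -!mulrA [d * (_ * _)]mulrCA mulVKf// [(m + 1)^-1 * m]mulrC.
by rewrite ler_piMr ?(ltW d0)// ler_pdivrMr ?mul1r ?lerDl// ltr_wpDl.
Qed.

Lemma form_clamp v k t Q : sqO v -> 0 <= k -> 0 < t ->
  (forall m, \sum_(n < m) lam n / (lam n + t) * B (phi n) v ^+ 2 <= Q) ->
  forall m, \sum_(n < m) lam n / (lam n + t) * B (phi n) (clamp k \o v) ^+ 2 <= Q.
Proof.
move=> sv k0 t0 HQ m.
apply: (energy_contraction HL HE test_sqiO grad_sq test_lin grad0 phi_L2 Dphi_sq lam0 _ _ _
  phi_dense phi_complete (F := fun w => clamp k \o w) sv (sqi_clamp k0 sv) t0 _ HQ m).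
- exact: phi_ortho.
- by move=> i j; rewrite (Dphi_form_ip i (Dphi_H10 j)); congr (_ * _); exact: phi_ortho.
- by move=> n psi tp; exact: (Dphi_form_ip n (test_in_H10 tp)).
- by move=> u d tu d0; exact: test_clamp_approx.
Qed.

(** At [t = r ^- 2] a nearly optimal [u] splits [v] into a test function, whose displacement is
    controlled by its gradient, and a remainder controlled in L^2. Doubling both gives
    [2 * N%:R / gamma] by coercivity and [8 = 2 * 4] by [Dsh_le4]; the constant is their sum. *)
Lemma Dsh_form (v : RN -> R) (y : RN) r Q : sqO v -> 0 < r -> (forall i, `|y ord0 i| <= r) ->
  (forall m, \sum_(n < m) lam n / (lam n + r ^- 2) * B (phi n) v ^+ 2 <= Q) ->
  Dsh y (v \_ Omega) <= (2 * N%:R / gamma + 8) * Q.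
Proof.
move=> sv r0 yr HQ; have Q0 : 0 <= Q by have := HQ 0%N; rewrite big_ord0.
have r20 : 0 < r ^+ 2 by rewrite exprn_gt0.
have t0 : 0 < r ^- 2 by rewrite invr_gt0.
pose K := 2 * N%:R / gamma + 8.
have K0 : 0 < K by rewrite ltr_wpDl// divr_ge0 ?mulr_ge0// ltW.
apply/ler_addgt0Pr => e e0.
have ek0 : 0 < e / (K * r ^+ 2) by rewrite divr_gt0// mulr_gt0.
have [u tu Hu] := form_upper sv t0 ek0 HQ.
have su := test_sqiO tu.
have uE : u \_ Omega = u := @patch_supp _ (euclid R N) R Omega u (fun x => @test_out _ _ _ u x tu).
have -> : v \_ Omega = u + (v - u) \_ Omega.
  by rewrite (@patchB _ (euclid R N) R Omega v u) uE addrC subrK.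
have sp := sqi_patch mO (phB HL sv su).
apply: (le_trans (Dsh_add y (test_sqi tu) sp)).
have h1 := Dsh_test_gradient tu yr.
have h2 := Dsh_le4 y sp; rewrite (ip_patch mu) in h2.
have h3 := gform_coercive mO ma aM aE (grad_sq tu).
have {}h3 : \sum_(i < N) ip mu setT (partial i u) (partial i u) <= E (grad u) (grad u) / gamma.
  rewrite ler_pdivlMr// mulrC; apply: le_trans h3; rewrite ler_wpM2l ?(ltW gamma0)//.
  apply: ler_sum => i _; rewrite (ip_supp mu (D := Omega))// => x.
  exact: (test_out (test_partial i tu)).
have Eu := ph_ge0 HE (grad_sq tu).
have Bu := ph_ge0 HL (phB HL sv su).
have Kr0 : 0 < K * r ^+ 2 by rewrite mulr_gt0.
have h4 := ler_wpM2l (ltW Kr0) Hu.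
have e4 : K * r ^+ 2 * (r ^- 2 * Q + e / (K * r ^+ 2)) = K * Q + e.
  by field; rewrite !lt0r_neq0.
have e5 : K * r ^+ 2 * (E (grad u) (grad u) + r ^- 2 * B (v - u) (v - u)) =
    K * r ^+ 2 * E (grad u) (grad u) + K * B (v - u) (v - u).
  by field; rewrite lt0r_neq0.
rewrite e4 e5 in h4; apply: le_trans h4.
have h5 : N%:R * r ^+ 2 * (\sum_(i < N) ip mu setT (partial i u) (partial i u)) <=
    N%:R * r ^+ 2 * (E (grad u) (grad u) / gamma).
  by rewrite ler_wpM2l// mulr_ge0// ltW.
apply: lerD.
  apply: (@le_trans _ _ (2 * (N%:R * r ^+ 2 * (E (grad u) (grad u) / gamma)))).
    by rewrite ler_wpM2l//; exact: le_trans h1 h5.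
  have -> : 2 * (N%:R * r ^+ 2 * (E (grad u) (grad u) / gamma)) =
      (2 * N%:R / gamma) * (r ^+ 2 * E (grad u) (grad u)) by field; rewrite lt0r_neq0.
  rewrite -[X in _ <= X]mulrA; apply: ler_wpM2r; first by rewrite mulr_ge0 ?(ltW r20).
  by rewrite /K lerDl.
apply: (@le_trans _ _ (8 * B (v - u) (v - u))).
  by move: h2; lra.
rewrite ler_wpM2r// /K lerDr divr_ge0 ?mulr_ge0// ltW//.
Qed.

End domain_form.

(** * Fractional powers as mixtures of resolvents *)

Section fractional_power.
Context {R : realType}.
Local Notation mu := (@lebesgue_measure R).
Variable s : R.
Hypothesis s01 : 0 < s < 1.

(** The integrand [t ^ (s - 1) / (1 + t)] of the Stieltjes integral over the positive half-line,
    after the substitution [t = exp x]. *)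
Definition stieltjes_kernel (x : R) : R := expR (s * x) / (expR x + 1).

Let expD0 (x : R) : 0 < expR x + 1.
Proof. by rewrite addr_gt0// expR_gt0. Qed.

Lemma stieltjes_kernel_ge0 x : 0 <= stieltjes_kernel x.
Proof. by rewrite divr_ge0 ?expR_ge0// ltW. Qed.

Lemma measurable_stieltjes_kernel : measurable_fun [set: R] stieltjes_kernel.
Proof.
apply: continuous_measurable_fun => x; apply: cvgM.
  apply: (@continuous_comp _ _ _ (fun y => s * y) expR); last exact: continuous_expR.
  by apply: cvgM; [exact: cvg_cst|exact: cvg_id].
apply: cvgV; first by rewrite lt0r_neq0.
by apply: cvgD; [exact: continuous_expR|exact: cvg_cst].
Qed.

Lemma ge0_lebesgue_integralN (g : measurableTypeR R -> \bar R) :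
  measurable_fun setT g -> (forall x, 0 <= g x)%E ->
  (\int[mu]_x g (- x)%R = \int[mu]_x g x)%E.
Proof.
move=> mg g0.
have mN : measurable_fun [set: measurableTypeR R] (-%R : measurableTypeR R -> measurableTypeR R).
  exact: oppr_measurable.
have := @ge0_integral_pushforward _ _ (measurableTypeR R) (measurableTypeR R) R _ mN mu setT g
  measurableT mg (fun y _ => g0 y).
rewrite preimage_setT => <-.
by apply: eq_measure_integral => A mA _; exact: lebesgue_measureN.
Qed.

(** The kernel is at most [expR (- (1 - s) * x)] on the right and [expR (s * x)] on the left, which
    are multiples of exponential densities with rates [1 - s] and [s]. *)
Lemma stieltjes_integral_lty : (\int[mu]_x (stieltjes_kernel x)%:E < +oo)%E.
Proof.
have [s0 s1] := andP s01.
have r0 : 0 < 1 - s by rewrite subr_gt0.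
have mp := measurable_exponential_pdf (1 - s).
have mq := measurable_exponential_pdf s.
have mN : measurable_fun [set: R] (fun x => exponential_pdf s (- x)).
  by apply: (measurableT_comp mq); exact: oppr_measurable.
apply: (@le_lt_trans _ _ (\int[mu]_x ((1 - s)^-1%:E * (exponential_pdf (1 - s) x)%:E +
    s^-1%:E * (exponential_pdf s (- x))%:E))%E).
  apply: ge0_le_integral => //.
  - by move=> x _; rewrite lee_fin stieltjes_kernel_ge0.
  - by apply/measurable_EFinP; exact: measurable_stieltjes_kernel.
  - apply: emeasurable_funD; apply: measurable_funeM; exact/measurable_EFinP.
  move=> x _; rewrite -!EFinM -EFinD lee_fin /stieltjes_kernel.
  have [x0|x0] := leP 0 x.
    rewrite -[leLHS]addr0 lerD//; last first.
      by rewrite mulr_ge0 ?exponential_pdf_ge0 ?invr_ge0// ltW.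
    rewrite exponential_pdfE// mulKf ?lt0r_neq0//.
    rewrite ler_pdivrMr// mulrDr -expRD mulr1.
    by rewrite (_ : - (1 - s) * x + x = s * x); [rewrite lerDl expR_ge0|ring].
  rewrite -[leLHS]add0r lerD//.
    by rewrite mulr_ge0 ?exponential_pdf_ge0 ?invr_ge0// ltW.
  rewrite exponential_pdfE ?oppr_ge0 ?(ltW x0)// mulKf ?lt0r_neq0// mulrNN.
  by rewrite ler_pdivrMr// ler_peMr ?expR_ge0// lerDr expR_ge0.
rewrite ge0_integralD//; last 4 first.
- by move=> x _; rewrite -EFinM lee_fin mulr_ge0 ?invr_ge0 ?(ltW r0)// exponential_pdf_ge0// ltW.
- by apply: measurable_funeM; exact/measurable_EFinP.
- by move=> x _; rewrite -EFinM lee_fin mulr_ge0 ?invr_ge0 ?(ltW s0)// exponential_pdf_ge0// ltW.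
- by apply: measurable_funeM; exact/measurable_EFinP.
rewrite !ge0_integralZl//; last 6 first.
- exact/measurable_EFinP.
- by move=> x _; rewrite lee_fin exponential_pdf_ge0// ltW.
- by rewrite lee_fin invr_ge0 ltW.
- exact/measurable_EFinP.
- by move=> x _; rewrite lee_fin exponential_pdf_ge0// ltW.
- by rewrite lee_fin invr_ge0 ltW.
rewrite (@ge0_lebesgue_integralN (fun x => (exponential_pdf s x)%:E)); last 2 first.
- exact/measurable_EFinP.
- by move=> x; rewrite lee_fin exponential_pdf_ge0// ltW.
by rewrite !integral_exponential_pdf// !mule1 -EFinD ltry.
Qed.

Lemma stieltjes_integral_gt0 : (0 < \int[mu]_x (stieltjes_kernel x)%:E)%E.
Proof.
have [s0 s1] := andP s01.
have mK : measurable_fun setT (EFin \o stieltjes_kernel).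
  by apply/measurable_EFinP; exact: measurable_stieltjes_kernel.
apply: (@lt_le_trans _ _ (\int[mu]_(x in `[0%R, 1%R]) (cst ((expR 1 + 1)^-1)%:E x))%E).
  rewrite integral_cst//= lebesgue_measure_itv/= lte01 sube0 mule1 lte_fin.
  by rewrite invr_gt0.
apply: (@le_trans _ _ (\int[mu]_(x in `[0%R, 1%R]) (stieltjes_kernel x)%:E)%E).
  apply: ge0_le_integral => //.
  - by move=> x _; rewrite lee_fin invr_ge0 ltW.
  - exact: measurable_funTS.
  move=> x; rewrite /= in_itv/= => /andP[x0 x1]; rewrite lee_fin /stieltjes_kernel.
  rewrite -[leLHS]mul1r ler_pM ?invr_ge0 ?(ltW (expD0 _))//.
    by rewrite -expR0 ler_expR mulr_ge0// ltW.
  by rewrite lef_pV2 ?posrE// lerD2r ler_expR.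
apply: ge0_subset_integral => //.
by move=> x _; rewrite lee_fin stieltjes_kernel_ge0.
Qed.

Lemma measurable_stieltjes_resolvent (l : R) : 0 < l ->
  measurable_fun [set: R] (fun x : R => expR (s * x) * (l / (l + expR x))).
Proof.
move=> l0; apply: continuous_measurable_fun => x; apply: cvgM.
  apply: (@continuous_comp _ _ _ (fun y => s * y) expR); last exact: continuous_expR.
  by apply: cvgM; [exact: cvg_cst|exact: cvg_id].
apply: cvgM; first exact: cvg_cst.
apply: cvgV; first by rewrite lt0r_neq0// addr_gt0// expR_gt0.
by apply: cvgD; [exact: cvg_cst|exact: continuous_expR].
Qed.

(* Substituting [x + ln l] for [x] scales the integral by [l `^ s]. *)
Lemma stieltjes_representation (l : R) : 0 < l ->
  (\int[mu]_x (expR (s * x) * (l / (l + expR x)))%:E =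
   (l `^ s)%:E * \int[mu]_x (stieltjes_kernel x)%:E)%E.
Proof.
move=> l0; rewrite -ge0_integralZl//; last 3 first.
- by apply/measurable_EFinP; exact: measurable_stieltjes_kernel.
- by move=> x _; rewrite lee_fin stieltjes_kernel_ge0.
- by rewrite lee_fin powR_ge0.
have mf := measurable_stieltjes_resolvent l0.
rewrite -(@ge0_lebesgue_integral_shift _ (ln l)
  (fun x => (expR (s * x) * (l / (l + expR x)))%:E)); last 2 first.
- exact/measurable_EFinP.
- by move=> x; rewrite lee_fin mulr_ge0 ?expR_ge0// divr_ge0 ?(ltW l0)// addr_ge0 ?(ltW l0) ?expR_ge0.
apply: eq_integral => x _; rewrite -EFinM; congr EFin.
rewrite /stieltjes_kernel mulrDr expRD expRD ?lnK ?posrE// /powR gt_eqF//.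
have := expD0 x; move: (expR (s * x)) (expR (s * ln l)) (expR x) => p q r r0.
by field; rewrite !lt0r_neq0//; nra.
Qed.

(** At each [t = expR x] the best bound is the whole series for [c], so the hypothesis becomes an
    inequality between integrands. Tonelli's theorem integrates it termwise with weight
    [expR (s * x)], and the common factor, the integral of the kernel, is divided out. *)
Lemma fractional_contraction (lam b c : nat -> R) : (forall n, 0 < lam n) ->
  (forall t Q : R, 0 < t -> (forall m, \sum_(n < m) lam n / (lam n + t) * c n ^+ 2 <= Q) ->
    forall m, \sum_(n < m) lam n / (lam n + t) * b n ^+ 2 <= Q) ->
  forall Q, (forall m, \sum_(n < m) lam n `^ s * c n ^+ 2 <= Q) ->
    forall m, \sum_(n < m) lam n `^ s * b n ^+ 2 <= Q.
Proof.
move=> lam0 h Q HQ m.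
pose W n x : R := expR (s * x) * (lam n / (lam n + expR x)).
have W0 n x : 0 <= W n x.
  by rewrite mulr_ge0 ?expR_ge0// divr_ge0 ?(ltW (lam0 _))// addr_ge0 ?expR_ge0 ?ltW.
have mW n : measurable_fun [set: R] (W n).
  exact: measurable_stieltjes_resolvent.
have iW n : (\int[mu]_x (W n x)%:E = (lam n `^ s)%:E * \int[mu]_x (stieltjes_kernel x)%:E)%E.
  exact: stieltjes_representation.
have mWc n (d : nat -> R) : measurable_fun setT (fun x => (W n x * d n ^+ 2)%:E).
  by apply/measurable_EFinP; apply: measurable_funM.
have Wc0 n (d : nat -> R) x : (0 <= (W n x * d n ^+ 2)%:E)%E.
  by rewrite lee_fin mulr_ge0// sqr_ge0.
have iWc n (d : nat -> R) : (\int[mu]_x (W n x * d n ^+ 2)%:E =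
    (lam n `^ s * d n ^+ 2)%:E * \int[mu]_x (stieltjes_kernel x)%:E)%E.
  under eq_integral do rewrite mulrC EFinM.
  rewrite ge0_integralZl//; first by rewrite iW muleA -EFinM mulrC.
  - by apply/measurable_EFinP; exact: mW.
  - by move=> x _; rewrite lee_fin; exact: W0.
  - by rewrite lee_fin sqr_ge0.
have pw x : (\sum_(n < m) (W n x * b n ^+ 2)%:E <= \sum_(n <oo) (W n x * c n ^+ 2)%:E)%E.
  (* An infinite right-hand side leaves nothing to prove; a finite one, divided by [expR (s * x)],
     is the bound fed to the hypothesis. *)
  have [fs|] := boolP ((\sum_(n <oo) (W n x * c n ^+ 2)%:E)%E \is a fin_num); last first.
    rewrite ge0_fin_numE; last by apply: nneseries_ge0.
    by rewrite -leNgt leye_eq => /eqP ->; rewrite leey.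
  rewrite -(fineK fs) sumEFin lee_fin.
  under eq_bigr do rewrite -mulrA.
  rewrite -mulr_sumr -ler_pdivlMl ?expR_gt0//.
  apply: h; first exact: expR_gt0.
  move=> k; rewrite ler_pdivlMl ?expR_gt0// mulr_sumr.
  under eq_bigr do rewrite mulrA.
  rewrite -lee_fin (fineK fs) -sumEFin -(big_mkord xpredT (fun n => (W n x * c n ^+ 2)%:E)).
  by apply: nneseries_lim_ge.
have ii : (\int[mu]_x (\sum_(n < m) (W n x * b n ^+ 2)%:E) <=
    \int[mu]_x (\sum_(n <oo) (W n x * c n ^+ 2)%:E))%E.
  apply: ge0_le_integral => //.
  - by move=> x _; exact: sume_ge0.
  - by apply: emeasurable_sum => n; exact: mWc.
  - by apply: ge0_emeasurable_sum => n *; [exact: Wc0|exact: mWc].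
have i1 : (\int[mu]_x (\sum_(n < m) (W n x * b n ^+ 2)%:E) =
    \sum_(n < m) \int[mu]_x (W n x * b n ^+ 2)%:E)%E.
  apply: (@ge0_integral_sum _ _ _ mu setT measurableT _ (fun (n : 'I_m) x => (W n x * b n ^+ 2)%:E)).
    by move=> n; exact: mWc.
  by move=> n x _; exact: Wc0.
have i2 : (\int[mu]_x (\sum_(n <oo) (W n x * c n ^+ 2)%:E) =
    \sum_(n <oo) \int[mu]_x (W n x * c n ^+ 2)%:E)%E.
  apply: (@integral_nneseries _ _ _ mu setT measurableT (fun n x => (W n x * c n ^+ 2)%:E)).
    by move=> n; exact: mWc.
  by move=> n x _; exact: Wc0.
move: ii; rewrite i1 i2.
have [k k0 kE] : exists2 k, 0 < k & (\int[mu]_x (stieltjes_kernel x)%:E)%E = k%:E.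
  have := stieltjes_integral_gt0; have := stieltjes_integral_lty.
  by case: (integral _ _ _) => // k _ k0; exists k; rewrite -?lte_fin.
under eq_bigr do rewrite iWc kE -EFinM.
under eq_eseriesr do rewrite iWc kE -EFinM.
rewrite sumEFin -mulr_suml => ii.
rewrite -(ler_pM2r k0) -lee_fin; apply: (le_trans ii).
apply: lime_le; first apply: is_cvg_nneseries => n *.
  rewrite lee_fin; apply: mulr_ge0; last exact: ltW.
  by apply: mulr_ge0; [exact: powR_ge0|exact: sqr_ge0].
apply: nearW => j; rewrite big_mkord sumEFin lee_fin -mulr_suml.
by rewrite ler_pM2r.
Qed.

End fractional_power.

(** * Riesz-Fischer and spectral square roots *)

Section riesz_fischer.
Context {d} {T : measurableType d} {R : realType} (mu : {measure set T -> \bar R}).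
Variables (D : set T) (mD : measurable D).
Local Notation sq := (sqi mu D).
Local Notation B := (ip mu D).
Local Notation HL := (prehilbert_L2 mu mD).

(** An interval that contains a tail of the sequence contains its upper limit. The upper limit is
    used to name the limit, as it is measurable without any convergence hypothesis. *)
Lemma limn_esup_close (f : nat -> R) k c : (forall j, (k <= j)%N -> `|f j - f k| <= c) ->
  `|fine (limn_esup (EFin \o f)) - f k| <= c.
Proof.
move=> h.
have le1 j : (k <= j)%N -> f k - c <= f j /\ f j <= f k + c.
  by move/h; rewrite ler_norml => /andP[? ?]; split; lra.
have hi : (limn_esup (EFin \o f) <= (f k + c)%:E)%E.
  rewrite limn_esup_lim; apply: lime_le; first exact: is_cvg_esups.
  exists k => // j /= kj; apply: ge_ereal_sup => _ [i /= ji <-]; rewrite lee_fin.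
  by have [] := le1 i (leq_trans kj ji).
have lo : ((f k - c)%:E <= limn_esup (EFin \o f))%E.
  rewrite limn_esup_lim; apply: lime_ge; first exact: is_cvg_esups.
  exists k => // j /= kj; apply: (@le_trans _ _ (f j)%:E).
    by rewrite lee_fin; have [] := le1 j kj.
  by apply: ereal_sup_ubound; exists j => /=.
move: hi lo; case: (limn_esup _) => //= r; rewrite !lee_fin => hi lo.
by rewrite ler_norml; apply/andP; split; lra.
Qed.

Lemma geometric_telescope (f : nat -> R) G : 0 <= G ->
  (forall i, `|f i.+1 - f i| <= G * (2^-1) ^+ i) ->
  forall k j, (k <= j)%N -> `|f j - f k| <= 2 * G * (2^-1) ^+ k.
Proof.
move=> G0 h k j kj.
suff : `|f j - f k| <= 2 * G * (2^-1) ^+ k - 2 * G * (2^-1) ^+ j.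
  move/le_trans; apply; rewrite lerBlDr lerDl.
  by rewrite mulr_ge0// ?mulr_ge0// exprn_ge0// invr_ge0.
elim: j kj => [|j IH]; first by rewrite leqn0 => /eqP ->; rewrite !subrr normr0.
rewrite leq_eqVlt => /orP[/eqP ->|]; first by rewrite !subrr normr0.
rewrite ltnS => /IH{}IH; rewrite -(subrKA (f j)).
apply: (le_trans (ler_normD _ _)); apply: (le_trans (lerD (h j) IH)).
by rewrite exprS; move: ((2^-1) ^+ j) => x; lra.
Qed.

Lemma L2_complete_geometric (f : nat -> T -> R) : (forall k, sq (f k)) ->
  (forall k, B (f k.+1 - f k) (f k.+1 - f k) <= (8^-1) ^+ k) ->
  exists2 w, sq w & (fun k => B (f k - w) (f k - w)) @ \oo --> (0 : R).
Proof.
move=> sf hf; pose dd k := f k.+1 - f k.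
have sd k : sq (dd k) := phB HL (sf k.+1) (sf k).
(* The weights [4 ^+ k] against the bounds [(8^-1) ^+ k] leave a series of sum at most 2. Where [G]
   is finite it dominates each of its terms, so that consecutive functions differ by at most the
   root of [G] times [(2^-1) ^+ k]. *)
pose term k x : \bar R := (4 ^+ k * (dd k x * dd k x))%:E.
have term0 k x : (0 <= term k x)%E.
  by rewrite lee_fin mulr_ge0 ?exprn_ge0// -expr2 sqr_ge0.
have mterm k : measurable_fun D (term k).
  apply/measurable_EFinP; apply: measurable_funM => //.
  by have [m _] := sd k; exact: measurable_funM.
pose G x := (\sum_(k <oo) term k x)%E.
have G0 x : (0 <= G x)%E by exact: nneseries_ge0.
have mG : measurable_fun D G by apply: ge0_emeasurable_sum => n *; [exact: term0|exact: mterm].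
have iterm k : (\int[mu]_(x in D) term k x = (4 ^+ k * B (dd k) (dd k))%:E)%E.
  rewrite EFinM (ip_EFin mD)// -ge0_integralZl//.
  - by apply/measurable_EFinP; have [m _] := sd k; exact: measurable_funM.
  - by move=> x _; rewrite lee_fin -expr2 sqr_ge0.
have iG : (\int[mu]_(x in D) G x <= 2%:E)%E.
  rewrite integral_nneseries//.
  apply: lime_le; first by apply: is_cvg_nneseries => n _ _; exact: integral_ge0.
  apply: nearW => n; rewrite big_mkord; under eq_bigr do rewrite iterm.
  rewrite sumEFin lee_fin.
  suff : \sum_(i < n) 4 ^+ i * B (dd i) (dd i) <= 2 - 2 * (2^-1) ^+ n.
    by move/le_trans; apply; rewrite gerBl mulr_ge0// exprn_ge0// invr_ge0.
  elim: n => [|n IH]; first by rewrite big_ord0 expr0; lra.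
  rewrite big_ord_recr /=; apply: (le_trans (lerD IH (ler_wpM2l _ (hf n)))).
    by rewrite exprn_ge0.
  rewrite -exprMn (_ : 4 * 8^-1 = 2^-1 :> R); last by field.
  by rewrite exprS; move: ((2^-1) ^+ n) => x; lra.
have Gfin : {ae mu, forall x, D x -> G x \is a fin_num}.
  apply: (integrable_ae mD); apply/integrableP; split => //.
  by under eq_integral do rewrite gee0_abs//; exact: (le_lt_trans iG (ltry _)).
pose g x := fine (G x).
have g0 x : 0 <= g x by rewrite fine_ge0.
have mg : measurable_fun D g by exact: (measurableT_comp (fine_measurable measurableT) mG).
have gG x : ((g x)%:E <= G x)%E by rewrite /g; case: (G x) (G0 x) => //= _; rewrite leey.
have ig : mu.-integrable D (EFin \o g).
  apply/integrableP; split; first exact/measurable_EFinP.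
  apply: (@le_lt_trans _ _ (\int[mu]_(x in D) G x)%E); last exact: (le_lt_trans iG (ltry _)).
  apply: ge0_le_integral => //.
  - by apply/measurable_EFinP; apply: measurableT_comp => //.
  - by move=> x _ /=; rewrite ger0_norm.
pose w x := fine (limn_esup (EFin \o (f ^~ x))).
have mw : measurable_fun D w.
  apply: (measurableT_comp (fine_measurable measurableT)).
  apply: (measurable_fun_limn_esup (f := fun n x => (f n x)%:E)) => n.
  by apply/measurable_EFinP; case: (sf n).
pose h k x := 2 * Num.sqrt (g x) * (2^-1) ^+ k.
have h2 k x : h k x * h k x = 4 * (4^-1) ^+ k * g x.
  rewrite /h -expr2 !exprMn sqr_sqrtr// -exprM mulnC exprM (_ : 2^-1 ^+ 2 = 4^-1 :> R).
    by rewrite -!natrX; ring.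
  by field.
have h0 k x : 0 <= h k x.
  by rewrite mulr_ge0// ?mulr_ge0 ?sqrtr_ge0// exprn_ge0// invr_ge0.
have hw k : {ae mu, forall x, D x -> `|w x - f k x| <= h k x}.
  apply: filterS Gfin => x /[apply] Gx; apply: limn_esup_close.
  apply: geometric_telescope; first exact: sqrtr_ge0.
  move=> i; rewrite -ler_sqr ?nnegrE ?mulr_ge0 ?sqrtr_ge0 ?exprn_ge0 ?invr_ge0//.
  rewrite real_normK ?num_real// exprMn sqr_sqrtr// -exprM mulnC exprM.
  rewrite (_ : 2^-1 ^+ 2 = 4^-1 :> R); last by field.
  rewrite exprVn ler_pdivlMr ?exprn_gt0// mulrC -lee_fin [X in (_ <= X)%E]fineK//.
  have := @nneseries_lim_ge _ (term ^~ x) xpredT 0 i.+1 (fun n _ _ => term0 n x).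
  rewrite big_nat_recr//=; apply: le_trans; rewrite expr2.
  by apply: leeDr; apply: sume_ge0.
have sh k : sq (h k).
  split.
    apply: measurable_funM => //; apply: measurable_funM => //.
    by apply: (measurableT_comp _ mg); apply: continuous_measurable_fun; exact: sqrt_continuous.
  rewrite (_ : _ \o _ = fun x => ((4 * (4^-1) ^+ k)%:E * (EFin \o g) x)%E).
    exact: integrableZl.
  by apply/funext => x /=; rewrite -EFinM expr2 h2.
have swf k : sq (w - f k).
  apply: (sqi_ae_le mD (sh k)); first by apply: measurable_funB => //; case: (sf k).
  by apply: filterS (hw k) => x /[apply]; rewrite (ger0_norm (h0 k x)).
have sw : sq w by rewrite -(subrK (f 0%N) w); exact: (phD HL).
exists w => //.
pose A := \int[mu]_(x in D) g x.
have lim0 : (fun k => 4 * (4^-1) ^+ k * A) @ \oo --> (0 : R).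
  rewrite -(mul0r A) -(mulr0 4); apply: cvgMl; apply: cvgMr.
  by apply: cvg_expr; rewrite ger0_norm ?invr_ge0// invf_lt1 ?ltr1n.
apply: (squeeze_cvgr _ (cvg_cst 0) lim0); apply: nearW => k; apply/andP; split.
  by apply: (ph_ge0 HL); exact: (phB HL).
rewrite -opprB (ph_sqN HL (swf k)).
rewrite /A -RintegralZl//; apply: (ae_le_Rintegral mD).
- exact: sqi_mul.
- by have := integrableZl mD (4 * (4^-1) ^+ k) ig; congr (_.-integrable _); apply/funext => x.
apply: filterS (hw k) => x /[apply] hx.
by rewrite -h2 -!expr2 -[leLHS]real_normK ?num_real// ler_pXn2r ?nnegrE.
Qed.

End riesz_fischer.

(** * Invariance of truncations along outward rays *)

Section clamp_rays.
Context {R : realType}.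
Implicit Types (k h t a : R).

(** The vector [t - clamp k t] vanishes when [t] is in the interval and otherwise points outwards
    from the end [clamp k t]; following it does not change the truncation. *)
Lemma clamp_ray k t a : 0 <= k -> 0 <= a -> clamp k (clamp k t + a * (t - clamp k t)) = clamp k t.
Proof.
move=> k0 a0; case: (clampP t k0) => [[? ->]|[? ->]|[[? ?] ->]].
- have : a * (t - - k) <= 0 by rewrite mulr_ge0_le0//; lra.
  by case: (clampP (- k + a * (t - - k)) k0) => [[? ->]|[? ->]|[[? ?] ->]]; lra.
- have : 0 <= a * (t - k) by rewrite mulr_ge0//; lra.
  by case: (clampP (k + a * (t - k)) k0) => [[? ->]|[? ->]|[[? ?] ->]]; lra.
- by rewrite subrr mulr0 addr0 clamp_id// ler_norml; apply/andP.
Qed.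

(** Truncating the outward vector keeps its sign, so the argument for [clamp_ray] persists. *)
Lemma clamp_step k h t a : 0 <= k -> 0 <= h -> 0 <= a ->
  clamp k (clamp k t + a * clamp h (t - clamp k t)) = clamp k t.
Proof.
move=> k0 h0 a0; case: (clampP t k0) => [[? ->]|[? ->]|[[? ?] ->]].
- have : a * clamp h (t - - k) <= 0.
    by rewrite mulr_ge0_le0// -(clamp0 h) clamp_homo//; lra.
  by case: (clampP (- k + a * clamp h (t - - k)) k0) => [[? ->]|[? ->]|[[? ?] ->]]; lra.
- have : 0 <= a * clamp h (t - k).
    by rewrite mulr_ge0// -(clamp0 h) clamp_homo//; lra.
  by case: (clampP (k + a * clamp h (t - k)) k0) => [[? ->]|[? ->]|[[? ?] ->]]; lra.
- by rewrite subrr clamp0 mulr0 addr0 clamp_id// ler_norml; apply/andP.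
Qed.

End clamp_rays.

(** * The half power of the operator and its pairings with truncations *)

Section spectral_root.
Context {d} {T : measurableType d} {R : realType} (mu : {measure set T -> \bar R}).
Variables (D : set T) (mD : measurable D).
Local Notation sq := (sqi mu D).
Local Notation B := (ip mu D).
Local Notation HL := (prehilbert_L2 mu mD).
Variables (lam : nat -> R) (phi : nat -> T -> R) (s : R).
Hypothesis phi_sq : forall n, sq (phi n).
Hypothesis phi_ortho : forall m n, B (phi m) (phi n) = (m == n)%:R.

Definition orthosum (c : nat -> R) m : T -> R := \sum_(n < m) fscale (c n) (phi n).

Lemma orthosum_sq c m : sq (orthosum c m).
Proof. by apply: (ph_sum HL (e := fun n => fscale (c n) (phi n))) => n; exact: (phZ HL). Qed.

Let phi_ortho1 m n : B (phi m) (phi n) = 1 * (m == n)%:R.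
Proof. by rewrite mul1r. Qed.

Lemma ip_orthosum c m : B (orthosum c m) (orthosum c m) = \sum_(n < m) c n ^+ 2.
Proof.
rewrite (ph_sq_sum HL c phi_sq phi_ortho1).
by apply: eq_bigr => i _; rewrite mul1r.
Qed.

Lemma orthosumB c m k : (m <= k)%N ->
  orthosum c k - orthosum c m = orthosum (fun n => if (m <= n)%N then c n else 0) k.
Proof.
elim: k => [|k IH]; first by rewrite leqn0 => /eqP ->; rewrite subrr /orthosum big_ord0.
rewrite leq_eqVlt => /orP[/eqP ->|].
  rewrite subrr /orthosum big1// => i _; rewrite leqNgt ltn_ord/=.
  by apply/funext => x; rewrite /fscale mul0r.
rewrite ltnS => mk; rewrite /orthosum !big_ord_recr /= mk addrAC; congr (_ + _).
exact: IH.
Qed.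

Lemma riesz_fischer (c : nat -> R) (Q : R) : (forall m, \sum_(n < m) c n ^+ 2 <= Q) ->
  exists2 w, sq w & (fun m => B (orthosum c m - w) (orthosum c m - w)) @ \oo --> (0 : R).
Proof.
move=> HQ; pose q m := \sum_(n < m) c n ^+ 2.
have q_mono : {homo q : m n / (m <= n)%N >-> m <= n}.
  apply: homo_leq => // [? ? ?|k]; first exact: le_trans.
  by rewrite /q big_ord_recr /= lerDl sqr_ge0.
have BS m k : (m <= k)%N ->
    B (orthosum c k - orthosum c m) (orthosum c k - orthosum c m) = q k - q m.
  move=> mk; rewrite orthosumB// ip_orthosum; apply/eqP; rewrite eq_sym subr_eq; apply/eqP.
  elim: k mk => [|k IH]; first by rewrite leqn0 => /eqP ->; rewrite /q !big_ord0 addr0.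
  rewrite leq_eqVlt => /orP[/eqP ->|].
    by rewrite big1 ?add0r// => i _; rewrite leqNgt ltn_ord/= expr0n.
  by rewrite ltnS => mk; rewrite /q !big_ord_recr /= mk -/(q k) IH// addrAC.
have qb : has_sup (range q) 
  by split; [exists (q 0%N); exists 0%N|exists Q => _ [m _ <-]; exact: HQ].
have cauchy (e : R) : 0 < e -> exists M, forall m k, (M <= m)%N -> (m <= k)%N -> q k - q m <= e.
  move=> e0; have [_ [M _ <-] hM] := sup_adherent e0 qb.
  exists M => m k Mm mk; have := q_mono _ _ Mm.
  have : q k <= sup (range q) by apply: ub_le_sup; [case: qb|exists k].
  by move: hM; lra.
have e8 k : 0 < (8^-1) ^+ k :> R by rewrite exprn_gt0// invr_gt0.
have [M hM] := choice (fun k : nat => cauchy _ (e8 k)).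
(* At least [M k], at least [k] and nondecreasing: consecutive partial sums along [m] are then as
   close as [L2_complete_geometric] requires. *)
pose m k := (\sum_(i < k.+1) M i + k)%N.
have mM k : (M k <= m k)%N by rewrite /m big_ord_recr /= -addnA addnCA leq_addr.
have mS k : (m k <= m k.+1)%N by rewrite /m [in leqRHS]big_ord_recr /= leq_add// leq_addr.
have S8 k : B (orthosum c (m k.+1) - orthosum c (m k)) (orthosum c (m k.+1) - orthosum c (m k)) <=
    (8^-1) ^+ k by rewrite BS// hM.
have [w sw cw] := L2_complete_geometric mD (fun k => orthosum_sq c (m k)) S8.
exists w => //.
have sSw k : sq (orthosum c k - w) := phB HL (orthosum_sq c k) sw.
apply/cvgr0Pnorm_le => e e0.
have e4 : 0 < e / 4 by rewrite divr_gt0.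
have [M1 hM1] := cauchy _ e4.
move/cvgr0Pnorm_le : cw => /(_ _ e4)[k _ hk].
(* One term of the subsequence close to [w], beyond the Cauchy threshold [M1], controls the whole
   sequence from [m j] on. *)
pose j := maxn k M1.
have mj : (M1 <= m j)%N.
  by apply: (leq_trans (leq_maxr k M1)); rewrite -/j /m leq_addl.
exists (m j) => // i /= ji.
rewrite ger0_norm; last exact: (ph_ge0 HL).
rewrite -(subrKA (orthosum c (m j))).
have sij := phB HL (orthosum_sq c i) (orthosum_sq c (m j)).
apply: (le_trans (ph_sqD_le HL sij (sSw (m j)))).
have h1 := hM1 _ _ mj ji; rewrite -BS// in h1.
have h2 := hk j (leq_maxl _ _); rewrite ger0_norm in h2; last exact: (ph_ge0 HL).
by move: h1 h2; lra.
Qed.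


(* [w] is the image of [u] under the power [s / 2] of the operator. *)
Definition root_image (u w : T -> R) : Prop := [/\ sq u, sq w &
  (fun m => B (orthosum (fun n => lam n `^ (s / 2) * B (phi n) u) m - w)
              (orthosum (fun n => lam n `^ (s / 2) * B (phi n) u) m - w)) @ \oo --> (0 : R)].

Let weight n : (lam n `^ (s / 2)) ^+ 2 = lam n `^ s.
Proof.
rewrite -powR_mulrn ?powR_ge0// -powRrM (_ : s / 2 * 2%:R = s)//.
by rewrite mulfVK.
Qed.

Lemma root_image_exists u Q : sq u -> (forall m, \sum_(n < m) lam n `^ s * B (phi n) u ^+ 2 <= Q) ->
  exists w, root_image u w.
Proof.
move=> su HQ; have [|w sw cw] := @riesz_fischer (fun n => lam n `^ (s / 2) * B (phi n) u) Q.
  by move=> m; under eq_bigr do rewrite exprMn weight.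
by exists w.
Qed.

Lemma root_image_lin a u v w z : root_image u w -> root_image v z -> root_image (u + fscale a v) (w + fscale a z).
Proof.
move=> [su sw cu] [sv sz cv].
split; [exact: (phD HL su (phZ HL a sv))|exact: (phD HL sw (phZ HL a sz))|].
pose S u m := orthosum (fun n => lam n `^ (s / 2) * B (phi n) u) m.
have SE m : S (u + fscale a v) m - (w + fscale a z) = (S u m - w) + fscale a (S v m - z).
  have -> : S (u + fscale a v) m = S u m + fscale a (S v m).
    rewrite /S /orthosum; elim: m => [|m IH].
      by rewrite !big_ord0; apply/funext => x; rewrite !fctE /fscale /= add0r mulr0.
    rewrite !big_ord_recr /= IH (phBDr HL su (phZ HL a sv))// (phBZr HL a sv)//.
    by apply/funext => x; rewrite !fctE /fscale /= ; ring.
  by apply/funext => x; rewrite !fctE /fscale /= ; ring.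
have sS y t m : sq t -> sq (S y m - t) by move=> st; exact: (phB HL (orthosum_sq _ _) st).
have lim0 : (fun m => 2 * B (S u m - w) (S u m - w) + (2 * a ^+ 2) * B (S v m - z) (S v m - z))
    @ \oo --> (0 : R).
  have := cvgD (cvgM (cvg_cst (2 : R)) cu) (cvgM (cvg_cst (2 * a ^+ 2 : R)) cv).
  by rewrite !mulr0 addr0; exact.
apply: (squeeze_cvgr _ (cvg_cst 0) lim0); apply: nearW => m; rewrite -/(S _ _) SE.
apply/andP; split; first by apply: (ph_ge0 HL); apply: (phD HL); [|apply: (phZ HL)]; exact: sS.
apply: (le_trans (ph_sqD_le HL (sS u w m sw) (phZ HL a (sS v z m sz)))).
rewrite (phBZl HL)//; [|exact: sS|exact: (phZ HL a (sS v z m sz))].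
by rewrite (phBZr HL a (sS v z m sz) (sS v z m sz)) le_eqVlt; apply/orP; left; apply/eqP; ring.
Qed.

Let energy_sum u m : B (orthosum (fun n => lam n `^ (s / 2) * B (phi n) u) m)
    (orthosum (fun n => lam n `^ (s / 2) * B (phi n) u) m) =
  \sum_(n < m) lam n `^ s * B (phi n) u ^+ 2.
Proof. by rewrite ip_orthosum; apply: eq_bigr => i _; rewrite exprMn weight. Qed.

(** Half of Parseval's identity, by comparison with a partial sum close to [w];
    [root_image_energy_ge] is the other half. Both are phrased with partial sums, the shape in which
    contractions are known. *)
Lemma root_image_energy_le u w m : root_image u w -> \sum_(n < m) lam n `^ s * B (phi n) u ^+ 2 <= B w w.
Proof.
move=> [su sw cu].
have W0 := ph_ge0 HL sw.
apply/ler_addgt0Pr => e e0; pose d0 := e / (2 * (B w w + 1)).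
have W1 : 0 < B w w + 1 by rewrite ltr_wpDl.
have d00 : 0 < d0 by rewrite divr_gt0// mulr_gt0.
have d1 : 0 < 1 + d0^-1 by rewrite addr_gt0// invr_gt0.
move/cvgr0Pnorm_le : cu => /(_ (e / 2 / (1 + d0^-1)))[|k _ hk].
  by rewrite !divr_gt0.
pose M := maxn m k.
have : \sum_(n < m) lam n `^ s * B (phi n) u ^+ 2 <= \sum_(n < M) lam n `^ s * B (phi n) u ^+ 2.
  rewrite -[M](subnKC (leq_maxl m k)) -/M; elim: (M - m)%N => [|i IH]; first by rewrite addn0.
  by rewrite addnS big_ord_recr /= (le_trans IH)// lerDl mulr_ge0 ?powR_ge0 ?sqr_ge0.
move/le_trans; apply; rewrite -energy_sum.
apply: (le_trans (ph_near HL (orthosum_sq _ _) sw d00)).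
have := hk M (leq_maxr m k); rewrite ger0_norm; last first.
  by apply: (ph_ge0 HL); exact: (phB HL (orthosum_sq _ _) sw).
rewrite ler_pdivlMr// mulrC => h2.
have h1 : d0 * B w w <= e / 2.
  rewrite /d0 mulrAC ler_pdivrMr ?mulr_gt0// mulrA divfK// ler_wpM2l ?(ltW e0)//.
  by rewrite lerDl.
by move: h1 h2; rewrite mulrDl mul1r; lra.
Qed.

Lemma root_image_energy_ge u w Q : root_image u w ->
  (forall m, \sum_(n < m) lam n `^ s * B (phi n) u ^+ 2 <= Q) -> B w w <= Q.
Proof.
move=> [su sw cu] HQ; have Q0 : 0 <= Q by have := HQ 0%N; rewrite big_ord0.
apply/ler_addgt0Pr => e e0; pose d0 := e / (2 * (Q + 1)).
have W1 : 0 < Q + 1 by rewrite ltr_wpDl.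
have d00 : 0 < d0 by rewrite divr_gt0// mulr_gt0.
have d1 : 0 < 1 + d0^-1 by rewrite addr_gt0// invr_gt0.
move/cvgr0Pnorm_le : cu => /(_ (e / 2 / (1 + d0^-1)))[|k _ hk].
  by rewrite !divr_gt0.
have sS := orthosum_sq (fun n => lam n `^ (s / 2) * B (phi n) u) k.
apply: (le_trans (ph_near HL sw sS d00)).
have := hk k (leqnn k); rewrite ger0_norm; last first.
  by apply: (ph_ge0 HL); exact: (phB HL sS sw).
rewrite -(ph_sqN HL (phB HL sS sw)) opprB energy_sum ler_pdivlMr// mulrC => h2.
have h3 := HQ k.
have h1 : d0 * Q <= e / 2.
  rewrite /d0 mulrAC ler_pdivrMr ?mulr_gt0// mulrA divfK// ler_wpM2l ?(ltW e0)//.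
  by rewrite lerDl.
have h4 := ler_wpM2l (ltW d00) h3.
by move: h1 h2 h3 h4; rewrite mulrDl mul1r; lra.
Qed.

Hypothesis clamp_sq : forall k u, 0 <= k -> sq u -> sq (clamp k \o u).
Hypothesis clamp_energy : forall k u Q, 0 <= k -> sq u ->
  (forall m, \sum_(n < m) lam n `^ s * B (phi n) u ^+ 2 <= Q) ->
  forall m, \sum_(n < m) lam n `^ s * B (phi n) (clamp k \o u) ^+ 2 <= Q.

Lemma root_image_clamp k u w : 0 <= k -> root_image u w -> exists z, root_image (clamp k \o u) z.
Proof.
move=> k0 hu; have [su _ _] := hu.
apply: (@root_image_exists _ (B w w)); first exact: clamp_sq.
by apply: clamp_energy => // m; exact: root_image_energy_le.
Qed.

(** First variation at [a = 0]: the truncation hypothesis makes the energy minimal there among all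
    [a >= 0]. *)
Lemma root_image_clamp_pairing k u v w z : 0 <= k -> root_image (clamp k \o u) w -> root_image v z ->
  (forall a, 0 <= a -> clamp k \o ((clamp k \o u) + fscale a v) = clamp k \o u) ->
  0 <= B w z.
Proof.
move=> k0 hu hv huv; have [_ sw _] := hu; have [_ sz _] := hv.
have key a : 0 <= a -> 0 <= 2 * a * B w z + a ^+ 2 * B z z.
  move=> a0; have h := root_image_lin a hu hv; have [suv _ _] := h.
  have : B w w <= B (w + fscale a z) (w + fscale a z).
    apply: (root_image_energy_ge hu); rewrite -{1}(huv a a0).
    by apply: clamp_energy => // m; exact: root_image_energy_le.
  rewrite (ph_sqD HL sw (phZ HL a sz)) (phBZr HL a sz sw) (phBZl HL a sz (phZ HL a sz)).
  by rewrite (phBZr HL a sz sz); lra.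
have Z0 := ph_ge0 HL sz.
rewrite leNgt; apply/negP => neg.
have Z1 : 0 < B z z + 1 by rewrite ltr_wpDl.
(* For this [a] the quadratic [2 * a * B w z + a ^+ 2 * B z z] equals [a * B w z - a ^+ 2], which
   would be negative. *)
pose a := - B w z / (B z z + 1).
have a0 : 0 < a by rewrite divr_gt0// oppr_gt0.
have aE : a * B z z = - B w z - a by rewrite /a; field; rewrite lt0r_neq0.
have : a * B w z < 0 by rewrite pmulr_rlt0.
have : 0 < a * a by rewrite mulr_gt0.
have := key a (ltW a0); rewrite (_ : a ^+ 2 * _ = a * (a * B z z)); last by ring.
by rewrite aE; lra.
Qed.

(** The image [w] splits into [t], [z] and the image of the remainder; the pairings of [z] with the
    first and the last are nonnegative by [clamp_step] and [clamp_ray]. *)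
Lemma truncation_energy k h u v w z : 0 <= k -> 0 <= h -> root_image u w -> root_image v z ->
  v = clamp h \o (u - (clamp k \o u)) -> B z z <= B w z.
Proof.
move=> k0 h0 hu hv vE; have [_ sw _] := hu; have [_ sz _] := hv.
have [t ht] := root_image_clamp k0 hu; have [_ st _] := ht.
have hy : root_image (u - (clamp k \o u)) (w - t).
  have := root_image_lin (-1) hu ht.
  have e (f : T -> R) : fscale (-1) f = - f by apply/funext => x; rewrite /fscale mulN1r.
  by rewrite !e.
have [_ sy _] := hy.
have hr : root_image ((u - (clamp k \o u)) - v) ((w - t) - z).
  have := root_image_lin (-1) hy hv.
  have e (f : T -> R) : fscale (-1) f = - f by apply/funext => x; rewrite /fscale mulN1r.
  by rewrite !e.
have h1 : 0 <= B t z.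
  apply: (root_image_clamp_pairing k0 ht hv) => a a0; apply/funext => x; rewrite vE !fctE /fscale /=.
  by apply: clamp_step.
have h2 : 0 <= B z ((w - t) - z).
  move: hv; rewrite vE => hv.
  apply: (root_image_clamp_pairing h0 hv hr) => a a0; apply/funext => x; rewrite vE !fctE /fscale /=.
  exact: clamp_ray.
have [_ sr _] := hr.
rewrite (phBBr HL sy sz sz) (phBBr HL sw st sz) in h2.
by move: h1; rewrite (phC HL st sz) (phC HL sw sz); lra.
Qed.

End spectral_root.

(** * Superposition operators *)

Section caratheodory_functions.
Context {d} {X : measurableType d} {R : realType}.
Variables (D : set X) (mD : measurable D).

(** With [g] rounded down to a multiple of [2 ^- n], the composition consists of countably many
    slices in [x] glued along measurable sets; continuity in the second variable gives the limit. *)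
Lemma measurable_fun_caratheodory (F : X -> R -> R) (g : X -> R) :
  (forall t, measurable_fun D (F ^~ t)) -> (forall x, D x -> continuous (F x)) ->
  measurable_fun D g -> measurable_fun D (fun x => F x (g x)).
Proof.
move=> mF cF mg.
pose k n x := Num.floor (2 ^+ n * g x).
apply: (@measurable_fun_cvg _ _ _ D (fun n x => F x ((k n x)%:~R / 2 ^+ n))).
  move=> n _ B mB.
  rewrite (_ : _ `&` _ = \bigcup_(i in [set: int]) ((D `&` (k n) @^-1` [set i]) `&`
      (D `&` (F ^~ (i%:~R / 2 ^+ n)) @^-1` B))); last first.
    apply/seteqP; split => [x [Dx Bx]|x [i _] [[Dx kx] [_ Bx]]].
      by exists (k n x).
    by split => //; move: kx Bx => /= <-.
  apply: countable_bigcupT_measurable => // i; apply: measurableI; last exact: mF.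
  rewrite (_ : _ `&` _ = D `&` (fun x => 2 ^+ n * g x) @^-1` `[i%:~R, (i + 1)%:~R[); last first.
    apply/seteqP; split => x [Dx /=].
      by rewrite /k in_itv/= => <-; split => //; exact: floor_itv.
    by rewrite in_itv/= => h; split => //; exact: floor_def.
  by apply: measurable_funM.
move=> x Dx; apply: continuous_cvg; first exact: cF.
apply/cvgrPdist_le => e e0; near=> n.
have p0 : 0 < 2 ^+ n :> R by rewrite exprn_gt0.
have /andP[h1 h2] := floor_itv (2 ^+ n * g x).
rewrite -/(k n x) in h1 h2; rewrite intrD in h2.
have -> : g x - (k n x)%:~R / 2 ^+ n = (2 ^+ n * g x - (k n x)%:~R) / 2 ^+ n.
  by rewrite mulrBl mulrAC mulfV ?mul1r// lt0r_neq0.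
rewrite ger0_norm ?divr_ge0 ?(ltW p0) ?subr_ge0// ler_pdivrMr//.
apply: (@le_trans _ _ 1); first by rewrite lerBlDl ltW.
rewrite mulrC -ler_pdivrMr// div1r.
apply: (@le_trans _ _ n%:R); last by rewrite -natrX ler_nat ltnW// ltn_expl.
near: n; exact: nbhs_infty_ger.
Unshelve. all: by end_near. Qed.

End caratheodory_functions.

Section measurable_primitive.
Context {d} {X : measurableType d} {R : realType}.
Variables (D : set X) (mD : measurable D).
Local Notation T := (measurableTypeR R).
Local Notation mu := (@lebesgue_measure R).

(** Tonelli's theorem for the integrand cut off to [0 <= t <= |g x|], which is jointly measurable by
    [measurable_fun_caratheodory]. *)
Lemma measurable_primitive (f : X -> R -> R) (g : X -> R) :
  (forall t, measurable_fun D (f ^~ t)) -> (forall x, D x -> continuous (f x)) ->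
  (forall x t, D x -> 0 <= t -> 0 <= f x t) -> measurable_fun D g ->
  measurable_fun D (fun x => \int[mu]_(t in `[0, `|g x|]) f x t).
Proof.
move=> mf cf f0 mg.
pose DT := D `*` [set: T].
have mDT : measurable DT by exact: measurableX.
have mfst (h : X -> R) : measurable_fun D h -> measurable_fun DT (h \o fst).
  move=> mh; apply: (measurable_comp mD) => //; first by move=> _ [p [Dp _] <-].
  exact: measurable_funTS.
have msnd : measurable_fun DT (snd : X * T -> R) by exact: measurable_funTS.
pose S := DT `&` [set p | 0 <= p.2] `&` [set p | 0 <= `|g p.1| - p.2].
have mS : measurable S.
  have m1 : measurable (DT `&` [set p : X * T | 0 <= p.2]).
    have := msnd mDT `[0, +oo[%classic (measurable_itv _).
    by congr measurable; apply/seteqP; split => p [h /=]; rewrite in_itv/= andbT.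
  have m2 : measurable_fun DT (fun p : X * T => `|g p.1| - p.2).
    apply: measurable_funB => //; apply: measurableT_comp => //; exact: (mfst g).
  have := measurableI _ _ m1 (m2 mDT `[0, +oo[%classic (measurable_itv _)).
  congr measurable; apply/seteqP; split => p.
    by move=> [h1 [h2 /=]]; rewrite in_itv/= andbT => h3.
  by move=> [[h1 h2] h3]; split => //; split => //=; rewrite in_itv/= andbT.
pose h : X * T -> \bar R := (fun p => (f p.1 p.2)%:E) \_ S.
have mh : measurable_fun setT h.
  apply/(measurable_restrictT _ mS); apply/measurable_EFinP.
  apply: (measurable_funS mDT); first by move=> p [[]].
  apply: (measurable_fun_caratheodory mDT (F := fun p => f p.1)) => //.
  - by move=> t; exact: (mfst (f ^~ t)).
  - by move=> p [Dp _]; exact: cf.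
have h0 p : (0 <= h p)%E.
  rewrite /h patchE; case: ifPn => // /set_mem[[[Dp _] p0] _].
  by rewrite lee_fin; exact: f0.
have mF : measurable_fun D (fubini_F mu h).
  by apply: measurable_funTS; exact: measurable_fun_fubini_tonelli_F.
have := measurableT_comp (fine_measurable measurableT) mF.
apply: eq_measurable_fun => x /set_mem Dx /=.
rewrite /fubini_F /Rintegral [in RHS]integral_mkcond; congr fine.
apply: eq_integral => t _; rewrite /h !patchE.
have -> : ((x, t) \in S) = (t \in `[0, `|g x|]%classic).
  apply/idP/idP => /set_mem; rewrite /S/=.
    by move=> [[_ t0] t1]; apply/mem_set; rewrite /= in_itv/= t0 -subr_ge0.
  by rewrite in_itv/= => /andP[t0 t1]; apply/mem_set; split; [split|rewrite /= subr_ge0].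
by case: ifP.
Qed.

End measurable_primitive.

(** * Measurability of the nonlinear term *)

Section nonlinearity.
Context {R : realType} {N : nat} (Omega : set 'rV[R]_N).
Hypothesis mO : measurable (Omega : set (euclid R N)).
Local Notation RN := 'rV[R]_N.
Local Notation mu := (@leb R N).
Variable f : RN -> R -> R.
Hypothesis mf : forall t, measurable_fun (Omega : set (euclid R N)) (f ^~ t).
Hypothesis fA : almost_everywhere_in Omega (fun x =>
  [/\ forall t, f x (- t) = - f x t, {homo f x : t1 t2 / t1 < t2}, continuous (f x),
      f x 0 = 0 & f x t @[t --> +oo] --> +oo]).

Lemma leb_complete : measure_is_complete mu.
Proof. exact: measure_is_complete_caratheodory. Qed.

(** The structural assumption holds almost everywhere only, while the measurability lemmas ask for
    it at every point: the exceptional null set is enlarged to a measurable one and removed. *)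
Lemma good_set : exists2 D : set (euclid R N), measurable D & [/\ D `<=` Omega,
  forall x, D x -> [/\ forall t, f x (- t) = - f x t, {homo f x : t1 t2 / t1 < t2},
    continuous (f x) & f x 0 = 0] & {ae mu, forall x, Omega x -> D x}].
Proof.
have [A [mA A0 sA]] := fA.
exists (Omega `\` A); first exact: measurableD.
split; first by move=> x [].
  move=> x [Ox nAx]; have : (Omega x -> [/\ forall t, f x (- t) = - f x t,
      {homo f x : t1 t2 / t1 < t2}, continuous (f x), f x 0 = 0 & f x t @[t --> +oo] --> +oo]).
    by apply/not_notP => h; apply: nAx; apply: sA.
  by move=> /(_ Ox)[].
exists A; split => // x /= h; apply/not_notP => nAx; apply: h => Ox; split => //.
Qed.

(** A change on a null set preserves measurability because the measure is complete. *)
Lemma measurable_of_good (D : set (euclid R N)) (h : RN -> R) : measurable D -> D `<=` Omega ->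
  {ae mu, forall x, Omega x -> D x} -> measurable_fun D (h : euclid R N -> R) ->
  measurable_fun (Omega : set (euclid R N)) (h : euclid R N -> R).
Proof.
move=> mD DO aD mh; apply/measurable_EFinP.
apply: (ae_measurable_fun leb_complete (f := (EFin \o (h : euclid R N -> R)) \_ D)).
  have [A [mA A0 sA]] := aD; exists A; split => // x /= nx; apply: sA => /= h1; apply: nx => Ox.
  by rewrite patchE mem_set//; exact: h1.
apply/(measurable_restrict _ mD mO); rewrite setIidr//; exact/measurable_EFinP.
Qed.

Lemma measurable_superposition (u : RN -> R) : measurable_fun (Omega : set (euclid R N)) u ->
  measurable_fun (Omega : set (euclid R N)) (fun x => f x (u x)).
Proof.
move=> mu_; have [D mD [DO DP aD]] := good_set.
apply: (measurable_of_good mD DO aD).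
apply: (measurable_fun_caratheodory mD (X := euclid R N)) => [t|x Dx|].
- exact: (measurable_funS mO DO (mf t)).
- by have [] := DP x Dx.
- exact: (measurable_funS mO DO mu_).
Qed.

Lemma measurable_superposition_primitive (u : RN -> R) :
  measurable_fun (Omega : set (euclid R N)) u ->
  measurable_fun (Omega : set (euclid R N)) (fun x => primitive f x (u x)).
Proof.
move=> mu_; have [D mD [DO DP aD]] := good_set.
apply: (measurable_of_good mD DO aD).
apply: (measurable_primitive mD (X := euclid R N)) => [t|x Dx|x t Dx t0|].
- exact: (measurable_funS mO DO (mf t)).
- by have [] := DP x Dx.
- have [_ fi _ f0] := DP x Dx; move: t0; rewrite le_eqVlt => /predU1P[<-|t0]; first by rewrite f0.
  by rewrite -f0 ltW// fi.
- exact: (measurable_funS mO DO mu_).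
Qed.

End nonlinearity.

(** * Decay of the level sets *)

Section hoelder_on_set.
Context {d} {T : measurableType d} {R : realType} (mu : {measure set T -> \bar R}).

(** The number [1 - 1 / p], with [1 / p = 0] for infinite [p]: the exponent of the measure in
    Hoelder's inequality on a set. *)
Definition hoelder_gap (p : \bar R) : R := 1 - fine (p^-1)%E.

(** Hoelder's inequality against the indicator of [A]. The values 1 and infinity of [p] are treated
    apart, as there the conjugate exponent is not a finite quotient [r / (r - 1)] or [p] is not
    real. *)
Lemma hoelder_on_set (f : T -> R) (A : set T) (p : \bar R) (K : R) : (1 <= p)%E ->
  measurable_fun setT f -> measurable A -> (mu A < +oo)%E ->
  ('N[mu]_p[EFin \o f])%E = K%:E ->
  (\int[mu]_(x in A) `|(f x)%:E| <= (K * fine (mu A) `^ hoelder_gap p)%:E)%E.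
Proof.
move=> p1 mf mA Afin NK; have mAf : mu A \is a fin_num by rewrite ge0_fin_numE.
have K0 : 0 <= K by rewrite -lee_fin -NK; exact: Lnorm_ge0.
have mEf : measurable_fun setT (EFin \o f) by exact/measurable_EFinP.
rewrite /hoelder_gap; case: p p1 NK => [r||//] p1 NK; last first.
  rewrite invey subr0 powRr1 ?fine_ge0// EFinM fineK//.
  rewrite -(integral_cst mu mA); apply: ae_ge0_le_integral => //.
  - by apply: measurableT_comp => //; exact: measurable_funTS.
  have [t0|t0] := boolP (0 < mu [set: T])%E.
    have : (ess_sup mu (abse \o (EFin \o f)) <= K%:E)%E.
      by move: NK; rewrite unlock t0 => ->.
    move/ess_supP; apply: filterS => x /= h _; exact: h.
  exists setT; split => //.
  by apply/eqP; rewrite eq_le measure_ge0 andbT leNgt.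
rewrite lee_fin in p1; have r0 : 0 < r by exact: lt_le_trans p1.
rewrite inver gt_eqF//=.
have [r1|r1] := eqVneq r 1.
  rewrite r1 invr1 subrr powRr0 mulr1 -NK r1 Lnorm1.
  apply: (@ge0_subset_integral _ _ _ mu A setT mA measurableT (fun x => (`|f x|)%:E)) => //.
  by apply/measurable_EFinP; exact: measurableT_comp.
have r10 : 0 < r - 1 by rewrite subr_gt0 lt_neqAle eq_sym r1.
pose q := r / (r - 1).
have q0 : 0 < q by rewrite divr_gt0.
have qE : q^-1 = 1 - r^-1 by rewrite /q; field; rewrite !lt0r_neq0.
have := @hoelder _ _ _ mu f (\1_A) r q mf (measurable_indic mA) r0 q0.
rewrite qE addrC subrK NK => /(_ erefl).
rewrite Lnorm1 [X in (_ <= _ * X)%E](_ : _ = (fine (mu A) `^ (1 - r^-1))%:E); last first.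
  rewrite unlock -qE -poweR_EFin fineK//; congr (_ `^ _)%E.
  rewrite -[in RHS](setIT A) -integral_indic//; apply: eq_integral => x _ /=.
  by rewrite indicE; case: (x \in A); rewrite ?normr1 ?powR1 ?normr0 ?powR0 ?lt0r_neq0.
rewrite -EFinM; apply: le_trans.
rewrite integral_mkcond le_eqVlt; apply/orP; left; apply/eqP; apply: eq_integral => x _.
rewrite patchE /= indicE; case: ifPn => xA; first by rewrite mulr1.
by rewrite mulr0 normr0.
Qed.

Lemma integrable_ae_le (D : set T) (u v : T -> R) : measurable D ->
  mu.-integrable D (EFin \o u) -> measurable_fun D v ->
  {ae mu, forall x, D x -> `|v x| <= `|u x|} -> mu.-integrable D (EFin \o v).
Proof.
move=> mD /integrableP[/measurable_EFinP mu_ iu] mv vu; apply/integrableP.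
split; first exact/measurable_EFinP.
apply: le_lt_trans iu; apply: (ae_ge0_le_integral mD) => //.
- by apply/measurable_EFinP; exact: measurableT_comp.
- by apply/measurable_EFinP; exact: measurableT_comp.
Qed.

End hoelder_on_set.

(** For [x = l / t] the left side is at most the minimum of [x] and 1, itself at most the [s]-th
    power of [x]. At [t = r ^- 2] this produces the power [2 * s] of [r]. *)
Lemma resolvent_le_powR {R : realType} (l t s : R) : 0 < l -> 0 < t -> 0 < s < 1 ->
  l / (l + t) <= (l / t) `^ s.
Proof.
move=> l0 t0 /andP[s0 s1]; have lt0 : 0 < l + t by rewrite addr_gt0.
have [lt|tl] := leP l t.
  apply: (@le_trans _ _ (l / t)).
    by rewrite ler_wpM2l ?(ltW l0)// lef_pV2 ?posrE// lerDr ltW.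
  by rewrite ger1_powR ?(ltW s1)// divr_gt0// ler_pdivrMr// mul1r.
apply: (@le_trans _ _ 1); first by rewrite ler_pdivrMr// mul1r lerDl ltW.
by rewrite -[leLHS](powRr0 (l / t)) ler_powR ?(ltW s0)// ler_pdivlMr// mul1r ltW.
Qed.

Section truncation.
Context {R : realType}.
Implicit Types k h t : R.

(** The function [sign t * min (max (|t| - k) 0) (h - k)], written with two nested truncations so
    that the contraction property of [clamp] applies twice. *)
Definition truncation k h t : R := clamp (h - k) (t - clamp k t).

Lemma truncation_norm k h t : 0 <= k -> k <= h -> `|truncation k h t| <= `|t|.
Proof.
move=> k0 kh; have hk : 0 <= h - k by rewrite subr_ge0.
apply: (le_trans (clamp_norm _ hk)).
case: (clampP t k0) => [[? ->]|[? ->]|[[? ?] ->]].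
- by rewrite !ler0_norm; lra.
- by rewrite !ger0_norm; lra.
- by rewrite subrr normr0.
Qed.

Lemma truncation_small k h t : `|t| <= k -> truncation k h t = 0.
Proof. by move=> tk; rewrite /truncation (clamp_id tk) subrr clamp0. Qed.

Lemma truncation_large k h t : 0 <= k -> k <= h -> h <= `|t| -> `|truncation k h t| = h - k.
Proof.
move=> k0 kh ht; have hk : 0 <= h - k by rewrite subr_ge0.
apply: clamp_large => //; case: (clampP t k0) => [[h1 ->]|[h1 ->]|[[h1 h2] ->]].
- by move: ht; rewrite !ler0_norm; lra.
- by move: ht; rewrite !ger0_norm; lra.
- have : `|t| <= k by rewrite ler_norml h1.
  by rewrite subrr normr0; lra.
Qed.

Lemma truncation_sign k h t : 0 <= k -> k <= h ->
  (0 <= t -> 0 <= truncation k h t) /\ (t <= 0 -> truncation k h t <= 0).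
Proof.
move=> k0 kh; have hk : 0 <= h - k by rewrite subr_ge0.
by split => t0; rewrite /truncation -(clamp0 (h - k)) clamp_homo//;
  case: (clampP t k0) => [[? ->]|[? ->]|[[? ?] ->]]; lra.
Qed.

End truncation.

Lemma primitive_mono {R : realType} (g : R -> R) a b : continuous g -> (forall t, 0 <= t -> 0 <= g t) ->
  0 <= b -> b <= a ->
  0 <= \int[@lebesgue_measure R]_(t in `[0, b]) g t <= \int[@lebesgue_measure R]_(t in `[0, a]) g t.
Proof.
move=> cg g0 b0 ba.
have ig c : (@lebesgue_measure R).-integrable `[0, c] (EFin \o g).
  by apply: continuous_compact_integrable; [exact: segment_compact|exact: continuous_subspaceT].
apply/andP; split; first by apply: Rintegral_ge0 => t; rewrite /= in_itv/= => /andP[t0 _]; exact: g0.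
have mg : measurable_fun setT (EFin \o g).
  by apply/measurable_EFinP; exact: continuous_measurable_fun.
rewrite /Rintegral fine_le//; try exact: integrable_fin_num.
apply: ge0_subset_integral => //.
- exact: measurable_funTS.
- by move=> t; rewrite /= in_itv/= => /andP[t0 _]; rewrite lee_fin g0.
- by move=> t; rewrite /= !in_itv/= => /andP[-> tb]; exact: le_trans tb ba.
Qed.

Lemma ereal_split_half {R : realType} (m : R) (x y : \bar R) : m%:E = (x + y)%E -> (2%:E * y <= m%:E)%E ->
  m / 2 <= fine x.
Proof.
by case: x y => [x| |] [y| |]//= [->]; rewrite -EFinM lee_fin => ?; lra.
Qed.

Lemma displacement_ge {R : realType} {N : nat} (V : 'rV[R]_N -> R) (y : 'rV[R]_N)
    (A : set (euclid R N)) (c : R) : sqi (@leb R N) setT V ->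
  measurable A -> (leb A < +oo)%E -> 0 <= c -> (forall x, A x -> c <= `|V (x + y) - V x|) ->
  c ^+ 2 * fine (leb A) <= Dsh y V.
Proof.
move=> sV mA Afin c0 h.
have sD := sqi_displacement (measurable_rVshift y) (fun A _ => leb_shift y A) sV.
rewrite -(Rintegral_cst leb mA (c ^+ 2)).
apply: (@le_trans _ _ (ip leb A ((V \o rVshift y) - V) ((V \o rVshift y) - V))).
  apply: (le_Rintegral mA); first exact: (finite_measure_integrable_cst_on mA _ Afin).
    by apply: (sqi_mul mA); exact: (sqiS mA sD).
  move=> x Ax; rewrite -expr2 -[leRHS]real_normK ?num_real// ler_pXn2r ?nnegrE// .
  exact: h.
rewrite -(ip_patch leb) -[Dsh _ _]/(ip leb setT _ _).
apply: (le_ip measurableT sD); first exact: (sqi_patch mA (sqiS mA sD)).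
by move=> x _; rewrite patchE; case: ifP => // _; rewrite normr0.
Qed.

(** * The level-set estimate for weak solutions *)

Section level_estimate.
Context {R : realType} {N : nat} (Omega : set 'rV[R]_N).
Hypothesis mO : measurable (Omega : set (euclid R N)).
Hypothesis Ofin : (@leb R N Omega < +oo)%E.
Local Notation RN := 'rV[R]_N.
Local Notation mu := (@leb R N).
Local Notation sqO := (sqi mu (Omega : set (euclid R N))).
Local Notation B := (ip mu (Omega : set (euclid R N))).
Local Notation HL := (prehilbert_L2 mu mO).
Variables (lam : nat -> R) (phi : nat -> RN -> R) (s K : R).
Hypothesis s01 : 0 < s < 1.
Hypothesis K0 : 0 < K.
Hypothesis lam0 : forall n, 0 < lam n.
Hypothesis phi_L2 : forall n, sqO (phi n).
Hypothesis phi_ortho : forall m n, B (phi m) (phi n) = (m == n)%:R.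
(** Together with [displacement_bound], all that this section retains of the elliptic form. *)
Hypothesis clamp_contract : forall (v : RN -> R) (k t Q : R), sqO v -> 0 <= k -> 0 < t ->
  (forall m, \sum_(n < m) lam n / (lam n + t) * B (phi n) v ^+ 2 <= Q) ->
  forall m, \sum_(n < m) lam n / (lam n + t) * B (phi n) (clamp k \o v) ^+ 2 <= Q.
Hypothesis displacement_bound : forall (v : RN -> R) (y : RN) (r Q : R), sqO v -> 0 < r ->
  (forall i, `|y ord0 i| <= r) ->
  (forall m, \sum_(n < m) lam n / (lam n + r ^- 2) * B (phi n) v ^+ 2 <= Q) ->
  Dsh y (v \_ Omega) <= K * Q.

Local Notation powO := (root_image mu (Omega : set (euclid R N)) lam phi s).

Lemma displacement_fractional (v : RN -> R) (y : RN) (r Q : R) : sqO v -> 0 < r ->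
  (forall i, `|y ord0 i| <= r) ->
  (forall m, \sum_(n < m) lam n `^ s * B (phi n) v ^+ 2 <= Q) ->
  Dsh y (v \_ Omega) <= K * (r `^ (2 * s) * Q).
Proof.
move=> sv r0 yr HQ; apply: (displacement_bound sv r0 yr) => m.
have r2 : 0 < r ^- 2 by rewrite invr_gt0 exprn_gt0.
apply: (@le_trans _ _ (\sum_(n < m) r `^ (2 * s) * (lam n `^ s * B (phi n) v ^+ 2))).
  apply: ler_sum => n _; rewrite mulrA ler_wpM2r ?sqr_ge0//.
  apply: (le_trans (resolvent_le_powR (lam0 n) r2 s01)).
  rewrite invrK powRM ?exprn_ge0 ?(ltW r0) ?(ltW (lam0 _))//.
  by rewrite -[r ^+ 2]powR_mulrn ?(ltW r0)// -powRrM mulrC.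
by rewrite -mulr_sumr ler_wpM2l ?powR_ge0.
Qed.

Lemma clamp_fractional k (u : RN -> R) Q : 0 <= k -> sqO u ->
  (forall m, \sum_(n < m) lam n `^ s * B (phi n) u ^+ 2 <= Q) ->
  forall m, \sum_(n < m) lam n `^ s * B (phi n) (clamp k \o u) ^+ 2 <= Q.
Proof.
move=> k0 su; apply: (fractional_contraction s01 (b := fun n => B (phi n) (clamp k \o u))
  (c := fun n => B (phi n) u) lam0) => t Q' t0.
exact: clamp_contract.
Qed.

Lemma Hspace_energy (u : RN -> R) : Hspace Omega lam phi s u ->
  sqO u /\ exists Q, forall m, \sum_(n < m) lam n `^ s * B (phi n) u ^+ 2 <= Q.
Proof.
move=> [/L2P su h]; split => //.
exists (fine (\sum_(0 <= n <oo) (lam n `^ s * coef Omega phi u n ^+ 2)%:E)%E) => m.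
have t0 n : (0 <= (lam n `^ s * coef Omega phi u n ^+ 2)%:E)%E.
  by rewrite lee_fin mulr_ge0 ?powR_ge0 ?sqr_ge0.
rewrite -lee_fin fineK; last by rewrite ge0_fin_numE//; exact: nneseries_ge0.
apply: le_trans (nneseries_lim_ge m _); last by move=> n _ _; exact: t0.
rewrite big_mkord -sumEFin le_eqVlt; apply/orP; left; apply/eqP; apply: eq_bigr => n _.
by rewrite (coefE mO phi_L2).
Qed.

Lemma energy_Hspace (u : RN -> R) Q : sqO u ->
  (forall m, \sum_(n < m) lam n `^ s * B (phi n) u ^+ 2 <= Q) -> Hspace Omega lam phi s u.
Proof.
move=> su HQ; split; first exact/L2P.
apply: (@le_lt_trans _ _ Q%:E); last exact: ltry.
apply: lime_le; first by apply: is_cvg_nneseries => n _ _; rewrite lee_fin mulr_ge0 ?powR_ge0 ?sqr_ge0.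
apply: nearW => m; rewrite big_mkord sumEFin lee_fin; apply: le_trans (HQ m).
by rewrite le_eqVlt; apply/orP; left; apply/eqP; apply: eq_bigr => n _; rewrite (coefE mO phi_L2).
Qed.

(** The set of limits is nonempty by the Riesz-Fischer theorem, so the choice made in [power_L_D]
    returns a true limit and not its default value. *)
Lemma root_image_power_L_D (u : RN -> R) : Hspace Omega lam phi s u ->
  powO u (power_L_D Omega lam phi (s / 2) u).
Proof.
move=> hu; have [su [Q HQ]] := Hspace_energy hu.
have SE : (fun n x => \sum_(k < n) lam k `^ (s / 2) * coef Omega phi u k * phi k x) =
    orthosum (T := euclid R N) phi (fun n => lam n `^ (s / 2) * B (phi n) u).
  apply/funext => m; apply/funext => x; rewrite /orthosum fct_sumE; apply: eq_bigr => n _.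
  by rewrite (coefE mO phi_L2).
have oS := @orthosum_sq _ (euclid R N) R mu Omega mO phi phi_L2.
have : exists w, [set w | L2 Omega w /\ cvg_L2 Omega
    (fun n x => \sum_(k < n) lam k `^ (s / 2) * coef Omega phi u k * phi k x) w] w.
  have [w [_ sw cw]] := root_image_exists mO phi_L2 phi_ortho su HQ.
  exists w; split; first exact/L2P.
  by rewrite SE; apply/(cvg_L2P mO).
rewrite /power_L_D => /(xgetPex (fun=> 0)); move: (xget _ _) => w [/L2P sw cw].
split => //; rewrite SE in cw.
exact: (proj1 (cvg_L2P mO (oS _) sw) cw).
Qed.

Lemma truncation_sq k h (u : RN -> R) : 0 <= k -> k <= h -> sqO u -> sqO (truncation k h \o u).
Proof.
move=> k0 kh su; apply: (sqi_clamp mO (v := u - (clamp k \o u))); first by rewrite subr_ge0.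
exact: (phB HL su (sqi_clamp mO k0 su)).
Qed.

Variable f : RN -> R -> R.
Hypothesis mf : forall t, measurable_fun (Omega : set (euclid R N)) (f ^~ t).
Hypothesis fA : almost_everywhere_in Omega (fun x =>
  [/\ forall t, f x (- t) = - f x t, {homo f x : t1 t2 / t1 < t2}, continuous (f x),
      f x 0 = 0 & f x t @[t --> +oo] --> +oo]).

Lemma truncation_sign_ae k h (u : RN -> R) : 0 <= k -> k <= h ->
  {ae mu, forall x, Omega x -> 0 <= f x (u x) * truncation k h (u x)}.
Proof.
move=> k0 kh; have [A [mA A0 sA]] := fA; exists A; split => // x /= nx; apply: sA => /= good.
apply: nx => Ox; have [_ inc _ f0 _] := good Ox.
have [tp tn] := truncation_sign (u x) k0 kh.
have mono : {homo f x : a b / a <= b}.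
  by move=> a b; rewrite le_eqVlt => /predU1P[->//|ab]; exact/ltW/inc.
have [u0|/ltW u0] := leP 0 (u x).
  by rewrite mulr_ge0 ?tp// -f0 mono.
by rewrite mulr_le0 ?tn// -f0 mono.
Qed.

(** The energy stays finite because both nested truncations contract it; the primitive stays
    integrable because it is nondecreasing in [|t|] and the truncation does not increase [|u x|]. *)
Lemma V0_truncation k h (u : RN -> R) : 0 <= k -> k <= h ->
  V0 Omega s lam phi f u -> V0 Omega s lam phi f (truncation k h \o u).
Proof.
move=> k0 kh [hu iu]; have [su [Q HQ]] := Hspace_energy hu.
have st := truncation_sq k0 kh su.
have [mu_ _] := su; have [mt _] := st.
split.
  have hw := root_image_power_L_D hu.
  have [t ht] := root_image_clamp mO phi_L2 phi_ortho (@sqi_clamp _ _ _ mO) (@clamp_fractional) k0 hw.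
  have := root_image_lin mO phi_L2 (-1) hw ht.
  have -> : u + fscale (-1) (clamp k \o u) = u - (clamp k \o u).
    by apply/funext => x; rewrite /fscale !fctE mulN1r.
  move=> hy; have [sy _ _] := hy.
  have hk : 0 <= h - k by rewrite subr_ge0.
  apply: (energy_Hspace st); apply: (clamp_fractional hk sy) => m.
  exact: (root_image_energy_le mO phi_L2 phi_ortho m hy).
have mFt := measurable_superposition_primitive mO mf fA mt.
apply: (integrable_ae_le mO iu mFt).
have [A [mA A0 sA]] := fA; exists A; split => // x /= nx; apply: sA => /= good.
apply: nx => Ox; have [_ inc cf f0 _] := good Ox.
have fp t : 0 <= t -> 0 <= f x t.
  by rewrite le_eqVlt => /predU1P[<-|t0]; rewrite ?f0// -f0 ltW// inc.
have /andP[h1 h2] := primitive_mono cf fp (normr_ge0 _) (truncation_norm (u x) k0 kh).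
by rewrite !ger0_norm//; exact: le_trans h1 h2.
Qed.

Lemma weak_solution_level (z u : RN -> R) k h : weak_solution Omega s lam phi f z u ->
  0 <= k -> k <= h -> exists2 Q,
    forall m, \sum_(n < m) lam n `^ s * B (phi n) (truncation k h \o u) ^+ 2 <= Q &
    Q <= integral_on Omega (fun x => z x * truncation k h (u x)).
Proof.
move=> [Vu wu] k0 kh; have Vt := V0_truncation k0 kh Vu.
have hu := root_image_power_L_D Vu.1; have ht := root_image_power_L_D Vt.1.
have := wu _ Vt.
move: (power_L_D _ _ _ _ _) (power_L_D _ _ _ _ _) hu ht => v w hw hv eqn.
have hk : 0 <= h - k by rewrite subr_ge0.
have := truncation_energy mO phi_L2 phi_ortho (@sqi_clamp _ _ _ mO) (@clamp_fractional) k0 hk hw hv erefl.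
move=> ineq; exists (B v v); first by move=> m; exact: (root_image_energy_le mO phi_L2 phi_ortho).
rewrite -eqn; apply: (le_trans ineq).
rewrite lerDl; apply: (ae_Rintegral_ge0 mO).
  apply: measurable_funM.
    by apply: measurable_superposition => //; have [[m _] _ _] := hw.
  by have [[m _] _ _] := hv.
exact: truncation_sign_ae.
Qed.

Definition superlevel (u : RN -> R) (k : R) : set (euclid R N) := Omega `&` [set x | k < `|u x|].

Lemma measurable_superlevel (u : RN -> R) k : measurable_fun (Omega : set (euclid R N)) u ->
  measurable (superlevel u k).
Proof.
move=> mu_; have mn : measurable_fun (Omega : set (euclid R N)) (fun x => `|u x|).
  exact: measurableT_comp.
have := mn mO `]k, +oo[%classic (measurable_itv _); congr measurable.
by apply/seteqP; split => x [Ox /=]; rewrite in_itv/= andbT.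
Qed.

Lemma superlevel_lty (u : RN -> R) k : measurable_fun (Omega : set (euclid R N)) u ->
  (mu (superlevel u k) < +oo)%E.
Proof.
move=> mu_; apply: le_lt_trans Ofin; apply: le_measure; rewrite ?inE//.
  exact: measurable_superlevel.
by move=> x [].
Qed.

Lemma superlevel_le (u : RN -> R) k h : measurable_fun (Omega : set (euclid R N)) u -> k <= h ->
  (mu (superlevel u h) <= mu (superlevel u k))%E.
Proof.
move=> mu_ kh; apply: le_measure; rewrite ?inE; try exact: measurable_superlevel.
by move=> x [Ox /= hx]; split => //; exact: le_lt_trans kh hx.
Qed.

(** The truncation vanishes where [|u| <= k] and is at most [h - k] in absolute value, so Hoelder's
    inequality is needed on the superlevel set only. *)
Lemma load_truncation (z u : RN -> R) k h p Z : 0 <= k -> k <= h -> (1 <= p)%E ->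
  measurable_fun (Omega : set (euclid R N)) u -> measurable_fun (Omega : set (euclid R N)) z ->
  norm_Lp Omega p z = Z%:E ->
  integral_on Omega (fun x => z x * truncation k h (u x)) <=
    (h - k) * (Z * fine (mu (superlevel u k)) `^ hoelder_gap p).
Proof.
move=> k0 kh p1 mu_ mz NZ; have hk : 0 <= h - k by rewrite subr_ge0.
pose A := superlevel u k.
have mA : measurable A by exact: measurable_superlevel.
have AO : A `<=` Omega by move=> x [].
have := hoelder_on_set p1 ((measurable_restrictT _ mO).1 mz) mA (superlevel_lty k mu_) NZ.
set J := fine (mu _) `^ _ => hoelder.
have mzA : measurable_fun A (z : euclid R N -> R) by exact: measurable_funS mO AO mz.
have eqA : (\int[mu]_(x in A) `|((z \_ Omega) x)%:E| = \int[mu]_(x in A) `|(z x)%:E|)%E.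
  by apply: eq_integral => x /set_mem Ax; rewrite patchE mem_set//; exact: AO.
rewrite eqA in hoelder.
have iz : mu.-integrable A (EFin \o (z : euclid R N -> R)).
  apply/integrableP; split; first exact/measurable_EFinP.
  exact: le_lt_trans hoelder (ltry _).
have iz2 : mu.-integrable A (EFin \o (fun x : euclid R N => (h - k) * `|z x|)).
  have := integrableZl mA (h - k) (integrable_norm iz).
  by congr (_.-integrable _); apply/funext => x.
have mt : measurable_fun A (fun x : euclid R N => truncation k h (u x)).
  apply: (measurable_funS mO AO).
  apply: measurableT_comp mu_; apply: measurableT_comp; first exact: measurable_clamp.
  by apply: measurable_funB => //; exact: measurable_clamp.
rewrite /integral_on [leLHS](_ : _ = \int[mu]_(x in A) (z x * truncation k h (u x))); last first.
  rewrite [LHS]Rintegral_mkcond [RHS]Rintegral_mkcond; apply: eq_Rintegral => x _.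
  rewrite !patchE; case: ifPn => [/set_mem Ox|nx]; case: ifPn => [/set_mem Ax|nAx] //.
    rewrite truncation_small ?mulr0// leNgt; apply/negP => ux.
    by move/negP : nAx; apply; apply/mem_set.
  by move/negP : nx; case; apply/mem_set; exact: AO.
have tA x : `|truncation k h (u x)| <= h - k by exact: clamp_le.
have ig : mu.-integrable A (EFin \o (fun x : euclid R N => z x * truncation k h (u x))).
  apply: (integrable_ae_le mA iz2); first exact: measurable_funM.
  apply: aeW => x _; rewrite normrM [leRHS]ger0_norm ?mulr_ge0// mulrC.
  by rewrite ler_wpM2r.
apply: (@le_trans _ _ (\int[mu]_(x in A) ((h - k) * `|z x|))).
  apply: (le_Rintegral mA) => // x _; apply: (le_trans (ler_norm _)).
  by rewrite normrM mulrC ler_wpM2r.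
rewrite RintegralZl//; last exact: (integrable_norm iz).
rewrite ler_wpM2l// -lee_fin; apply: le_trans hoelder.
rewrite /Rintegral fineK//; apply: integrable_fin_num => //; exact: (integrable_norm iz).
Qed.

(* A suitable translation of length comparable with [mu (superlevel u k) `^ N^-1] moves half
   of [superlevel u h] off [superlevel u k]. *)
Lemma superlevel_decay (z u : RN -> R) k h p Z : (0 < N)%N -> 0 <= k -> k < h -> (1 <= p)%E ->
  weak_solution Omega s lam phi f z u -> measurable_fun (Omega : set (euclid R N)) z ->
  norm_Lp Omega p z = Z%:E ->
  (h - k) * fine (mu (superlevel u h)) <=
    2 * K * 3 `^ (2 * s / N%:R) * Z *
    fine (mu (superlevel u k)) `^ (hoelder_gap p + 2 * s / N%:R).
Proof.
move=> N0 k0 kh p1 wu mz NZ.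
have [[[/L2P su _] _] _] := wu; have [mu_ _] := su.
have Z0 : 0 <= Z by rewrite -lee_fin -NZ; exact: Lnorm_ge0.
have hk : 0 < h - k by rewrite subr_gt0.
have mAh := measurable_superlevel h mu_; have mAk := measurable_superlevel k mu_.
have Ahf : mu (superlevel u h) \is a fin_num by rewrite ge0_fin_numE ?superlevel_lty.
have Akf : mu (superlevel u k) \is a fin_num by rewrite ge0_fin_numE ?superlevel_lty.
pose mh := fine (mu (superlevel u h)); pose mk := fine (mu (superlevel u k)).
rewrite -/mh -/mk.
have mhE : mu (superlevel u h) = mh%:E by rewrite fineK.
have mkE : mu (superlevel u k) = mk%:E by rewrite fineK.
have mh0 : 0 <= mh by exact: fine_ge0.
have mhk : mh <= mk by rewrite -lee_fin -mhE -mkE superlevel_le// ltW.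
(* A null superlevel set at [h] is set aside, as [small_correlation] asks for positive measure. *)
move: mh0; rewrite le_eqVlt => /predU1P[<-|mh0].
  by rewrite mulr0 !mulr_ge0 ?powR_ge0// ltW.
have mk0 : 0 < mk by exact: lt_le_trans mhk.
have n0 : (0 : R) < N%:R by rewrite ltr0n.
(* Gives [r ^+ N = 3 * mk], above the [2 * mk] required by [small_correlation]. *)
pose r := (3 * mk) `^ (N%:R^-1).
have r0 : 0 < r by rewrite powR_gt0// mulr_gt0.
have rN : r ^+ N = 3 * mk.
  by rewrite -powR_mulrn ?(ltW r0)// -powRrM mulVf ?lt0r_neq0// powRr1// mulr_ge0// ltW.
have [||y yr hy] := @small_correlation R N (superlevel u h) (superlevel u k) r mAh mAk
    (superlevel_lty h mu_) _ r0.
- by rewrite mhE lte_fin.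
- by rewrite mkE -EFinM lte_fin rN ltr_pM2r// ltr_nat.
have yr' i : `|y ord0 i| <= r by have /andP[y0 y1] := yr i; rewrite ger0_norm.
have mS : measurable (rVshift y @^-1` superlevel u k : set (euclid R N)).
  by rewrite -[X in measurable X]setTI; apply: measurable_rVshift.
(* At a point [x] of [E] the extended truncation has absolute value [h - k], while it vanishes at
   [x + y]. *)
pose E : set (euclid R N) := superlevel u h `\` rVshift y @^-1` superlevel u k.
have mE : measurable E by exact: measurableD.
have ES : (mu E <= mu (superlevel u h))%E.
  by apply: le_measure; rewrite ?inE// => x [].
have Efin : (mu E < +oo)%E by apply: le_lt_trans ES _; exact: superlevel_lty.
have Ege : mh / 2 <= fine (mu E).
  rewrite mhE in hy; apply: ereal_split_half hy; rewrite -mhE.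
  exact: (measureDI mu mAh mS).
have [Q HQ Qz] := weak_solution_level wu k0 (ltW kh).
have st := truncation_sq k0 (ltW kh) su.
have d1 := displacement_fractional st r0 yr' HQ.
have d2 : (h - k) ^+ 2 * fine (mu E) <= Dsh y ((truncation k h \o u) \_ Omega).
  apply: displacement_ge => //; first exact: sqi_patch.
    exact: ltW.
  move=> x [[Ox /= hx] nx].
  have -> : ((truncation k h \o u) \_ Omega) x = truncation k h (u x) by rewrite patchE mem_set.
  have -> : ((truncation k h \o u) \_ Omega) (x + y) = 0.
    rewrite patchE; case: ifPn => // /set_mem Oxy /=.
    rewrite truncation_small// leNgt; apply/negP => kx; exact: nx.
  by rewrite sub0r normrN truncation_large// ltW.
have d3 := load_truncation k0 (ltW kh) p1 mu_ mz NZ; rewrite -/mk in d3.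
have r2 : r `^ (2 * s) = 3 `^ (2 * s / N%:R) * mk `^ (2 * s / N%:R).
  by rewrite -powRM ?(ltW mk0)// /r -powRrM [_^-1 * _]mulrC.
rewrite powRD; last by rewrite (lt0r_neq0 mk0) implybT.
(* The displacement carries [(h - k) ^+ 2] and the load a single factor [h - k], which cancels. *)
rewrite -(ler_pM2l hk).
have rs0 : 0 <= K * r `^ (2 * s) by rewrite mulr_ge0 ?powR_ge0// ltW.
have d4 := le_trans Qz d3.
have d5 := ler_wpM2l rs0 d4.
have d6 : (h - k) ^+ 2 * (mh / 2) <= (h - k) ^+ 2 * fine (mu E).
  by rewrite ler_wpM2l ?sqr_ge0.
have {}d1 : Dsh y ((truncation k h \o u) \_ Omega) <= K * r `^ (2 * s) * Q by rewrite -mulrA.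
have := le_trans (le_trans d6 d2) (le_trans d1 d5); rewrite r2.
move: (mk `^ _) (mk `^ _) (3 `^ _) => a b c.
have -> : (h - k) ^+ 2 * (mh / 2) = (h - k) * ((h - k) * mh) / 2 by ring.
rewrite ler_pdivrMr// => /le_trans; apply.
by rewrite le_eqVlt; apply/orP; left; apply/eqP; ring.
Qed.

End level_estimate.

(** * Stampacchia's lemma and the main theorem *)

(* With [rho = 2 `^ - (b - 1)^-1], induction gives [g (d * (1 - 2 ^- n)) <= M * rho ^+ n]. *)
Lemma stampacchia {R : realType} (g : R -> R) (C M b d : R) :
  (forall k, 0 <= g k) -> (forall k h, k <= h -> g h <= g k) -> 0 <= C -> 0 < d ->
  1 < b -> g 0 <= M ->
  (forall k h, 0 <= k -> k < h -> (h - k) * g h <= C * g k `^ b) ->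
  2 * C * M `^ (b - 1) * 2 `^ ((b - 1)^-1) <= d -> g d = 0.
Proof.
move=> g0 gmono C0 d0 b1 gM gC hd.
have M0 : 0 <= M by exact: le_trans (g0 0) gM.
have b10 : 0 < b - 1 by rewrite subr_gt0.
have b0 : 0 < b by exact: lt_trans b1.
(* The power [b - 1] of [rho] is one half, which compensates the halving of the gap between
   consecutive levels. *)
pose rho : R := (2 `^ ((b - 1)^-1))^-1.
have tau0 : 0 < 2 `^ ((b - 1)^-1) :> R by rewrite powR_gt0.
have rho0 : 0 < rho by rewrite invr_gt0.
have rho1 : rho < 1.
  rewrite invf_lt1//; apply: (@le_lt_trans _ _ (1 `^ (b - 1)^-1)); first by rewrite powR1.
  by apply: gt0_ltr_powR; rewrite ?invr_gt0 ?nnegrE// ltr1n.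
have rhob : rho `^ b = rho / 2.
  rewrite /rho -powRN -powRrM (_ : - (b - 1)^-1 * b = - (b - 1)^-1 + - 1); last first.
    by field; rewrite lt0r_neq0.
  by rewrite powRD ?pnatr_eq0 ?implybT// powR_inv1.
have Mb : M `^ b = M * M `^ (b - 1).
  rewrite -[X in _ = X * _](powRr1 M0) -powRD; first by rewrite addrC subrK.
  by rewrite addrC subrK gt_eqF.
pose k n : R := d * (1 - (2^-1) ^+ n).
have k0 n : 0 <= k n by rewrite mulr_ge0 ?(ltW d0)// subr_ge0 exprn_ile1// invf_le1 ?ler1n.
have kS n : k n.+1 - k n = d * (2^-1) ^+ n.+1.
  by rewrite /k exprS; move: ((2^-1) ^+ n) => x; field.
have p0 n : 0 < (2^-1) ^+ n :> R by rewrite exprn_gt0// invr_gt0.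
have key n : g (k n) <= M * rho ^+ n.
  elim: n => [|n IH]; first by rewrite /k !expr0 subrr mulr0 mulr1.
  have kk : k n < k n.+1 by rewrite -subr_gt0 kS mulr_gt0.
  have h1 := gC _ _ (k0 n) kk; rewrite kS in h1.
  have h2 : g (k n) `^ b <= M * M `^ (b - 1) * (rho ^+ n * (2^-1) ^+ n).
    apply: (@le_trans _ _ ((M * rho ^+ n) `^ b)).
      by rewrite ge0_ler_powR// ?nnegrE ?(ltW b0)// mulr_ge0// exprn_ge0// ltW.
    rewrite powRM// ?exprn_ge0 ?(ltW rho0)// Mb -(powR_mulrn n (ltW rho0)) powRAC rhob.
    by rewrite !powR_mulrn ?divr_ge0 ?(ltW rho0)// exprMn.
  have h3 := le_trans h1 (ler_wpM2l C0 h2).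
  rewrite -(ler_pM2l (mulr_gt0 d0 (p0 n.+1))); apply: (le_trans h3).
  rewrite !exprS.
  have -> : C * (M * M `^ (b - 1) * (rho ^+ n * (2^-1) ^+ n)) =
     (2 * C * M `^ (b - 1) * 2 `^ ((b - 1)^-1)) * (M * rho ^+ n * rho * (2^-1 * (2^-1) ^+ n)).
    by rewrite /rho; field; rewrite lt0r_neq0.
  have -> : d * (2^-1 * (2^-1) ^+ n) * (M * (rho * rho ^+ n)) =
     d * (M * rho ^+ n * rho * (2^-1 * (2^-1) ^+ n)) by ring.
  by rewrite ler_wpM2r// !mulr_ge0// ?exprn_ge0 ?invr_ge0// ltW.
apply/eqP; rewrite eq_le g0 andbT.
have lim0 : (fun n => M * rho ^+ n) @ \oo --> (0 : R).
  rewrite -(mulr0 M); apply: cvgM; first exact: cvg_cst.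
  by apply: cvg_expr; rewrite ger0_norm// ltW.
apply: (cvgr_to_ge lim0); apply: nearW => n.
apply: le_trans (key n); apply: gmono.
by rewrite /k mulrBr mulr1 gerBl mulr_ge0// ltW.
Qed.

(** The exponent exceeds 1 exactly when [1 / p < 2 * s / N]. This is the hypothesis inverted when
    [N > 2 * s]; when [N = 2 * s] the right side is 1 and [p > 1]; when [N < 2 * s] it exceeds 1 and
    [p = 1]. *)
Lemma admissible_ge1 {R : realType} (N : nat) (s : R) (p : \bar R) : (1 <= N)%N -> 0 < s < 1 ->
  admissible_exponent N s p -> (1 <= p)%E /\ 1 < hoelder_gap p + 2 * s / N%:R.
Proof.
move=> N1 /andP[s0 s1] [h1 h2 h3].
have n0 : 0 < N%:R :> R by rewrite ltr0n.
have s20 : 0 < 2 * s by rewrite mulr_gt0.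
suff : (1 <= p)%E /\ fine p^-1 < 2 * s / N%:R.
  by move=> [-> h]; split => //; rewrite /hoelder_gap; move: h; lra.
have [lt|gt|eq] := ltgtP (2 * s) N%:R.
- have r1 : 1 < N%:R / (2 * s) by rewrite ltr_pdivlMr// mul1r.
  case: p h1 {h2 h3} => [r| |] h1 //; [|split|]; rewrite ?leey//.
  + have := h1 lt; rewrite lte_fin => rr.
    have rr1 := lt_trans r1 rr.
    have r0 := lt_trans ltr01 rr1.
    split; first by rewrite lee_fin ltW.
    rewrite inver gt_eqF//= -[ltRHS]invrK invf_div ltf_pV2 ?posrE//.
    by rewrite divr_gt0.
  + by rewrite invey/= divr_gt0.
  + by have := h1 lt.
- rewrite (h3 gt); split => //; rewrite inver oner_eq0/= invr1 ltr_pdivlMr// mul1r//.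
- have -> : 2 * s / N%:R = 1 by rewrite eq divff// lt0r_neq0.
  case: p h2 {h1 h3} => [r| |] h2.
  + have := h2 (esym eq); rewrite lte_fin => r1; have r0 := lt_trans ltr01 r1.
    by split; [rewrite lee_fin ltW|rewrite inver gt_eqF//= invf_lt1].
  + by rewrite leey invey.
  + by have := h2 (esym eq).
Qed.

(** * Essential bounds for the coefficients and the solution *)

Section main.
Context {R : realType} {N : nat} (Omega : set 'rV[R]_N).
Local Notation RN := 'rV[R]_N.
Local Notation mu := (@leb R N).

Lemma elliptic_bounds (a : 'I_N -> 'I_N -> RN -> R) : elliptic_coefficients Omega a ->
  exists M, forall i j, {ae mu, forall x, Omega x -> `|a i j x| <= M}.
Proof.
move=> [aL _ _].
have /choice[m hm] (ij : 'I_N * 'I_N) :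
    exists m : R, {ae mu, forall x, Omega x -> `|a ij.1 ij.2 x| <= m}.
  by have [mij nij] := aL ij.1 ij.2; exact: (ae_bounded_of_norm mij nij).
exists (\sum_ij `|m ij|) => i j.
have [A [mA A0 sA]] := hm (i, j); exists A; split => // x /= nx; apply: sA => /= h.
apply: nx => Ox; apply: (le_trans (h Ox)); apply: (le_trans (ler_norm _)).
by rewrite (bigD1 (i, j))//= lerDl sumr_ge0.
Qed.

(** The margin [e] keeps the level [d + e] positive, as Stampacchia's lemma requires, even when [d]
    is 0. *)
Lemma Lpy_of_ae_bound (u : RN -> R) (d : R) : measurable (Omega : set (euclid R N)) ->
  measurable_fun (Omega : set (euclid R N)) u -> 0 <= d ->
  (forall e : R, 0 < e -> mu (superlevel Omega u (d + e)) = 0%E) ->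
  (norm_Lp Omega +oo u <= d%:E)%E.
Proof.
move=> mO mu_ d0 hu.
rewrite /norm_Lp unlock; case: ifPn => // mu0.
apply/lee_addgt0Pr => e e0.
apply/ess_supP.
exists (superlevel Omega u (d + e)); split; [exact: measurable_superlevel|exact: hu|].
move=> x /= nx; apply/not_notP => nA; apply: nx; rewrite lee_fin patchE; case: ifPn => [/set_mem Ox|_].
  by rewrite leNgt; apply/negP => ux; exact: nA.
by rewrite normr0 addr_ge0// ltW.
Qed.

End main.

Theorem theorem3p7 (R : realType) (N : nat) (s : R) (p : \bar R)
    (Omega : set 'rV[R]_N) (a : 'I_N -> 'I_N -> 'rV[R]_N -> R) :
  (1 <= N)%N -> 0 < s < 1 ->
  open Omega -> bounded_set Omega ->
  elliptic_coefficients Omega a ->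
  admissible_exponent N s p ->
  exists2 C : R, 0 < C &
    forall (lambda : nat -> R) (phi : nat -> 'rV[R]_N -> R),
      eigenbasis Omega a lambda phi ->
    forall f : 'rV[R]_N -> R -> R, assumption_A Omega f ->
    forall z : 'rV[R]_N -> R, Lp Omega p z ->
    forall u : 'rV[R]_N -> R, weak_solution Omega s lambda phi f z u ->
      Lp Omega +oo%E u /\ (norm_Lp Omega +oo%E u <= C%:E * norm_Lp Omega p z)%E.
Proof.
move=> N1 s01 oO bO ea adm.
have mO : measurable (Omega : set (euclid R N)) by exact/borel_measurable/open_borel.
have Ofin : (@leb R N Omega < +oo)%E by exact: leb_bounded.
have [p1 b1] := admissible_ge1 N1 s01 adm.
have [M aM] := elliptic_bounds ea.
have [aL aC [gamma gamma0 aE]] := ea.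
have ma i j : measurable_fun (Omega : set (euclid R N)) (a i j) by have [] := aL i j.
pose K := 2 * N%:R / gamma + 8.
have K0 : 0 < K by rewrite ltr_wpDl// divr_ge0 ?mulr_ge0// ltW.
pose b := hoelder_gap p + 2 * s / N%:R; rewrite -/b in b1.
pose C0 := 2 * K * 3 `^ (2 * s / N%:R).
have C00 : 0 <= C0 by rewrite !mulr_ge0 ?powR_ge0// ltW.
pose m := fine (@leb R N Omega).
(* The threshold of [stampacchia] for the initial bound [m], without the factor [Z], the norm of the
   load; it involves neither the eigenbasis nor [f], [z] or [u]. *)
pose C1 := 2 * C0 * m `^ (b - 1) * 2 `^ ((b - 1)^-1).
have C10 : 0 <= C1.
  by rewrite mulr_ge0 ?powR_ge0// mulr_ge0 ?powR_ge0// mulr_ge0.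
(* The added 1 makes the constant positive even for an empty domain, where [C1] is 0. *)
exists (C1 + 1); first by rewrite ltr_wpDl.
move=> lam phi [[lam0 _ _] phiL phi_ortho phi_basis] f [fA mf _] z [mz zp] u wu.
have /choice[Dphi hDphi] n : exists Du, in_H10 Omega (phi n) Du /\
    forall v Dv, in_H10 Omega v Dv -> form_D Omega a Du Dv =
      integral_on Omega (fun x => lam n * phi n x * v x).
  by have [_ [Du h1 h2]] := phiL n; exists Du.
have Dphi_H10 n := (hDphi n).1; have Dphi_form n := (hDphi n).2.
have phi_sq n : sqi (@leb R N) (Omega : set (euclid R N)) (phi n).
  by have [[h _ _] _] := Dphi_H10 n; exact/L2P.
have [Z NZ] : exists Z, norm_Lp Omega p z = Z%:E.
  have := Lnorm_ge0 (@leb R N) p (EFin \o (z \_ Omega)).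
  by move: zp; rewrite /norm_Lp; case: (Lnorm _ _ _) => // r _ _; exists r.
have Z0 : 0 <= Z by rewrite -lee_fin -NZ; exact: Lnorm_ge0.
have [[[/L2P[mu_ _] _] _] _] := wu.
have contract := form_clamp mO Ofin ma aM aC gamma0 aE lam0 phi_sq Dphi_H10 Dphi_form phi_ortho phi_basis.
have disp := Dsh_form mO ma aM aC gamma0 aE lam0 phi_sq Dphi_H10 Dphi_form phi_ortho phi_basis.
have decay k h (k0 : 0 <= k) (kh : k < h) := superlevel_decay mO Ofin s01 K0 lam0 phi_sq
  phi_ortho contract disp mf fA N1 k0 kh p1 wu mz NZ.
have bound : (norm_Lp Omega +oo u <= (C1 * Z)%:E)%E.
  apply: (Lpy_of_ae_bound mO mu_); first exact: mulr_ge0.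
  move=> e e0.
  have fin k : leb (superlevel Omega u k) \is a fin_num.
    by rewrite ge0_fin_numE// superlevel_lty.
  rewrite -[LHS](fineK (fin _)); congr EFin.
  apply: (@stampacchia R (fun k => fine (leb (superlevel Omega u k))) (C0 * Z) m b) => //.
  - by move=> k; rewrite fine_ge0.
  - by move=> k h kh; apply: fine_le => //; exact: superlevel_le.
  - exact: mulr_ge0.
  - by rewrite ltr_wpDl// mulr_ge0.
  - apply: fine_le => //; first by rewrite ge0_fin_numE.
    apply: le_measure; rewrite ?inE//; first exact: measurable_superlevel.
    by move=> x [].
  - by rewrite (_ : 2 * (C0 * Z) * _ * _ = C1 * Z) ?lerDl ?ltW// /C1; ring.
split; first by split => //; apply: le_lt_trans bound (ltry _).
by apply: (le_trans bound); rewrite NZ -EFinM lee_fin ler_wpM2r// lerDl ler01.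
Qed.
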